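(* Let $G=(V,E)$ be a 3-connected graph and let $p:V\to\{-1,+1\}$ satisfy $\sum_{j\in V}p(j)=0$. If $|V|\equiv 0\pmod 4$, then there is a partition $(V_1,V_2)$ of $V$ such that $G[V_1]$ and $G[V_2]$ are connected, $p(V_1)=p(V_2)=0$ and $|V_1|=|V_2|$. If $|V|\equiv 2\pmod 4$, then there is a partition $(V_1,V_2)$ of $V$ such that $G[V_1]$ and $G[V_2]$ are connected, $p(V_1)=p(V_2)=0$ and $|V_1|=|V_2|+2$. Moreover, such a partition can be found in polynomial time.
   Context: For $S\subseteq V$, $p(S)=\sum_{j\in S}p(j)$, and $G[S]$ denotes the subgraph of $G$ induced by $S$. A partition $(V_1,V_2)$ of $V$ means $V_1\cap V_2=\emptyset$ and $V_1\cup V_2=V$. *)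

(* Defs.v *)
From mathcomp Require Import all_boot all_order all_algebra.

Set Implicit Arguments.
Unset Strict Implicit.
Unset Printing Implicit Defensive.

(* A graph on the vertex type T is given by its adjacency relation e : rel T,
   assumed symmetric and irreflexive wherever a simple graph is meant. *)

Definition induced (T : finType) (e : rel T) (S : {set T}) : rel T :=
  [rel x y | [&& x \in S, y \in S & e x y]].

(* The null graph does not count as connected. *)
Definition connected_on (T : finType) (e : rel T) (S : {set T}) : Prop :=
  S != set0 /\ {in S &, forall x y, connect (induced e S) x y}.

Definition k_connected (k : nat) (T : finType) (e : rel T) : Prop :=
  k < #|T| /\ forall X : {set T}, #|X| < k -> connected_on e (~: X).

Definition weight (T : finType) (p : T -> int) (S : {set T}) : int :=
  (\sum_(j in S) p j)%R.

Definition bipartition (T : finType) (V1 V2 : {set T}) : Prop :=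
  V1 :&: V2 = set0 /\ V1 :|: V2 = [set: T].

(* Computation model for running times: a random access machine programmed in a
   structured language, with registers and arrays of natural numbers, both named
   by natural numbers, of which a program can mention only finitely many.  Array
   cells are addressed indirectly.  Every operation has unit cost.  Addition and
   truncated subtraction are the only arithmetic operations, so each unit of
   cost lengthens the numbers in use by at most one bit; hence polynomial time on
   this machine coincides with polynomial time on a Turing machine. *)

Inductive expr : Type :=
  | ECst of nat
  | EReg of nat
  | EGet of nat & expr
  | EAdd of expr & expr
  | ESub of expr & expr.

Inductive cmd : Type :=
  | CSkip
  | CSet of nat & expr
  | CPut of nat & expr & expr
  | CSeq of cmd & cmd
  | CIf of expr & cmd & cmd
  | CWhile of expr & cmd.

Record store : Type := Store { reg : nat -> nat; arr : nat -> nat -> nat }.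

Fixpoint eval (s : store) (a : expr) : nat :=
  match a with
  | ECst c => c
  | EReg x => reg s x
  | EGet A i => arr s A (eval s i)
  | EAdd a1 a2 => eval s a1 + eval s a2
  | ESub a1 a2 => eval s a1 - eval s a2
  end.

Fixpoint cost (a : expr) : nat :=
  match a with
  | ECst _ | EReg _ => 1
  | EGet _ i => (cost i).+1
  | EAdd a1 a2 | ESub a1 a2 => (cost a1 + cost a2).+1
  end.

Definition set_reg (s : store) (x v : nat) : store :=
  Store (fun y => if y == x then v else reg s y) (arr s).

Definition set_arr (s : store) (A i v : nat) : store :=
  Store (reg s)
        (fun B j => if (B == A) && (j == i) then v else arr s B j).

(* exec c s t s': started in s, the program c halts in s' after t steps.
   A test succeeds when its value is nonzero. *)
Inductive exec : cmd -> store -> nat -> store -> Prop :=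
  | ExecSkip s : exec CSkip s 1 s
  | ExecSet s x a : exec (CSet x a) s (cost a).+1 (set_reg s x (eval s a))
  | ExecPut s A i a :
      exec (CPut A i a) s (cost i + cost a).+1
           (set_arr s A (eval s i) (eval s a))
  | ExecSeq c1 c2 s s1 s2 t1 t2 :
      exec c1 s t1 s1 -> exec c2 s1 t2 s2 -> exec (CSeq c1 c2) s (t1 + t2) s2
  | ExecIfTrue a c1 c2 s s1 t :
      eval s a != 0 -> exec c1 s t s1 -> exec (CIf a c1 c2) s (cost a + t) s1
  | ExecIfFalse a c1 c2 s s1 t :
      eval s a = 0 -> exec c2 s t s1 -> exec (CIf a c1 c2) s (cost a + t) s1
  | ExecWhileTrue a c s s1 s2 t1 t2 :
      eval s a != 0 -> exec c s t1 s1 -> exec (CWhile a c) s1 t2 s2 ->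
      exec (CWhile a c) s (cost a + t1 + t2) s2
  | ExecWhileFalse a c s :
      eval s a = 0 -> exec (CWhile a c) s (cost a) s.

(* Adjacency matrix of a graph on {0, ..., n-1}, in row-major order, as a total
   function on addresses: 0 beyond the n * n entries. *)
Definition adj_array (n : nat) (e : rel 'I_n) (a : nat) : nat :=
  [exists i : 'I_n, exists j : 'I_n, (a == i * n + j) && e i j].

(* Signs: 1 for vertices with p = +1, 0 for vertices with p = -1. *)
Definition sign_array (n : nat) (p : 'I_n -> int) (a : nat) : nat :=
  [exists i : 'I_n, (a == i) && (p i == 1%R)].

(* Register 0 holds n, array 0 the adjacency matrix, array 1 the signs. *)
Definition graph_input (n : nat) (e : rel 'I_n) (p : 'I_n -> int) : store :=
  Store (fun x => if x == 0 then n else 0)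
        (fun A => if A == 0 then adj_array e
                  else if A == 1 then sign_array p else fun=> 0).

(* Vertex i is in the output set when cell i of array 2 is nonzero. *)
Definition set_output (n : nat) (s : store) : {set 'I_n} :=
  [set i : 'I_n | arr s 2 i != 0].

(* Main.v *)
(* After Linial, Lovasz and Wigderson one would draw G in the plane so that every
   vertex outside a fixed cycle is in the convex hull of its neighbours; the
   orders read off by a rotating line go from an order to its reverse by swaps of
   adjacent vertices, all initial and final segments being connected, and the
   weight of an initial segment of even length 2h, the least even number at least
   |V|/2, changes by at most 2 per swap, hence vanishes somewhere.

   Here this is done without geometry.  Contract contractible edges of G one by
   one until two vertices are left.  An order of a contraction is valid if every
   vertex but the first has an earlier neighbour and every vertex but the last a
   later one; it expands to a valid order of the graph before the contraction,
   the contracted vertex being replaced by its two vertices in a suitable order.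
   Two valid orders that differ by a swap admit a common choice, so that their
   expansions are joined by at most four swaps through valid orders.  Starting
   from the two orders of the last graph, whose full expansions are reverse to
   each other, one keeps a pair of orders at distance one swap whose full
   expansions have weights of opposite signs, and descends to G.

   This descent is an algorithm.  It is written as a term of a small functional
   language whose only loops run from 0 to n - 1, so that every term compiles to
   a machine program of polynomial cost. *)

Require Import Defs.
From mathcomp Require Import all_boot all_order all_algebra.
From mathcomp Require Import zify.
From Stdlib Require Import FunctionalExtensionality.

Set Implicit Arguments.
Unset Strict Implicit.
Unset Printing Implicit Defensive.

(** * Contractible edges *)

(** Two demands pull the expansion of an order apart. It must commute with reversal, so that the two
    orders of the last graph have reverse full expansions; and two neighbouring orders must replace
    the contracted vertex in the same way, so that one swap does not expand into many. The first is
    met by a canonical rule that looks at one order only, with ties broken by the two vertices that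
    survive every contraction; the second by a rule that looks at both orders. Passing from one rule
    to the other costs at most one swap at either end, since it can only exchange the two new
    vertices. Graphs and orders are Boolean relations defined by quantifiers over vertices, the edge
    to contract is the lexicographically least one, and connectivity is an iteration of fixed
    length. Thus every step of the descent is a formula with bounded loops, which the small language
    can evaluate as it stands, and the mathematical proof is about the very objects that the program
    computes. *)

Section Levels.
Variable T : finType.
Implicit Types (R : rel T) (C D X Y S : {set T}).

(* A graph on a set of vertices is a symmetric relation that is reflexive exactly
   on that set. *)
Definition alive R : {set T} := [set u | R u u].

Definition fragment R X C : bool :=
  [&& C \subset alive R, C != set0, [disjoint C & X],
      [forall u in C, forall v, R u v ==> (v \in C :|: X)]
    & ~~ (alive R \subset C :|: X)].

(** No lower bound on the number of vertices is imposed, in contrast to [k_connected 3]: a triangle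
    and a single edge are levels too, so contraction can go on down to two vertices. *)
Record level R : Prop := Level {
  level_sym : symmetric R;
  level_refl : forall u v, R u v -> R u u;
  level_conn : forall X C, #|X| <= 2 -> ~~ fragment R X C }.

Lemma fragmentP R X C :
  reflect [/\ C \subset alive R, C != set0, [disjoint C & X],
             (forall u v, u \in C -> R u v -> v \in C :|: X)
           & ~~ (alive R \subset C :|: X)] (fragment R X C).
Proof.
apply: (iffP and5P) => -[sCA C0 dCX clC nA]; split=> //.
  by move=> u v uC Ruv; have /forall_inP/(_ u uC)/forallP/(_ v)/implyP := clC; apply.
by apply/forall_inP=> u uC; apply/forallP=> v; apply/implyP; exact: clC.
Qed.

Lemma fragment_coside R X C : level R ->
  fragment R X C -> fragment R X (alive R :\: (C :|: X)).
Proof.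
move=> lR /fragmentP[sCA C0 dCX clC nA]; apply/fragmentP; split.
- exact: subsetDl.
- by rewrite setD_eq0.
- rewrite disjoint_sym disjoints_subset; apply/subsetP=> u uX.
  by rewrite !inE uX orbT.
- move=> u v; rewrite !inE negb_or => /andP[/andP[uC uX] _] Ruv.
  have Rvu: R v u by rewrite (level_sym lR).
  rewrite (level_refl lR Rvu) andbT negb_or.
  case vX: (v \in X); first by rewrite orbT.
  rewrite andbT orbF; apply/negP=> vC.
  by have := clC _ _ vC Rvu; rewrite inE (negPf uC) (negPf uX).
- case/set0Pn: C0 => u uC; apply/subsetPn; exists u; first exact: (subsetP sCA).
  by rewrite !inE uC /= (disjointFr dCX uC).
Qed.

Lemma fragment_shrink R X Y C : fragment R X C -> Y \subset X ->
  (forall u v, u \in C -> R u v -> v \in X -> v \in Y) -> fragment R Y C.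
Proof.
move=> /fragmentP[sCA C0 dCX clC nA] sYX H; apply/fragmentP; split=> //.
- exact: disjointWr dCX.
- move=> u v uC Ruv; have := clC _ _ uC Ruv; rewrite !inE => /orP[->//|vX].
  by rewrite (H u v) ?orbT.
- by apply: contra nA => /subset_trans; apply; apply: setUS.
Qed.

Lemma disjointsU1 x C D : [disjoint x |: C & D] = (x \notin D) && [disjoint C & D].
Proof. by rewrite disjoints_subset subUset sub1set inE -disjoints_subset. Qed.

Lemma card_set2_le (x y : T) : #|[set x; y]| <= 2.
Proof. by rewrite cards2; case: (x != y). Qed.

(** Otherwise [z] could be dropped from the cut set, leaving at most two vertices. *)
Lemma fragment_nbr R x y z C : level R -> fragment R [set x; y; z] C ->
  exists2 v, v \in C & R z v.
Proof.
move=> lR fC.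
case: (boolP [exists v in C, R z v]) => [/exists_inP[v vC zv]|nz]; first by exists v.
have: fragment R [set x; y] C.
  apply: fragment_shrink fC (subsetUl _ _) _ => u v uC Ruv.
  rewrite [v \in _ :|: [set z]]inE => /orP[//|]; rewrite inE => /eqP vz.
  by case/negP: nz; apply/exists_inP; exists u => //; rewrite (level_sym lR) -vz.
by rewrite (negPf (level_conn lR _ (card_set2_le x y))).
Qed.

Definition solid R x y := forall z C, ~~ fragment R [set x; y; z] C.

(** Thomassen's argument, as a descent on the size of a side [C] of a separator through the edge
    [xy]. The third cut vertex [z] has a neighbour [v] in [C]. If [zv] is not solid, some separator
    contains it, and one of its sides misses [x] and [y]; the part of that side within [C] is again
    a side, and smaller because it misses [v]. *)
Lemma contractible_edge_aux R m x y z C : level R -> #|C| <= m -> R x y ->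
  fragment R [set x; y; z] C ->
  exists x' y', [/\ x' != y', R x' y' & solid R x' y'].
Proof.
move=> lR; elim: m x y z C => [|m IHm] x y z C leC Rxy fC.
  move: leC; rewrite leqn0 cards_eq0 => /eqP C0.
  by case/fragmentP: fC => _; rewrite C0 eqxx.
have [v vC zv] := fragment_nbr lR fC.
have [sCA C0 dCX clC nA] := fragmentP _ _ _ fC.
have zv_neq : z != v.
  by apply: contraTneq vC => <-; rewrite (disjointFl dCX) // !inE eqxx orbT.
case: (boolP [exists w, exists D, fragment R [set z; v; w] D]); last first.
  move=> /existsPn nf; exists z, v; split=> // w D.
  by have /existsPn/(_ D) := nf w.
move=> /existsP[w /existsP[D0 fD0]].
(* No edge joins opposite sides of a separator, so [D0] or the side opposite to it misses both [x]
   and [y]. *)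
have [D fD] : exists2 D, fragment R [set z; v; w] D & (x \notin D) && (y \notin D).
  case: (boolP ((x \notin D0) && (y \notin D0))) => [nD0|]; first by exists D0.
  have [_ _ _ clD _] := fragmentP _ _ _ fD0.
  have Ryx : R y x by rewrite (level_sym lR).
  rewrite negb_and !negbK => xyD; exists (alive R :\: (D0 :|: [set z; v; w])).
    exact: fragment_coside.
  have H u t : R u t -> u \in D0 -> (u \notin alive R :\: (D0 :|: [set z; v; w])) && (t \notin alive R :\: (D0 :|: [set z; v; w])).
    by move=> Rut uD; have := clD _ _ uD Rut; rewrite !inE uD /= => ->.
  by case/orP: xyD => [/(H _ _ Rxy)//|/(H _ _ Ryx)]; rewrite andbC.
move=> /andP[xD yD].
have [sDA D_n0 dDX clD nDA] := fragmentP _ _ _ fD.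
have [u uD vu] : exists2 u, u \in D & R v u.
  apply: (@fragment_nbr R z w v D lR).
  by rewrite -setUA [[set w; v]]setUC setUA.
have zD : z \notin D by rewrite (disjointFl dDX) // !inE eqxx.
have vD : v \notin D by rewrite (disjointFl dDX) // !inE eqxx orbT.
have inC t : t \in D -> t \in C :|: [set x; y; z] -> t \in C.
  move=> tD; rewrite !inE => /orP[//|].
  by case/orP=> [/orP[]|] /eqP tt; move: tD; rewrite tt (negPf xD, negPf yD, negPf zD).
apply: (IHm z v w (D :&: C)) => //.
  rewrite -ltnS; apply: leq_trans leC; apply: proper_card; apply/properP; split.
    exact: subsetIr.
  by exists v; rewrite // inE (negPf vD).
apply/fragmentP; split.
- by rewrite subIset // sDA.
- by apply/set0Pn; exists u; rewrite inE uD inC //; exact: clC vu.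
- by apply: disjointWl dDX; exact: subsetIl.
- move=> s t; rewrite inE => /andP[sD sC] Rst.
  have := clD _ _ sD Rst; rewrite inE => /orP[tD|tX].
    by rewrite 2!inE tD inC //; exact: clC Rst.
  by rewrite inE tX orbT.
- by apply: contra nDA => /subset_trans; apply; apply: setSU; exact: subsetIl.
Qed.

Lemma level_edge R a : level R -> 1 < #|alive R| -> a \in alive R ->
  exists2 b, a != b & R a b.
Proof.
move=> lR; rewrite inE => A2 aA.
case: (boolP [exists b, (a != b) && R a b]) => [/existsP[b /andP[]]|/existsPn nE].
  by exists b.
have: fragment R set0 [set a].
  apply/fragmentP; split.
  - by rewrite sub1set inE.
  - by rewrite -cards_eq0 cards1.
  - by rewrite disjoint_sym disjoints_subset sub0set.
  - move=> u v /set1P-> Rav; rewrite setU0 inE.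
    by have := nE v; rewrite Rav andbT negbK eq_sym.
  - rewrite setU0; apply: contraL A2 => /subset_leq_card.
    by rewrite cards1 -leqNgt.
by rewrite (negPf (level_conn lR _ _)) // cards0.
Qed.

Lemma contractible_edge R : level R -> 1 < #|alive R| ->
  exists x y, [/\ x != y, R x y & solid R x y].
Proof.
move=> lR A2.
have /card_gt0P[a aA] : 0 < #|alive R| by apply: ltnW.
have [b ab Rab] := level_edge lR A2 aA.
case: (boolP [exists z, exists C, fragment R [set a; b; z] C]).
  by move=> /existsP[z /existsP[C fC]]; exact: contractible_edge_aux fC.
move=> /existsPn nf; exists a, b; split=> // w D.
by have /existsPn/(_ D) := nf w.
Qed.

(* The vertices reachable from a outside X, as an increasing iteration that the
   program can carry out. *)
Definition reach_next R X (a : T) S : {set T} :=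
  [set b | [&& R b b, b \notin X & (b == a) || [exists c, (c \in S) && R c b]]].

Definition reached R X a b : bool := b \in iter #|T| (reach_next R X a) set0.

Definition connected_off R X : bool :=
  [forall a, forall b, [&& R a a, a \notin X, R b b & b \notin X] ==> reached R X a b].

(** The set reached from [a] is the least one containing [a] and closed under adjacency outside [X].
    It stays inside any fragment that contains [a], and it is itself a fragment when it misses a
    live vertex outside [X]. *)
Lemma connected_offP R X : level R ->
  reflect (forall C, ~~ fragment R X C) (connected_off R X).
Proof.
move=> lR; apply: (iffP idP) => [cX C|nf].
  apply/negP=> /fragmentP[sCA /set0Pn[a aC] dCX clC /subsetPn[b bA]].
  rewrite !inE negb_or => /andP[bC bX].
  have aX := disjointFr dCX aC.
  have: reached R X a b.
    have /forallP/(_ a)/forallP/(_ b)/implyP := cX; apply.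
    by move: (subsetP sCA a aC) bA; rewrite !inE aX bX => -> ->.
  apply/negP; apply: contra bC; apply: subsetP; elim: #|T| => [|i IHi].
    exact: sub0set.
  apply/subsetP=> c; rewrite inE => /and3P[_ cX' /orP[/eqP->//|/existsP[d /andP[dS Rdc]]]].
  have := clC d c (subsetP IHi d dS) Rdc.
  by rewrite inE (negPf cX') orbF.
apply/forallP=> a; apply/forallP=> b; apply/implyP=> /and4P[aA aX bA bX].
have mono : {homo reach_next R X a : S S' / S \subset S'}.
  move=> S S' /subsetP sS; apply/subsetP=> c; rewrite !inE => /and3P[-> -> /orP[->//|]].
  case/existsP=> d /andP[dS Rdc]; apply/orP; right; apply/existsP; exists d.
  by rewrite Rdc (sS d dS).
(* A monotone operator iterated from the empty set is stationary after [#|T|] rounds. *)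
have fixC := fixsetK mono.
rewrite -/(fixset _) in fixC *.
set C := fixset _ in fixC.
have CE c : (c \in C) = [&& R c c, c \notin X & (c == a) || [exists d, (d \in C) && R d c]].
  by rewrite -{1}fixC inE.
apply: contraT => nab; have /negP[] := nf C; apply/fragmentP; split.
- by apply/subsetP=> c; rewrite CE inE => /and3P[].
- by apply/set0Pn; exists a; rewrite CE aA aX eqxx.
- by rewrite disjoints_subset; apply/subsetP=> c; rewrite CE inE => /and3P[].
- move=> u v uC Ruv; rewrite inE CE.
  have Rvu : R v u by rewrite (level_sym lR).
  rewrite (level_refl lR Rvu) /=; case: (v \in X); rewrite ?orbT //=.
  by rewrite orbF; apply/orP; right; apply/existsP; exists u; rewrite uC.
- by apply/subsetPn; exists b; rewrite !inE // negb_or bX andbT.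
Qed.

Definition contractible R x y : bool :=
  [&& x != y, R x y & [forall z, connected_off R [set x; y; z]]].

Lemma contractibleP R x y : level R ->
  reflect [/\ x != y, R x y & solid R x y] (contractible R x y).
Proof.
move=> lR; apply: (iffP and3P) => -[xy Rxy sxy]; split=> //.
  by move=> z; apply/(connected_offP _ lR); apply: (forallP sxy).
by apply/forallP=> z; apply/(connected_offP _ lR); apply: sxy.
Qed.

(* The edge xy is contracted onto x. *)
Definition contract R x y : rel T := fun u v =>
  [&& u != y, v != y & [|| R u v, (u == x) && R y v | (v == x) && R u y]].

Section Contract.
Variables (R : rel T) (x y : T).
Hypotheses (lR : level R) (xy : x != y) (Rxy : R x y).

Lemma alive_contract : alive (contract R x y) = alive R :\ y.
Proof.
apply/setP=> u; rewrite !inE /contract; case: eqP => //= _.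
case: eqP => [->|_] /=; last by rewrite orbF.
by rewrite (level_refl lR Rxy).
Qed.

(** A separator [X] of the contracted graph lifts to the graph. If it contains [x], adding [y] gives
    a separator of at most three vertices through the edge, which solidity excludes. Otherwise [y]
    joins the side on which [x] lies, and at most two vertices separate the graph. *)
Lemma contract_level : solid R x y -> level (contract R x y).
Proof.
have Ryx : R y x by rewrite (level_sym lR).
move=> sR; split.
- move=> u v; rewrite /contract (level_sym lR u v) (level_sym lR y v) (level_sym lR u y).
  by rewrite andbCA; congr [&& _, _ & _ || _]; rewrite orbC.
- move=> u v; rewrite /contract => /and3P[-> _ /or3P[Ruv|/andP[/eqP-> _]|/andP[_ Ruy]]].
  + by rewrite (level_refl lR Ruv).
  + by rewrite (level_refl lR Rxy).
  + by rewrite (level_refl lR Ruy).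
move=> X C X2; apply/negP=> /fragmentP[]; rewrite alive_contract => sCA C0 dCX clC nA.
have yC : y \notin C by apply/negP=> /(subsetP sCA); rewrite !inE eqxx.
have clR u v : u \in C -> R u v -> v != y -> v \in C :|: X.
  move=> uC Ruv vy; apply: (clC u) => //; rewrite /contract Ruv vy.
  by rewrite (contraNneq _ yC) // => <-.
have clx u : u \in C -> R u y -> x \in C :|: X.
  move=> uC Ruy; apply: (clC u) => //; rewrite /contract eqxx xy Ruy !orbT.
  by rewrite (contraNneq _ yC) // => <-.
have sCR : C \subset alive R by apply: subset_trans sCA (subsetDl _ _).
have nAR : ~~ (alive R \subset C :|: (y |: X)).
  apply: contra nA => /subsetP sA; apply/subsetP=> u.
  by rewrite !inE => /andP[uy Ru]; have := sA u; rewrite !inE (negPf uy); apply.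
case: (boolP (x \in X)) => xX.
  (* [X] may be [{x}] alone, in which case [z] is [x]. *)
  have [z XE] : exists z, X = [set x; z].
    have := cardsD1 x X; rewrite xX; case: (#|X :\ x| =P 0) => [/cards0_eq X0|].
      by exists x; rewrite -(setD1K xX) X0 setU0 setUid.
    move=> n0 e1; have /cards1P[z Ez] : #|X :\ x| == 1 by lia.
    by exists z; rewrite -(setD1K xX) Ez.
  have /negP[] := sR z C; apply/fragmentP.
  have -> : [set x; y; z] = y |: X by rewrite XE setUA [y |: [set x]]setUC.
  split=> //.
  - by rewrite disjoint_sym disjointsU1 ?yC //= disjoint_sym.
  - move=> u v uC Ruv; have [->|vy] := eqVneq v y; first by rewrite !inE eqxx orbT.
    by have := clR u v uC Ruv vy; rewrite !inE => /orP[]->; rewrite ?orbT.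
case: (boolP (x \in C)) => xC.
  have /negP[] := @level_conn _ lR (X :\ y) (y |: C) (leq_trans (subset_leq_card (subsetDl _ _)) X2).
  apply/fragmentP; split.
  - by rewrite subUset sCR sub1set inE (level_refl lR Ryx).
  - by apply/set0Pn; exists y; rewrite !inE eqxx.
  - rewrite disjointsU1 ?inE ?eqxx //=; apply: disjointWr dCX; exact: subsetDl.
  - move=> u v; rewrite !inE; have [->|vy] := eqVneq v y; first by [].
    move=> /orP[/eqP->|uC] Ruv /=; last by have := clR _ _ uC Ruv vy; rewrite inE.
    have := clC x v xC; rewrite /contract eqxx xy vy Ruv orbT /= !inE; exact.
  - apply: contra nAR; apply: (fun h => @subset_trans _ _ _ _^~ h).
    by apply/subsetP=> u; rewrite !inE; case: (u == y); case: (u \in C); case: (u \in X).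
have /negP[] := @level_conn _ lR X C X2; apply/fragmentP; split=> //.
- move=> u v uC Ruv; have [vy|vy] := eqVneq v y; last exact: clR Ruv vy.
  by have := clx u uC; rewrite -vy Ruv inE (negPf xC) (negPf xX) => /(_ isT).
- by apply: contra nAR => /subset_trans; apply; apply: setUS; exact: subsetUr.
Qed.

End Contract.
End Levels.

(** * Orders *)

Lemma rel_ext (T : Type) (P Q : rel T) : (forall u v, P u v = Q u v) -> P = Q.
Proof.
by move=> PQ; apply: functional_extensionality => u; apply: functional_extensionality.
Qed.

Section Orders.
Variable T : finType.
Implicit Types (R P Q : rel T) (A X : {set T}).

Definition reverse P : rel T := fun u v => P v u.

Record linear_order A P : Prop := LinearOrder {
  linear_sub : forall u v, P u v -> (u \in A) && (v \in A);
  linear_irr : forall u, P u u = false;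
  linear_trans : forall v u w, P u v -> P v w -> P u w;
  linear_total : forall u v, u \in A -> v \in A -> u != v -> P u v || P v u }.

Definition early R P := forall w v, P w v -> exists2 u, R u v & P u v.

(* Validity makes initial and final segments connected. *)
Record valid R P : Prop := Valid {
  valid_linear : linear_order (alive R) P;
  valid_early : early R P;
  valid_late : early R (reverse P) }.

(** For linear orders on the same set this means equality or a swap of two consecutive elements:
    transitivity forces [a] and [b] to be consecutive if the orders disagree on them. *)
Definition near P Q := exists a b, forall u v, P u v != Q u v ->
  (u == a) && (v == b) || (u == b) && (v == a).

Lemma linear_rev A P : linear_order A P -> linear_order A (reverse P).
Proof.
case=> sA irr tr tot; split=> //.
- by move=> u v /sA; rewrite andbC.
- by move=> v u w Pvu Pwv; apply: tr Pvu.
- by move=> u v uA vA uv; rewrite orbC; apply: tot.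
Qed.

Lemma valid_rev R P : valid R P -> valid R (reverse P).
Proof. by case=> lP eP fP; split=> //; apply: linear_rev. Qed.

Lemma near_refl P (a : T) : near P P.
Proof. by exists a, a => u v; rewrite eqxx. Qed.

Lemma near_sym P Q : near P Q -> near Q P.
Proof. by case=> a [b ab]; exists a, b => u v; rewrite eq_sym; apply: ab. Qed.

Lemma linear_asym A P u v : linear_order A P -> P u v -> P v u = false.
Proof.
move=> lP Puv; apply/negP => Pvu; have := linear_trans lP Puv Pvu.
by rewrite (linear_irr lP).
Qed.

(** A swap as seen from [x]: it leaves [x] alone, or it exchanges [x] with some [z]. The second case
    is directed, [x] coming first in [P]; [nearP] provides one of the two directions. *)
Variant near_at x P Q : Prop :=
  | NearSame of (forall u, P u x = Q u x) & (forall u, P x u = Q x u)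
  | NearSwap z of P x z & Q z x & (forall u, u != z -> P u x = Q u x)
      & (forall u, u != z -> P x u = Q x u)
      & (forall u v, u != x -> v != x -> P u v = Q u v).

Lemma nearP A x P Q : linear_order A P -> linear_order A Q -> near P Q ->
  near_at x P Q \/ near_at x Q P.
Proof.
move=> lP lQ [a [b ab]].
have swap z : P x z != Q x z ->
    near_at x P Q \/ near_at x Q P.
  move=> dz; have zx : z != x by apply: contraNneq dz => ->; rewrite (linear_irr lP) (linear_irr lQ).
  have H u v : P u v != Q u v -> (u == x) && (v == z) || (u == z) && (v == x).
    by move: (ab _ _ dz) => /orP[]/andP[/eqP-> /eqP->] /ab //; rewrite orbC.
  have H1 u : u != z -> P u x = Q u x.
    move=> uz; apply/eqP; apply: contraT => /H; rewrite (negPf uz) orbF.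
    by rewrite [x == z]eq_sym (negPf zx) andbF.
  have H2 u : u != z -> P x u = Q x u.
    move=> uz; apply/eqP; apply: contraT => /H; rewrite (negPf uz) andbF /=.
    by rewrite [x == z]eq_sym (negPf zx).
  have H3 u v : u != x -> v != x -> P u v = Q u v.
    move=> ux vx; apply/eqP; apply: contraT => /H; rewrite (negPf ux) (negPf vx).
    by rewrite andbF.
  case Pxz: (P x z); case Qxz: (Q x z); move: dz; rewrite Pxz Qxz // => _.
    left; apply: (NearSwap (z := z)) => //.
    have /andP[xA zA] := linear_sub lP Pxz.
    by have := linear_total lQ xA zA; rewrite eq_sym zx Qxz /=; apply.
  right; apply: (NearSwap (z := z)) => //.
  - have /andP[xA zA] := linear_sub lQ Qxz.
    by have := linear_total lP xA zA; rewrite eq_sym zx Pxz /=; apply.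
  - by move=> u /H1.
  - by move=> u /H2.
  - by move=> u v ux vx; rewrite H3.
case: (boolP [exists z, P x z != Q x z]) => [/existsP[z]|/existsPn same]; first exact: swap.
have same2 u : P x u = Q x u by apply/eqP; have := same u; rewrite negbK.
left; apply: NearSame => // u.
have [->|ux] := eqVneq u x; first exact: same2.
apply/idP/idP => [Pux|Qux].
  have /andP[uA xA] := linear_sub lP Pux.
  by have := linear_total lQ uA xA ux; rewrite -same2 (linear_asym lP Pux) orbF.
have /andP[uA xA] := linear_sub lQ Qux.
by have := linear_total lP uA xA ux; rewrite same2 (linear_asym lQ Qux) orbF.
Qed.

(* The order in which the contracted vertex x is replaced by the pair lo < hi.
   Between P and Q, which may differ by a swap of x with some z, the vertex z
   is placed between lo and hi. *)
Definition mid x lo hi P Q : rel T := fun a b =>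
  if a == lo then if b == hi then true else if b == lo then false else P x b || Q x b
  else if a == hi then if (b == lo) || (b == hi) then false else P x b && Q x b
  else if b == lo then P a x && Q a x
  else if b == hi then P a x || Q a x
  else P a b.

Definition ext x lo hi P := mid x lo hi P P.

(** Being adjacent, [lo] and [hi] serve as earlier and later neighbour of each other. What remains
    for validity is an earlier neighbour of [lo], unless [x] is first, and a later neighbour of
    [hi], unless [x] is last. *)
Definition pair_ok R x lo hi P :=
  ([exists w, P w x] ==> [exists u, R u lo && P u x]) &&
  ([exists w, P x w] ==> [exists u, R hi u && P x u]).

Lemma mid_rev x lo hi P Q : lo != hi ->
  reverse (mid x lo hi P Q) = mid x hi lo (reverse P) (reverse Q).
Proof.
move=> lh; apply: rel_ext => a b; rewrite /reverse /mid.
case: (eqVneq b lo) lh => [->|bl]; case: (eqVneq a lo) => [->|al];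
  rewrite ?eqxx //; case: (eqVneq lo hi) => //= _ _; try case: eqVneq => //=; try case: eqVneq => //=.
Qed.

Lemma ext_rev x lo hi P : lo != hi -> reverse (ext x lo hi P) = ext x hi lo (reverse P).
Proof. exact: mid_rev. Qed.

Lemma pair_ok_rev R x lo hi P : symmetric R ->
  pair_ok R x lo hi (reverse P) = pair_ok R x hi lo P.
Proof.
move=> sR; rewrite /pair_ok andbC /reverse; congr ((_ ==> _) && (_ ==> _)).
  by apply: eq_existsb => u; rewrite sR.
by apply: eq_existsb => u; rewrite sR.
Qed.

Lemma mid_same x lo hi P Q : (forall u, P u x = Q u x) -> (forall u, P x u = Q x u) ->
  mid x lo hi P Q = ext x lo hi P.
Proof. by move=> H1 H2; apply: rel_ext => a b; rewrite /ext /mid -!H1 -!H2. Qed.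

(** Only the comparison of two vertices other than [lo] and [hi] treats [P] and [Q] differently; as
    [x] is one of [lo] and [hi], that comparison does not involve [x]. *)
Lemma midC x lo hi P Q : lo = x \/ hi = x ->
  (forall u v, u != x -> v != x -> P u v = Q u v) ->
  mid x lo hi P Q = mid x lo hi Q P.
Proof.
move=> lhx H; apply: rel_ext => a b; rewrite /mid ![P _ _ || _]orbC ![P _ _ && _]andbC.
do ![case: eqVneq => //= ?]; apply: H; case: lhx => <- //.
Qed.

End Orders.

(** * Expanding a contracted edge *)

Section Expansion.
Variables (T : finType) (R : rel T) (x y : T).
Hypotheses (lR : level R) (xy : x != y) (Rxy : R x y).
Implicit Types P Q : rel T.

Let Ryx : R y x. Proof. by rewrite (level_sym lR). Qed.

Variant orientation : T -> T -> Prop :=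
  | Orient1 : orientation x y
  | Orient2 : orientation y x.

Lemma orientation_sym lo hi : orientation lo hi -> orientation hi lo.
Proof. by case; constructor. Qed.

Lemma orientation_neq lo hi : orientation lo hi -> lo != hi.
Proof. by case=> //; rewrite eq_sym. Qed.

Lemma orientation_rel lo hi : orientation lo hi -> R lo hi.
Proof. by case. Qed.

Lemma orientation_other lo hi u : orientation lo hi -> u != lo -> u != hi ->
  [/\ u != x, u != y & (u \in alive (contract R x y)) = (u \in alive R)].
Proof. by rewrite (alive_contract lR Rxy); case=> h1 h2; rewrite in_setD1 ?h1 ?h2. Qed.

Let A' := alive (contract R x y).

Lemma contract_alive u : u \in A' -> (u \in alive R) && (u != y).
Proof. by rewrite /A' (alive_contract lR) // in_setD1 andbC. Qed.

Lemma linear_mid lo hi P Q : orientation lo hi -> linear_order A' P -> linear_order A' Q ->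
  (forall u v, u != x -> v != x -> P u v = Q u v) ->
  linear_order (alive R) (mid x lo hi P Q).
Proof.
move=> olh lP lQ agree.
have lh := orientation_neq olh.
have hl : hi != lo by rewrite eq_sym.
have loA : lo \in alive R by case: olh; rewrite inE ?(level_refl lR Rxy) ?(level_refl lR Ryx).
have hiA : hi \in alive R by case: olh; rewrite inE ?(level_refl lR Rxy) ?(level_refl lR Ryx).
have sP u v : P u v -> (u \in alive R) && (v \in alive R).
  by move=> /(linear_sub lP)/andP[/contract_alive/andP[-> _] /contract_alive/andP[]].
have sQ u v : Q u v -> (u \in alive R) && (v \in alive R).
  by move=> /(linear_sub lQ)/andP[/contract_alive/andP[-> _] /contract_alive/andP[]].
split.
- move=> u v; rewrite /mid.
  have [->|ul] := eqVneq u lo; first have [->|vh] := eqVneq v hi.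
  + by rewrite loA hiA.
  + case: eqVneq => // vl /orP[/sP|/sQ] /andP[_ ->]; by rewrite loA.
  have [->|uh] := eqVneq u hi.
    by case: orP => // _ /andP[/sP/andP[_ ->]]; rewrite hiA.
  have [->|vl] := eqVneq v lo; first by move=> /andP[/sP/andP[-> _]]; rewrite loA.
  have [->|vh] := eqVneq v hi; last exact: sP.
  by move=> /orP[/sP|/sQ] /andP[-> _]; rewrite hiA.
- move=> u; rewrite /mid.
  have [->|ul] := eqVneq u lo; first by rewrite (negPf lh).
  have [->|uh] := eqVneq u hi; first by [].
  exact: linear_irr lP u.
- have tP := linear_trans lP; have tQ := linear_trans lQ.
  have asP := linear_asym lP; have asQ := linear_asym lQ.
  have oth u : u != lo -> u != hi -> u != x by move=> h1 h2; case: (orientation_other olh h1 h2).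
  (* Transitivity has to chain a comparison with [x], known perhaps in [Q] only, with one in [P]
     between other vertices; off [x] the latter transfers to [Q]. *)
  have QP u v : u != x -> v != x -> P u v -> Q u v by move=> h1 h2; rewrite agree.
  have PQ u v : u != x -> v != x -> Q u v -> P u v by move=> h1 h2; rewrite agree.
  move=> v u w; rewrite /mid.
  have [?|ul] := eqVneq u lo; [subst u; rewrite ?eqxx ?(negPf lh) ?(negPf hl)|].
    rewrite ?(negPf lh) ?(negPf hl) ?eqxx.
    have [?|vh] := eqVneq v hi; [subst v; rewrite ?eqxx ?(negPf lh) ?(negPf hl)|].
      case: (eqVneq w lo) => // wl; case: (eqVneq w hi) => //= wh _.
      by case/andP=> ->.
    have [?|vl] := eqVneq v lo; first by subst v; rewrite ?eqxx ?(negPf lh) ?(negPf hl).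
    have vx := oth v vl vh.
    have [?|wh] := eqVneq w hi; first by subst w; rewrite ?eqxx ?(negPf lh) ?(negPf hl).
    have [?|wl] := eqVneq w lo; [subst w; rewrite ?eqxx ?(negPf lh) ?(negPf hl)|].
      move=> /orP[Pxv|Qxv] /andP[Pvx Qvx].
        by rewrite (asP _ _ Pxv) in Pvx.
      by rewrite (asQ _ _ Qxv) in Qvx.
    have wx := oth w wl wh.
    by move=> /orP[Pxv|Qxv] Pvw; rewrite ?(tP _ _ _ Pxv Pvw) ?(tQ _ _ _ Qxv (QP _ _ vx wx Pvw)) ?orbT.
  have [?|uh] := eqVneq u hi; [subst u; rewrite ?eqxx ?(negPf lh) ?(negPf hl)|].
    have [?|vl] := eqVneq v lo; first by subst v; rewrite ?eqxx ?(negPf lh) ?(negPf hl).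
    have [?|vh] := eqVneq v hi; first by subst v; rewrite ?eqxx ?(negPf lh) ?(negPf hl).
    have vx := oth v vl vh.
    move=> /andP[Pxv Qxv]; have [?|wl] := eqVneq w lo; [subst w; rewrite ?eqxx ?(negPf lh) ?(negPf hl)|].
      by move=> /andP[Pvx Qvx]; rewrite (asP _ _ Pxv) in Pvx.
    have [?|wh] := eqVneq w hi; [subst w; rewrite ?eqxx ?(negPf lh) ?(negPf hl)|].
      by move=> /orP[Pvx|Qvx]; [rewrite (asP _ _ Pxv) in Pvx|rewrite (asQ _ _ Qxv) in Qvx].
    have wx := oth w wl wh.
    by move=> Pvw; rewrite (tP _ _ _ Pxv Pvw) (tQ _ _ _ Qxv (QP _ _ vx wx Pvw)).
  have ux := oth u ul uh.
  have [?|vl] := eqVneq v lo; [subst v; rewrite ?eqxx ?(negPf lh) ?(negPf hl)|].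
    move=> /andP[Pux Qux]; have [?|wh] := eqVneq w hi; [subst w; rewrite ?eqxx ?(negPf lh) ?(negPf hl)|].
      by rewrite Pux.
    have [?|wl] := eqVneq w lo; first by subst w; rewrite ?eqxx ?(negPf lh) ?(negPf hl).
    have wx := oth w wl wh.
    move=> /orP[Pxw|Qxw]; first exact: tP Pux Pxw.
    by apply: PQ => //; exact: tQ Qux Qxw.
  have [?|vh] := eqVneq v hi; [subst v; rewrite ?eqxx ?(negPf lh) ?(negPf hl)|].
    move=> H; have [?|wl] := eqVneq w lo; first by subst w; rewrite ?eqxx ?(negPf lh) ?(negPf hl).
    have [?|wh] := eqVneq w hi; first by subst w; rewrite ?eqxx ?(negPf lh) ?(negPf hl).
    have wx := oth w wl wh.
    move=> /andP[Pxw Qxw]; case/orP: H => [Pux|Qux]; first exact: tP Pux Pxw.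
    by apply: PQ => //; exact: tQ Qux Qxw.
  have vx := oth v vl vh.
  have [?|wl] := eqVneq w lo; [subst w; rewrite ?eqxx ?(negPf lh) ?(negPf hl)|].
    move=> Puv /andP[Pvx Qvx]; rewrite (tP _ _ _ Puv Pvx).
    exact: tQ (QP _ _ ux vx Puv) Qvx.
  have [?|wh] := eqVneq w hi; last exact: tP.
  subst w; rewrite ?eqxx ?(negPf hl).
  move=> Puv /orP[Pvx|Qvx]; first by rewrite (tP _ _ _ Puv Pvx).
  by rewrite (tQ _ _ _ (QP _ _ ux vx Puv) Qvx) orbT.
move=> u v uA vA uv; rewrite /mid.
have xA' : x \in A' by rewrite /A' (alive_contract lR) // in_setD1 xy inE (level_refl lR Rxy).
have tot w : w != lo -> w != hi -> w \in alive R -> (P x w || P w x) && (Q x w || Q w x).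
  move=> wl wh wA; have [wx wy wA'] := orientation_other olh wl wh.
  by rewrite (linear_total lP) ?(linear_total lQ) // ?wA' // eq_sym.
have [ul|ul] := eqVneq u lo.
  have [vh|vh] := eqVneq v hi; first by [].
  have vl : v != lo by rewrite -ul eq_sym.
  by rewrite (negPf vl); case/andP: (tot v vl vh vA); case: (P x v); case: (Q x v); case: (P v x); case: (Q v x).
have [uh|uh] := eqVneq u hi.
  have [vl|vl] := eqVneq v lo; first by rewrite orbT.
  have vh : v != hi by rewrite -uh eq_sym.
  by rewrite (negPf vh); case/andP: (tot v vl vh vA); case: (P x v); case: (Q x v); case: (P v x); case: (Q v x).
have [vl|vl] := eqVneq v lo.
  by case/andP: (tot u ul uh uA); case: (P x u); case: (Q x u); case: (P u x); case: (Q u x).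
have [vh|vh] := eqVneq v hi.
  by case/andP: (tot u ul uh uA); case: (P x u); case: (Q x u); case: (P u x); case: (Q u x).
have [_ _ uA'] := orientation_other olh ul uh; have [_ _ vA'] := orientation_other olh vl vh.
by rewrite (linear_total lP) ?uA' ?vA'.
Qed.

Lemma contract_nbr u v : contract R x y u v -> v != x ->
  [/\ u != y, v != y & R u v || (u == x) && R y v].
Proof. by move=> /and3P[-> -> h] vx; split=> //; move: h; rewrite (negPf vx) orbF. Qed.

(** A vertex outside the pair keeps its earlier neighbour from the contraction; if that is [x], it
    comes from an edge to [x] or to [y], and both now precede the vertex. *)
Lemma early_ext lo hi P : orientation lo hi -> valid (contract R x y) P ->
  pair_ok R x lo hi P -> early R (ext x lo hi P).
Proof.
move=> olh [lP eP _] /andP[ok1 _] w v wv.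
have lh := orientation_neq olh.
have [vh|vh] := eqVneq v hi.
  by exists lo; rewrite vh ?(orientation_rel olh) // /ext /mid !eqxx.
have oth u : P u x -> (u != lo) && (u != hi).
  move=> Pux; have /andP[/contract_alive/andP[_ uy] _] := linear_sub lP Pux.
  have ux : u != x by apply: contraTneq Pux => ->; rewrite (linear_irr lP).
  by case: olh; rewrite ux uy.
have [vl|vl] := eqVneq v lo.
  have Pwx : P w x.
    move: wv; rewrite vl /ext /mid; case: eqVneq => [_|wl]; first by rewrite (negPf lh) eqxx.
    by case: eqVneq => _; rewrite eqxx // andbb.
  have /existsP[u /andP[Rul Pux]] := implyP ok1 (introT existsP (ex_intro _ w Pwx)).
  have /andP[ul uh] := oth u Pux.
  by exists u; rewrite vl // /ext /mid (negPf ul) (negPf uh) eqxx Pux.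
have [vx vy _] := orientation_other olh vl vh.
have [w' Pwv] : exists w', P w' v.
  move: wv; rewrite /ext /mid (negPf vl) (negPf vh) /=.
  case: eqVneq => _; first by rewrite orbb; exists x.
  case: eqVneq => _; first by rewrite andbb; exists x.
  by exists w.
have [u cuv Puv] := eP _ _ Pwv.
have [uy _] := contract_nbr cuv vx.
have [ux|ux] := eqVneq u x.
  rewrite ux /= in cuv Puv *; case/orP=> Rv; [exists x|exists y] => //;
  rewrite /ext /mid (negPf vl) (negPf vh); case: olh; rewrite ?eqxx ?orbb ?andbb //;
  rewrite ?(negPf xy) ?[y == x]eq_sym ?(negPf xy) ?andbb ?orbb //.
rewrite orbF => Ruv; exists u => //; rewrite /ext /mid (negPf vl) (negPf vh).
by case: olh; rewrite (negPf ux) (negPf uy).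
Qed.

Lemma ext_valid lo hi P : orientation lo hi -> valid (contract R x y) P ->
  pair_ok R x lo hi P -> valid R (ext x lo hi P).
Proof.
move=> olh vP okP; have lh := orientation_neq olh.
have lP := valid_linear vP.
split; first exact: linear_mid.
  exact: early_ext.
rewrite ext_rev //; apply: early_ext; [exact: orientation_sym|exact: valid_rev|].
by rewrite pair_ok_rev //; exact: level_sym.
Qed.

(** With a swap of [x] and [z] the order reads [lo], [z], [hi]. The earlier neighbour of [lo] comes
    from [P], those of the vertices outside the pair from [Q], where fewer vertices follow [x]. This
    fails only for a vertex that is first in [Q] but not in the new order. *)
Lemma early_mid lo hi P Q : orientation lo hi ->
  valid (contract R x y) P -> valid (contract R x y) Q ->
  pair_ok R x lo hi P -> pair_ok R x lo hi Q -> near_at x P Q ->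
  early R (mid x lo hi P Q).
Proof.
move=> olh vP vQ okP okQ [|z Pxz Qzx d1 d2 agree].
  by move=> h1 h2; rewrite mid_same //; exact: early_ext.
have lP := valid_linear vP; have lQ := valid_linear vQ.
have lh := orientation_neq olh.
have Pzx := linear_asym lP Pxz; have Qxz := linear_asym lQ Qzx.
have PQ u : P u x -> Q u x.
  by have [->|uz] := eqVneq u z; [rewrite Pzx|rewrite d1].
have QP u : Q x u -> P x u.
  by have [->|uz] := eqVneq u z; [rewrite Qxz|rewrite d2].
move=> w v wv.
have [vh|vh] := eqVneq v hi.
  by exists lo; rewrite vh ?(orientation_rel olh) // /mid !eqxx.
have oth u : P u x -> (u != lo) && (u != hi).
  move=> Pux; have /andP[/contract_alive/andP[_ uy] _] := linear_sub lP Pux.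
  have ux : u != x by apply: contraTneq Pux => ->; rewrite (linear_irr lP).
  by case: olh; rewrite ux uy.
have othQ u : Q u x -> (u != lo) && (u != hi).
  move=> Pux; have /andP[/contract_alive/andP[_ uy] _] := linear_sub lQ Pux.
  have ux : u != x by apply: contraTneq Pux => ->; rewrite (linear_irr lQ).
  by case: olh; rewrite ux uy.
have [vl|vl] := eqVneq v lo.
  have Pwx : P w x.
    move: wv; rewrite vl /mid; case: eqVneq => [_|wl]; first by rewrite (negPf lh) eqxx.
    by case: eqVneq => _; rewrite eqxx // => /andP[].
  have /andP[ok1 _] := okP.
  have /existsP[u /andP[Rul Pux]] := implyP ok1 (introT existsP (ex_intro _ w Pwx)).
  have /andP[ul uh] := oth u Pux.
  by exists u; rewrite vl // /mid (negPf ul) (negPf uh) eqxx Pux PQ.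
have [vx vy _] := orientation_other olh vl vh.
case: (boolP [exists w', Q w' v]) => [/existsP[w' Qwv]|/existsPn minv].
  have [u cuv Quv] := valid_early vQ Qwv.
  have [uy _] := contract_nbr cuv vx.
  have [ux|ux] := eqVneq u x.
    rewrite ux /= in cuv Quv *; have Pxv := QP v Quv.
    by case/orP=> Rv; [exists x|exists y] => //;
    rewrite /mid (negPf vl) (negPf vh); case: olh;
    rewrite ?eqxx ?[y == x]eq_sym ?(negPf xy) ?Pxv ?Quv.
  rewrite orbF => Ruv; exists u => //; rewrite /mid (negPf vl) (negPf vh).
  by case: olh; rewrite (negPf ux) (negPf uy) agree.
have Pxv : P x v.
  move: wv; rewrite /mid (negPf vl) (negPf vh) /=.
  case: eqVneq => [_|wl]; first by rewrite (negPf (minv x)) orbF.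
  case: eqVneq => [_|wh]; first by rewrite (negPf (minv x)) andbF.
  have [wx _ _] := orientation_other olh wl wh.
  by rewrite agree // (negPf (minv w)).
have vz : v = z.
  by apply/eqP; apply: contraT => vz; move: Pxv; rewrite d2 // (negPf (minv x)).
(* Here [v] is [z], first in [Q] and preceded by [lo]. Since [z] precedes [x] in [Q], [lo] has a
   neighbour before [x] in [Q]; any such vertex other than [z] would precede [z] in [P], hence in
   [Q]. So [z] is the neighbour of [lo]. *)
have /andP[ok1 _] := okQ.
have /existsP[u /andP[Rul Qux]] := implyP ok1 (introT existsP (ex_intro _ z Qzx)).
have uv : u = v.
  apply/eqP; apply: contraT => uv.
  have uz : u != z by rewrite -vz.
  have Puv : P u v by apply: linear_trans lP _ _ _ _ Pxv; rewrite d1.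
  have ux : u != x by apply: contraTneq Qux => ->; rewrite (linear_irr lQ).
  by move: Puv; rewrite agree // (negPf (minv u)).
exists lo; first by rewrite (level_sym lR) -uv.
by rewrite /mid eqxx (negPf vh) (negPf vl) Pxv.
Qed.

Lemma orientation_x lo hi : orientation lo hi -> lo = x \/ hi = x.
Proof. by case; [left|right]. Qed.

Lemma near_at_rev P Q : near_at x P Q -> near_at x (reverse Q) (reverse P).
Proof.
case=> [h1 h2|z Pxz Qzx h1 h2 h3]; first by apply: NearSame => u; rewrite /reverse ?h1 ?h2.
apply: (NearSwap (z := z)) => // u.
- by move=> uz; rewrite /reverse h2.
- by move=> uz; rewrite /reverse h1.
- by move=> v ux vx; rewrite /reverse h3.
Qed.

Lemma mid_near_rev lo hi P Q : orientation lo hi -> near_at x P Q ->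
  reverse (mid x lo hi P Q) = mid x hi lo (reverse P) (reverse Q) /\
  (mid x hi lo (reverse P) (reverse Q) = mid x hi lo (reverse Q) (reverse P) \/
   mid x lo hi P Q = ext x lo hi P).
Proof.
move=> olh nPQ; split; first by apply: mid_rev; exact: orientation_neq.
case: nPQ => [h1 h2|z _ _ _ _ h3]; first by right; exact: mid_same.
left; apply: midC; first by case: (orientation_x olh); [right|left].
by move=> u v ux vx; rewrite /reverse h3.
Qed.

(** Later neighbours are obtained from [early_mid] by reversal. This exchanges [lo] with [hi], and
    also [P] with [Q], because [near_at] is directed; [midC] undoes the second exchange. *)
Lemma mid_valid lo hi P Q : orientation lo hi ->
  valid (contract R x y) P -> valid (contract R x y) Q ->
  pair_ok R x lo hi P -> pair_ok R x lo hi Q -> near_at x P Q ->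
  valid R (mid x lo hi P Q).
Proof.
move=> olh vP vQ okP okQ nPQ.
have [revE [midE|->]] := mid_near_rev olh nPQ; last exact: ext_valid.
case: (nPQ) => [h1 h2|z _ _ _ _ h3]; first by rewrite mid_same //; exact: ext_valid.
split.
- by apply: linear_mid h3 => //; exact: valid_linear.
- exact: early_mid.
rewrite revE midE; apply: early_mid.
- exact: orientation_sym.
- exact: valid_rev.
- exact: valid_rev.
- by rewrite (pair_ok_rev _ _ _ _ (level_sym lR)).
- by rewrite (pair_ok_rev _ _ _ _ (level_sym lR)).
- exact: near_at_rev.
Qed.

Lemma near_ext_ext lo hi lo' hi' P : orientation lo hi -> orientation lo' hi' ->
  near (ext x lo hi P) (ext x lo' hi' P).
Proof.
move=> olh olh'; exists x, y => u v; apply: contraR.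
rewrite negb_or !negb_and /ext /mid !orbb !andbb.
have yx : y != x by rewrite eq_sym.
case: olh; case: olh';
  (case: (eqVneq u x) => [?|ux]; [subst u|case: (eqVneq u y) => [?|uy]; [subst u|]]);
  (case: (eqVneq v x) => [?|vx]; [subst v|case: (eqVneq v y) => [?|vy]; [subst v|]]);
  by rewrite ?eqxx ?(negPf xy) ?(negPf yx) ?eqxx.
Qed.

(** If [x] and [z] are swapped, the three orders read [lo hi z], [lo z hi] and [z lo hi], so the
    swaps are those of [z] with [hi] and with [lo]. If the swap misses [x], it survives the
    expansion unchanged. *)
Lemma near_ext_mid lo hi P Q : orientation lo hi -> near_at x P Q -> near P Q ->
  near (ext x lo hi P) (mid x lo hi P Q) /\ near (mid x lo hi P Q) (ext x lo hi Q).
Proof.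
move=> olh [h1 h2|z Pxz Qzx d1 d2 h3] nPQ.
  rewrite mid_same //; split; first exact: near_refl x.
  case: nPQ => a [b ab]; exists a, b => u v; rewrite /ext /mid -!h1 -!h2.
  case: (u == lo) (u == hi) => -[]; case: (v == lo) (v == hi) => -[];
    rewrite ?eqxx //; exact: ab.
have PQ u : P u x -> Q u x.
  by have [->|uz] := eqVneq u z; [rewrite Qzx|rewrite d1].
have QP u : Q x u -> P x u.
  by have [->|uz] := eqVneq u z; [rewrite Pxz|rewrite d2].
have PQx u : P u x && Q u x = P u x by move: (PQ u); case: (P u x); case: (Q u x) => // ->.
have PQx' u : P u x || Q u x = Q u x by move: (PQ u); case: (P u x); case: (Q u x) => // ->.
have QPx u : P x u && Q x u = Q x u.
  by move: (QP u); case: (P x u); case: (Q x u) => // ->.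
have QPx' u : P x u || Q x u = P x u.
  by move: (QP u); case: (P x u); case: (Q x u) => // ->.
have lh := orientation_neq olh; have hl : hi != lo by rewrite eq_sym.
have oth u : u != lo -> u != hi -> u != x by move=> h4 h5; case: (orientation_other olh h4 h5).
split; [exists hi, z|exists lo, z] => u v; apply: contraR;
  rewrite negb_or !negb_and /ext /mid !orbb !andbb PQx PQx' QPx QPx' => duv;
  move: duv; (case: (eqVneq u lo) => [?|ul]; [subst u|case: (eqVneq u hi) => [?|uh]; [subst u|]]);
  (case: (eqVneq v lo) => [?|vl]; [subst v|case: (eqVneq v hi) => [?|vh]; [subst v|]]);
  rewrite ?eqxx ?(negPf lh) ?(negPf hl) ?andbF ?andbT ?orbF ?orbT ?eqxx //= => duv;
  rewrite ?negbK; apply/eqP; first [by apply: d1; move: duv; rewrite ?andbT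
    | by apply: d2; move: duv; rewrite ?andbT | by apply: h3; apply: oth].
Qed.

(** Otherwise [z] would cut [u] off, making [{u}] a fragment. *)
Lemma outer_nbr u z : u != z -> R u u ->
  (exists2 t, t \notin [set u; z] & R u t) \/ alive R \subset [set u; z].
Proof.
move=> uz Ruu; case: (boolP [exists t in ~: [set u; z], R u t]) => [/exists_inP[t]|/existsPn nE].
  by rewrite inE; left; exists t.
right; apply: contraT => nA; have /negP[] := level_conn lR [set u] (card_set2_le z z).
apply/fragmentP; split.
- by rewrite sub1set inE.
- by rewrite -cards_eq0 cards1.
- by rewrite disjoints1 !inE orbb.
- move=> a t /set1P->; have := nE t; rewrite !inE negb_and !negbK orbb => /orP[//|].
  by move=> /negPf->.
- by rewrite setUid.
Qed.

Lemma outer_nbr2 u v z : u != v -> u != z -> R u u ->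
  (exists2 t, t \notin [set u; v; z] & R u t) \/ alive R \subset [set u; v; z].
Proof.
move=> uv uz Ruu; case: (boolP [exists t in ~: [set u; v; z], R u t]) => [/exists_inP[t]|/existsPn nE].
  by rewrite inE; left; exists t.
right; apply: contraT => nA; have /negP[] := level_conn lR [set u] (card_set2_le v z).
apply/fragmentP; split.
- by rewrite sub1set inE.
- by rewrite -cards_eq0 cards1.
- by rewrite disjoints1 !inE negb_or uv.
- move=> a t /set1P->; have := nE t; rewrite !inE negb_and !negbK orbA => /orP[//|].
  by move=> /negPf->.
- by rewrite setUA.
Qed.

(** Each of [x] and [y] has a neighbour outside the pair, before or after it. If [x] cannot come
    first for want of an earlier neighbour, then it has a later one, and validity of [P] gives [y]
    an earlier one, so [y], [x] works; likewise if [y] cannot come last. *)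
Lemma common_same P : valid (contract R x y) P -> 2 < #|alive R| ->
  pair_ok R x x y P || pair_ok R x y x P.
Proof.
move=> vP A3; have lP := valid_linear vP.
have small : ~~ (alive R \subset [set x; y]).
  by apply: contraL A3 => /subset_leq_card; rewrite cards2 xy -leqNgt.
have side t u : R t u -> u != x -> u != y -> P u x || P x u.
  move=> Rtu ux uy; apply: (linear_total lP) => //.
    rewrite /A' (alive_contract lR Rxy) in_setD1 uy inE.
    by apply: (level_refl lR (v := t)); rewrite (level_sym lR).
  by rewrite (alive_contract lR Rxy) in_setD1 xy inE (level_refl lR Rxy).
pose E t := [exists u, R u t && P u x]; pose L t := [exists u, R t u && P x u].
have EL t : t \in [set x; y] -> E t || L t.
  move=> tin; have Rtt : R t t.
    by move: tin; rewrite !inE => /orP[]/eqP->; rewrite ?(level_refl lR Rxy) ?(level_refl lR Ryx).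
  have [u unin Rtu] : exists2 u, u \notin [set x; y] & R t u.
    move: tin; rewrite !inE => /orP[]/eqP tE; rewrite tE in Rtt *.
      by case: (outer_nbr xy Rtt) => // sA; rewrite sA in small.
    have yx : y != x by rewrite eq_sym.
    by case: (outer_nbr yx Rtt); rewrite setUC // => sA; rewrite sA in small.
  move: unin; rewrite !inE negb_or => /andP[ux uy].
  case/orP: (side _ _ Rtu ux uy) => Pu; apply/orP; [left|right]; apply/existsP; exists u.
    by rewrite Pu (level_sym lR) Rtu.
  by rewrite Pu Rtu.
have mn : [exists w, P w x] -> E x || E y.
  case/existsP=> w /(valid_early vP)[u /and3P[_ _ cu] Pux].
  have ux : u != x by apply: contraTneq Pux => ->; rewrite (linear_irr lP).
  rewrite (negPf ux) eqxx /= in cu.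
  by case/orP: cu => Ru; apply/orP; [left|right]; apply/existsP; exists u; rewrite Pux Ru.
have mx : [exists w, P x w] -> L x || L y.
  case/existsP=> w /(valid_late vP)[u /and3P[_ _ cu] Pxu].
  have ux : u != x by apply: contraTneq Pxu => ->; rewrite /reverse (linear_irr lP).
  rewrite (negPf ux) eqxx /= in cu.
  by case/orP: cu => Ru; apply/orP; [left|right]; apply/existsP; exists u; rewrite (level_sym lR) Ru.
have Emn t : E t -> [exists w, P w x].
  by case/existsP=> u /andP[_ Pu]; apply/existsP; exists u.
have Lmx t : L t -> [exists w, P x w].
  by case/existsP=> u /andP[_ Pu]; apply/existsP; exists u.
have ELx : E x || L x by apply: EL; rewrite !inE eqxx.
have ELy : E y || L y by apply: EL; rewrite !inE eqxx orbT.
rewrite /pair_ok -![[exists u, R u _ && P u x]]/(E _) -![[exists u, R _ u && P x u]]/(L _).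
move/implyP: mn ELx ELy; move/implyP: mx.
move/implyP: (Emn x); move/implyP: (Emn y); move/implyP: (Lmx x); move/implyP: (Lmx y).
move: (E x) (E y) (L x) (L y) [exists w, P w x] [exists w, P x w].
by do 6 case.
Qed.

(** The argument of [common_same] for the neighbours that lie on the same side of [x] in both
    orders. The swapped vertex [z] lies after [x] in [P] and before it in [Q], so it can help [hi]
    in the one and [lo] in the other. What is collected about these neighbours and [z] leaves a
    propositional check. *)
Lemma common_orientation P Q : valid (contract R x y) P -> valid (contract R x y) Q ->
  near_at x P Q -> 2 < #|alive R| ->
  pair_ok R x x y P && pair_ok R x x y Q || pair_ok R x y x P && pair_ok R x y x Q.
Proof.
move=> vP vQ [h1 h2|z Pxz Qzx d1 d2 agree] A3.
  have okE lo hi : pair_ok R x lo hi Q = pair_ok R x lo hi P.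
    rewrite /pair_ok; congr ((_ ==> _) && (_ ==> _)); apply: eq_existsb => u;
    by rewrite ?h1 ?h2.
  by rewrite !okE !andbb; exact: common_same.
have lP := valid_linear vP; have lQ := valid_linear vQ.
have Pzx := linear_asym lP Pxz; have Qxz := linear_asym lQ Qzx.
have PQ u : P u x -> Q u x.
  by have [->|uz] := eqVneq u z; [rewrite Pzx|rewrite d1].
have QP u : Q x u -> P x u.
  by have [->|uz] := eqVneq u z; [rewrite Qxz|rewrite d2].
have xA' : x \in A' by rewrite /A' (alive_contract lR Rxy) in_setD1 xy inE (level_refl lR Rxy).
have [zA zy] : z \in alive R /\ z != y.
  by have /andP[_ /contract_alive/andP[]] := linear_sub lP Pxz.
have zx : z != x by apply: contraTneq Pxz => ->; rewrite (linear_irr lP).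
have yx : y != x by rewrite eq_sym.
have side t u : R t u -> u != x -> u != y -> u != z -> P u x || Q x u.
  move=> Rtu ux uy uz; rewrite -d2 //; apply: (linear_total lP) => //.
  rewrite /A' (alive_contract lR Rxy) in_setD1 uy inE.
  by apply: (level_refl lR (v := t)); rewrite (level_sym lR).
(* Before [x] in [P] means before [x] in both orders, after [x] in [Q] means after [x] in both; [z]
   counts for neither. *)
pose E t := [exists u, R u t && P u x]; pose L t := [exists u, R t u && Q x u].
pose mn := [exists w, P w x]; pose mx := [exists w, Q x w].
have okP lo hi : (mn ==> E lo) && (L hi || R hi z) -> pair_ok R x lo hi P.
  rewrite /pair_ok => /andP[-> H] /=; apply/implyP=> _; apply/existsP.
  case/orP: H => [/existsP[u /andP[Ru /QP Pu]]|Rz]; [by exists u; rewrite Ru|].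
  by exists z; rewrite Rz.
have okQ lo hi : (E lo || R lo z) && (mx ==> L hi) -> pair_ok R x lo hi Q.
  rewrite /pair_ok => /andP[H ->]; rewrite andbT; apply/implyP=> _; apply/existsP.
  case/orP: H => [/existsP[u /andP[Ru /PQ Qu]]|Rz]; [by exists u; rewrite Ru|].
  by exists z; rewrite (level_sym lR) Rz.
have refl t : t \in [set x; y] -> R t t.
  by rewrite !inE => /orP[]/eqP->; rewrite ?(level_refl lR Rxy) ?(level_refl lR Ryx).
have Exy : mn -> E x || E y.
  case/existsP=> w /(valid_early vP)[u /and3P[_ _ cu] Pux].
  have ux : u != x by apply: contraTneq Pux => ->; rewrite (linear_irr lP).
  rewrite (negPf ux) eqxx /= in cu.
  by case/orP: cu => Ru; apply/orP; [left|right]; apply/existsP; exists u; rewrite Pux Ru.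
have Lxy : mx -> L x || L y.
  case/existsP=> w /(valid_late vQ)[u /and3P[_ _ cu] Pxu].
  have ux : u != x by apply: contraTneq Pxu => ->; rewrite /reverse (linear_irr lQ).
  rewrite (negPf ux) eqxx /= in cu.
  by case/orP: cu => Ru; apply/orP; [left|right]; apply/existsP; exists u; rewrite (level_sym lR) Ru.
have Emn t : E t -> mn by case/existsP=> u /andP[_ Pu]; apply/existsP; exists u.
have Lmx t : L t -> mx by case/existsP=> u /andP[_ Pu]; apply/existsP; exists u.
have noE : ~~ mn -> R x z || R y z.
  move/existsPn=> nE; have [u /and3P[_ _ cu] Qux] := valid_early vQ Qzx.
  have uz : u = z.
    by apply/eqP; apply: contraT => uz; move: Qux; rewrite -d1 // (negPf (nE u)).
  by move: cu; rewrite uz (negPf zx) eqxx /= (level_sym lR) (level_sym lR z y).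
have noL : ~~ mx -> R x z || R y z.
  move/existsPn=> nL; have [u /and3P[_ _ cu] Pxu] := valid_late vP Pxz.
  have uz : u = z.
    by apply/eqP; apply: contraT => uz; move: Pxu; rewrite /reverse d2 // (negPf (nL u)).
  by move: cu; rewrite uz (negPf zx) eqxx /= (level_sym lR) (level_sym lR z y).
(* If there is no fourth vertex, [x] and [y] are both adjacent to [z], and [x] has nothing before it
   in [P] and nothing after it in [Q]. *)
case: (boolP (alive R \subset [set x; y; z])) => [sA|big].
  have inA u v : R u v -> v \in [set x; y; z].
    move=> Ruv; apply: (subsetP sA); rewrite inE.
    by apply: (level_refl lR (v := u)); rewrite (level_sym lR).
  have Rz t s : t != s -> t \in [set x; y] -> s \in [set x; y] -> R t z.
    move=> ts tin sin; case: (outer_nbr ts (refl t tin)) => [[u]|sA2].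
      rewrite !inE negb_or => /andP[ut us] Rtu; have := inA _ _ Rtu.
      rewrite !inE => /orP[uxy|/eqP<-//]; move: ut us ts; move: tin sin uxy; rewrite !inE.
      by do 3 case/orP=> /eqP->; rewrite ?eqxx.
    by move: A3; rewrite ltnNge (leq_trans (subset_leq_card sA2)) ?card_set2_le.
  have Rxz : R x z by apply: (Rz x y); rewrite // !inE eqxx ?orbT.
  have Ryz : R y z by apply: (Rz y x); rewrite // !inE eqxx ?orbT.
  have inA' u : u \in A' -> (u == x) || (u == z).
    by move=> /contract_alive/andP[/(subsetP sA)]; rewrite !inE => /orP[/orP[->|->]|->]; rewrite ?orbT.
  have nmn : mn = false.
    rewrite /mn; apply/existsP=> -[w Pwx]; have /andP[/inA' + _] := linear_sub lP Pwx.
    by case/orP=> /eqP wE; move: Pwx; rewrite wE ?Pzx ?(linear_irr lP).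
  have nmx : mx = false.
    rewrite /mx; apply/existsP=> -[w Qxw]; have /andP[_ /inA'] := linear_sub lQ Qxw.
    by case/orP=> /eqP wE; move: Qxw; rewrite wE ?Qxz ?(linear_irr lQ).
  by rewrite okP ?okQ ?nmn ?nmx ?Rxz ?Ryz ?orbT.
have EL t : t \in [set x; y] -> E t || L t.
  move=> tin; have Rtt := refl t tin.
  have [u unin Rtu] : exists2 u, u \notin [set x; y; z] & R t u.
    move: tin; rewrite !inE => /orP[]/eqP tE; rewrite tE in Rtt *.
      by case: (outer_nbr2 (z := z) xy _ Rtt) => // [|sA]; [rewrite eq_sym|rewrite sA in big].
    case: (outer_nbr2 (z := z) yx _ Rtt) => // [|H|sA]; first by rewrite eq_sym.
      by rewrite [[set x; y]]setUC.
    by move: big; rewrite [[set x; y]]setUC sA.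
  move: unin; rewrite !inE !negb_or -andbA => /and3P[ux uy uz].
  case/orP: (side _ _ Rtu ux uy uz) => Pu; apply/orP; [left|right]; apply/existsP; exists u.
    by rewrite Pu (level_sym lR) Rtu.
  by rewrite Pu Rtu.
have H : [&& mn ==> E x, L y || R y z, E x || R x z & mx ==> L y] ||
         [&& mn ==> E y, L x || R x z, E y || R y z & mx ==> L x].
  have ELx : E x || L x by apply: EL; rewrite !inE eqxx.
  have ELy : E y || L y by apply: EL; rewrite !inE eqxx orbT.
  move/implyP: Exy ELx ELy; move/implyP: Lxy; move/implyP: noE; move/implyP: noL.
  move/implyP: (Emn x); move/implyP: (Emn y); move/implyP: (Lmx x); move/implyP: (Lmx y).
  move: (E x) (E y) (L x) (L y) (mn) (mx) (R x z) (R y z).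
  by do 8 case.
case/orP: H => /and4P[e1 e2 e3 e4].
  by apply/orP; left; apply/andP; split; [apply: okP|apply: okQ]; apply/andP.
by apply/orP; right; apply/andP; split; [apply: okP|apply: okQ]; apply/andP.
Qed.

End Expansion.

(** * Initial segments *)

Section Prefixes.
Variable T : finType.
Implicit Types (P Q R e : rel T) (S : {set T}).

Definition rank P v := #|[set u | P u v]|.
Definition initial P k : {set T} := [set v | rank P v < k].
Definition prefix_count S k P := #|initial P k :&: S|.

Lemma rank_mono P u v : linear_order [set: T] P -> P u v -> rank P u < rank P v.
Proof.
move=> lP Puv; apply: proper_card; apply/properP; split.
  by apply/subsetP=> w; rewrite !inE => Pwu; exact: linear_trans lP _ _ _ Pwu Puv.
by exists u; rewrite inE // (linear_irr lP).
Qed.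

Lemma rank_inj P : linear_order [set: T] P -> injective (rank P).
Proof.
move=> lP u v ruv; apply/eqP; apply: contraT => uv.
case/orP: (linear_total lP (in_setT u) (in_setT v) uv) => /(rank_mono lP);
by rewrite ruv ltnn.
Qed.

Lemma rank_sum P v : linear_order [set: T] P -> rank P v + rank (reverse P) v < #|T|.
Proof.
move=> lP; rewrite /rank -cardsUI.
have -> : [set u | P u v] :&: [set u | reverse P u v] = set0.
  by apply/setP=> u; rewrite !inE; apply/andP=> -[/(linear_asym lP)]; rewrite /reverse => ->.
rewrite cards0 addn0 -cardsT; apply: proper_card; apply/properP; split; first exact: subsetT.
by exists v; rewrite !inE // /reverse (linear_irr lP).
Qed.

Lemma card_prefix P k : linear_order [set: T] P -> k <= #|T| -> #|initial P k| = k.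
Proof.
move=> lP kT.
have rT v : rank P v < #|T| by apply: leq_ltn_trans (rank_sum v lP); exact: leq_addr.
pose f v := Ordinal (rT v).
have finj : injective f by move=> u v /(congr1 val) /(rank_inj lP).
have fbij : bijective f by apply: inj_card_bij; rewrite ?card_ord.
have -> : initial P k = f @^-1: [set i : 'I_#|T| | i < k].
  by apply/setP=> v; rewrite !inE.
rewrite on_card_preimset; last exact: onW_bij.
rewrite -sum1_card; under eq_bigl => i do rewrite inE.
by rewrite -(big_ord_widen #|T| (fun=> 1) kT) sum_nat_const card_ord muln1.
Qed.

Lemma prefix_cover P k : linear_order [set: T] P -> #|T| <= k + k ->
  initial P k :|: initial (reverse P) k = [set: T].
Proof.
move=> lP kT; apply/setP=> v; rewrite !inE; apply/negbNE.
rewrite negb_or -!leqNgt; apply/negP=> /andP[h1 h2].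
have := leq_trans (rank_sum v lP) kT; rewrite ltnNge => /negP[]; exact: leq_add.
Qed.

(** Only [a] and [b] change their rank, and both segments have [k] elements, so at most one element
    is exchanged. *)
Lemma near_prefix_count P Q S k : linear_order [set: T] P -> linear_order [set: T] Q ->
  near P Q -> k <= #|T| -> prefix_count S k P <= (prefix_count S k Q).+1.
Proof.
move=> lP lQ [a [b ab]] kT; pose D := [set a; b].
have same v : v \notin D -> (v \in initial P k) = (v \in initial Q k).
  rewrite !inE negb_or => /andP[va vb]; rewrite /rank.
  congr (_ < k); apply: eq_card => u; rewrite !inE; apply/eqP; apply: contraT => /ab.
  by rewrite (negPf va) (negPf vb) !andbF.
have sameD W : (initial P k :&: W) :\: D = (initial Q k :&: W) :\: D.
  by apply/setP=> v; rewrite !in_setD !in_setI; case: (boolP (v \in D)) => //= /same ->.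
have E := cardsID D; rewrite /prefix_count.
(* The segments have equal size and agree off [D], so they contain equally many of [a] and [b]. *)
have cD : #|initial P k :&: D| = #|initial Q k :&: D|.
  have := card_prefix lP kT; rewrite -{2}(card_prefix lQ kT) -(E (initial P k)) -(E (initial Q k)).
  by have := sameD setT; rewrite !setIT => ->; move/addIn.
rewrite -(E (initial P k :&: S)) -(E (initial Q k :&: S)) sameD -addSn leq_add2r.
have sub1 : #|initial P k :&: S :&: D| <= #|initial P k :&: D|.
  by apply: subset_leq_card; apply: setSI; exact: subsetIl.
case: (leqP #|initial P k :&: D| 1) => [c1|c2]; first by apply: leq_trans sub1 _; apply: leq_trans c1 _.
have full W : #|W :&: D| = #|initial P k :&: D| -> D \subset W.
  move=> cW; have D2 : #|D| <= 2 by rewrite cards2; case: (a != b).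
  apply/setIidPr; apply/eqP; rewrite eqEcard subsetIr cW; exact: leq_trans c2.
have P1 : D \subset initial P k by exact: full.
have Q1 : D \subset initial Q k by apply: full.
apply: leqW; apply: subset_leq_card; apply/subsetP=> v; rewrite !in_setI => /andP[/andP[_ ->] vD].
by rewrite vD (subsetP Q1).
Qed.

(** From any vertex of [D], repeated passage to an earlier neighbour stays in [D] and ends at the
    first vertex. For final segments this is applied to the reverse order. *)
Lemma down_closed_connected e R P D : symmetric e ->
  (forall u v, R u v -> u != v -> e u v) -> linear_order [set: T] P -> early R P ->
  D != set0 -> (forall u v, v \in D -> P u v -> u \in D) -> connected_on e D.
Proof.
move=> se Re lP eP D0 dD; split=> //.
have [m0 m0D] := set0Pn _ D0.
case: (arg_minnP (rank P) m0D) => m mD mmin.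
have conn v : v \in D -> connect (induced e D) m v.
  have [k] := ubnP (rank P v); elim: k v => // k IHk v; rewrite ltnS => vk vD.
  case: (boolP [exists w, P w v]) => [/existsP[w Pwv]|/existsPn nw].
    have [u Ruv Puv] := eP _ _ Pwv; have uD := dD _ _ vD Puv.
    have uv : u != v by apply: contraTneq Puv => ->; rewrite (linear_irr lP).
    apply: connect_trans (IHk u _ uD) _; first by exact: leq_trans (rank_mono lP Puv) vk.
    by apply: connect1; rewrite /induced /= uD vD Re.
  have rv : rank P v = 0.
    by apply/eqP; rewrite cards_eq0; apply/eqP/setP=> w; rewrite !inE; exact/negbTE.
  by have := mmin v vD; rewrite rv leqn0 => /eqP rm; rewrite (rank_inj lP (etrans rm (esym rv))) connect0.
have sy : connect_sym (induced e D).
  by apply: sym_connect_sym => u v; rewrite /induced /= se andbCA.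
move=> u v uD vD; apply: connect_trans (conn v vD); rewrite sy; exact: conn.
Qed.

Lemma prefix_connected e R P k : symmetric e ->
  (forall u v, R u v -> u != v -> e u v) -> alive R = setT -> valid R P ->
  0 < k < #|T| -> connected_on e (initial P k) /\ connected_on e (~: initial P k).
Proof.
move=> se Re AR [lP eP lateP] /andP[k0 kT]; rewrite AR in lP.
have cardk := card_prefix lP (ltnW kT).
split.
  apply: (down_closed_connected se Re lP eP); first by rewrite -card_gt0 cardk.
  move=> u v; rewrite !inE => vk /(rank_mono lP) uv; exact: ltn_trans vk.
apply: (down_closed_connected se Re (linear_rev lP) lateP).
  by rewrite -card_gt0 cardsCs setCK cardk subn_gt0.
move=> u v; rewrite !inE -!leqNgt => vk /(rank_mono lP) uv.
exact: leq_trans (ltnW uv).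
Qed.

(** The two segments cover all vertices and overlap in [k + k - #|T|] of them, which are the only
    ones counted twice. *)
Lemma prefix_count_reverse P S k : linear_order [set: T] P -> k <= #|T| <= k + k ->
  #|S| <= prefix_count S k P + prefix_count S k (reverse P) <= #|S| + (k + k - #|T|).
Proof.
move=> lP /andP[kT Tk]; have lrP := linear_rev lP.
have cov := prefix_cover lP Tk.
have := cardsUI (initial P k) (initial (reverse P) k).
rewrite cov cardsT !card_prefix // => cI.
rewrite /prefix_count -cardsUI -setIUl cov setTI leq_addr leq_add2l.
apply: leq_trans (_ : #|initial P k :&: initial (reverse P) k| <= _); last by lia.
by apply: subset_leq_card; apply: setISS; exact: subsetIl.
Qed.

End Prefixes.

(** * The descent *)

Lemma iteri_shift (A : Type) m (f : nat -> A -> A) x :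
  iteri m.+1 f x = iteri m (fun j => f j.+1) (f 0 x).
Proof. by elim: m => //= m <-. Qed.

Lemma eq_iteri (A : Type) m (f g : nat -> A -> A) x :
  (forall j a, j < m -> f j a = g j a) -> iteri m f x = iteri m g x.
Proof. by elim: m => //= m IHm fg; rewrite fg // IHm // => j a /ltnW; exact: fg. Qed.

(** Loops of the language have exactly [n] rounds; a shorter loop is one that idles from round [l]
    on. *)
Lemma iteri_guard (A : Type) n l (f : nat -> A -> A) x : l <= n ->
  iteri n (fun j a => if j < l then f j a else a) x = iteri l f x.
Proof.
elim: n l => [|n IHn] l; first by rewrite leqn0 => /eqP->.
rewrite leq_eqVlt ltnS => /orP[/eqP->|ln].
  by apply: eq_iteri => j a ->.
by rewrite /= ltnNge ln /= IHn.
Qed.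

Section Algorithm.
Variable n : nat.
Notation T := 'I_n.
Implicit Types (R P Q : rel T) (x y : T).

(** The lexicographically least contractible pair: a canonical choice that quantifiers can
    express. *)
Definition selected R x y := contractible R x y &&
  ~~ [exists u, exists v, contractible R u v && ((u < x) || (u == x) && (v < y))].

Lemma selected_unique R x y x' y' : selected R x y -> selected R x' y' -> x = x' /\ y = y'.
Proof.
move=> /andP[c1 m1] /andP[c2 m2].
have no (a b : T) : ~~ [exists u, exists v, contractible R u v && ((u < a) || (u == a) && (v < b))] ->
    forall u v, contractible R u v -> (a <= u) && ((u == a) ==> (b <= v)).
  move=> nE u v cuv; move/existsPn/(_ u)/existsPn/(_ v): nE.
  by rewrite cuv /= negb_or negb_and -!leqNgt implybE.
have /andP[h1 h2] := no _ _ m1 _ _ c2; have /andP[h3 h4] := no _ _ m2 _ _ c1.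
have xx : x = x' by apply/val_inj/eqP; rewrite /= eqn_leq h1.
split=> //; move: h2 h4; rewrite xx eqxx /= => h2 h4.
by apply/val_inj/eqP; rewrite /= eqn_leq h2.
Qed.

Lemma selected_exists R : level R -> 1 < #|alive R| -> exists x y, selected R x y.
Proof.
move=> lR A2; have [x0 [y0 /(contractibleP _ _ lR) c0]] := contractible_edge lR A2.
pose C (q : T * T) := contractible R q.1 q.2.
case: (@arg_minnP _ (x0, y0) C (fun q => q.1 * n + q.2) c0) => -[x y] cxy xmin.
exists x, y; apply/andP; split=> //.
apply/existsPn => u; apply/existsPn => v; rewrite negb_and; apply/orP.
case: (boolP (contractible R u v)) => [cuv|]; [right|by left].
have /= := xmin (u, v) cuv; rewrite negb_or negb_and -!leqNgt => le.
have vn := ltn_ord v; have yn := ltn_ord y.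
case: (ltngtP u x) => [ux|ux|/val_inj ux] /=.
- have : u.+1 * n <= x * n by rewrite leq_mul2r ux orbT.
  by rewrite mulSn; lia.
- by apply/orP; left; apply/eqP => E; rewrite E ltnn in ux.
- by rewrite ux eqxx /=; move: le; rewrite ux leq_add2l.
Qed.

(** A definite description: as the selected pair is unique, the existential quantifiers just
    evaluate [F] at it. *)
Definition at_selected R (F : T -> T -> rel T) : rel T :=
  fun a b => [exists x, exists y, selected R x y && F x y a b].

Lemma at_selectedE R F x y : selected R x y -> at_selected R F = F x y.
Proof.
move=> sxy; apply: rel_ext => a b; apply/existsP/idP.
  by case=> x' /existsP[y' /andP[sxy']]; have [-> ->] := selected_unique sxy sxy'.
by move=> Fab; exists x; apply/existsP; exists y; rewrite sxy.
Qed.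

Definition contraction R := at_selected R (contract R).

Lemma selected_solid R x y : level R -> selected R x y -> [/\ x != y, R x y & solid R x y].
Proof. by move=> lR /andP[/contractibleP-/(_ lR)]. Qed.

Lemma contraction_level R : level R -> 1 < #|alive R| ->
  level (contraction R) /\ #|alive (contraction R)| = #|alive R|.-1.
Proof.
move=> lR A2; have [x [y sxy]] := selected_exists lR A2.
have [xy Rxy so] := selected_solid lR sxy.
rewrite /contraction (at_selectedE _ sxy); split; first exact: contract_level.
rewrite alive_contract // (cardsD1 y (alive R)) inE.
by rewrite (level_refl lR (u := y) (v := x)) // (level_sym lR).
Qed.

Definition extend x y (o : bool) P := if o then ext x x y P else ext x y x P.
Definition between x y (o : bool) P Q := if o then mid x x y P Q else mid x y x P Q.
(** The bit [t] matters only if both orders of the pair are admissible. Reversal exchanges the two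
    orders and negates [t], so the rule commutes with it, which a fixed preference would not. *)
Definition preferred R x y (t : bool) P :=
  pair_ok R x x y P && (t || ~~ pair_ok R x y x P).
Definition common R x y P Q := pair_ok R x x y P && pair_ok R x x y Q.

Definition expand R t P := at_selected R (fun x y => extend x y (preferred R x y t P) P).
Definition first_step R P Q := at_selected R (fun x y => extend x y (common R x y P Q) P).
Definition middle_step R P Q := at_selected R (fun x y => between x y (common R x y P Q) P Q).
Definition last_step R P Q := at_selected R (fun x y => extend x y (common R x y P Q) Q).

Lemma valid_near R P Q x : valid R P -> valid R Q -> near P Q ->
  near_at x P Q \/ near_at x Q P.
Proof. by move=> vP vQ; exact: nearP (valid_linear vP) (valid_linear vQ). Qed.

Lemma expand_valid R t P : level R -> 2 < #|alive R| -> valid (contraction R) P ->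
  valid R (expand R t P).
Proof.
move=> lR A3; have [x [y sxy]] := selected_exists lR (ltnW A3).
have [xy Rxy so] := selected_solid lR sxy.
rewrite /contraction /expand !(at_selectedE _ sxy) /extend /preferred => vP.
have := common_same lR xy Rxy vP A3.
case: (boolP (pair_ok R x x y P)) => /= [ok1 _|_ ok2].
  case: ifP => [_|/norP[_ /negPn ok2]]; last exact: (ext_valid lR xy Rxy (Orient2 x y) vP).
  exact: (ext_valid lR xy Rxy (Orient1 x y) vP).
exact: (ext_valid lR xy Rxy (Orient2 x y) vP).
Qed.

Lemma expand_reverse R t P : level R -> 2 < #|alive R| -> valid (contraction R) P ->
  expand R (~~ t) (reverse P) = reverse (expand R t P).
Proof.
move=> lR A3; have [x [y sxy]] := selected_exists lR (ltnW A3).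
have [xy Rxy so] := selected_solid lR sxy.
have yx : y != x by rewrite eq_sym.
rewrite /contraction /expand !(at_selectedE _ sxy) /extend /preferred => vP.
rewrite (@pair_ok_rev _ R x x y P (level_sym lR)) (@pair_ok_rev _ R x y x P (level_sym lR)).
have := common_same lR xy Rxy vP A3.
by case: (pair_ok R x x y P); case: (pair_ok R x y x P); case: t => //= _; rewrite ext_rev.
Qed.

Lemma mid_steps R x y lo hi P Q : level R -> x != y -> R x y -> orientation x y lo hi ->
  valid (contract R x y) P -> valid (contract R x y) Q -> near P Q ->
  pair_ok R x lo hi P -> pair_ok R x lo hi Q ->
  [/\ valid R (mid x lo hi P Q), near (ext x lo hi P) (mid x lo hi P Q)
    & near (mid x lo hi P Q) (ext x lo hi Q)].
Proof.
move=> lR xy Rxy olh vP vQ nPQ okP okQ.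
case: (valid_near x vP vQ nPQ) => nx.
  have [n1 n2] := near_ext_mid lR xy Rxy olh nx nPQ.
  by split=> //; exact: (mid_valid lR xy Rxy olh vP vQ okP okQ nx).
have [n1 n2] := near_ext_mid lR xy Rxy olh nx (near_sym nPQ).
case: (nx) => [h1 h2|z _ _ _ _ h3].
  rewrite mid_same; [|by move=> u; rewrite h1|by move=> u; rewrite h2].
  rewrite mid_same // in n1 n2.
  by split; [exact: (ext_valid lR xy Rxy olh vP okP)|exact: near_refl x|exact: near_sym].
have -> : mid x lo hi P Q = mid x lo hi Q P.
  apply: midC; first exact: orientation_x olh.
  by move=> u v ux vx; rewrite h3.
by split; [exact: (mid_valid lR xy Rxy olh vQ vP okQ okP nx)|exact: near_sym|exact: near_sym].
Qed.

(** The inner three orders use the common orientation of the pair, the outer two the canonical ones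
    with tie bits of their own. So the outer swaps can only exchange [x] and [y], and the inner ones
    carry the swap between [P] and [Q]. *)
Lemma refine_steps R t t' P Q : level R -> 2 < #|alive R| ->
  valid (contraction R) P -> valid (contraction R) Q -> near P Q ->
  [/\ valid R (first_step R P Q), valid R (middle_step R P Q), valid R (last_step R P Q)
    & [/\ near (expand R t P) (first_step R P Q),
          near (first_step R P Q) (middle_step R P Q),
          near (middle_step R P Q) (last_step R P Q)
        & near (last_step R P Q) (expand R t' Q)]].
Proof.
move=> lR A3; have [x [y sxy]] := selected_exists lR (ltnW A3).
have [xy Rxy so] := selected_solid lR sxy.
rewrite /contraction /expand /first_step /middle_step /last_step !(at_selectedE _ sxy).
move=> vP vQ nPQ.
have ors (o : bool) : orientation x y (if o then x else y) (if o then y else x).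
  by case: o; constructor.
have extE o S : extend x y o S = ext x (if o then x else y) (if o then y else x) S by case: o.
have midE o : between x y o P Q = mid x (if o then x else y) (if o then y else x) P Q by case: o.
set o := common R x y P Q.
have [okP okQ] : pair_ok R x (if o then x else y) (if o then y else x) P /\
                 pair_ok R x (if o then x else y) (if o then y else x) Q.
  rewrite /o /common; case: (valid_near x vP vQ nPQ) => nx.
    have := common_orientation lR xy Rxy vP vQ nx A3.
    by case: andP => [//|_ /= /andP[]].
  have := common_orientation lR xy Rxy vQ vP nx A3; rewrite andbC.
  by case: andP => [//|_ /= /andP[]].
rewrite !extE midE.
have [vm n1 n2] := mid_steps lR xy Rxy (ors o) vP vQ nPQ okP okQ.
split.
- exact: (ext_valid lR xy Rxy (ors o) vP okP).
- exact: vm.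
- exact: (ext_valid lR xy Rxy (ors o) vQ okQ).
- by split=> //; exact: (near_ext_ext xy).
Qed.

Variables (e : rel T) (plus : {set T}) (h : nat).
Hypotheses (esym : symmetric e) (e3 : k_connected 3 e).
Hypothesis h_bounds : n <= 4 * h <= n + 2.
Hypothesis plus_card : 2 * #|plus| = n.

Let n4 : 3 < n.
Proof. by have [] := e3; rewrite card_ord. Qed.

Definition start_graph : rel T := fun u v => e u v || (u == v).

Definition graph_at l := iter l contraction start_graph.

(** A path that avoids [X] cannot leave a fragment. *)
Lemma start_level : level start_graph.
Proof.
split.
- by move=> u v; rewrite /start_graph esym eq_sym.
- by move=> u v _; rewrite /start_graph eqxx orbT.
move=> X C X2; apply/negP=> /fragmentP[_ /set0Pn[a aC] dCX clC /subsetPn[b _]].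
rewrite inE negb_or => /andP[bC bX].
have [_ con] := e3; have [_ conX] := con X X2.
have aX := disjointFr dCX aC.
have : connect (induced e (~: X)) a b by apply: conX; rewrite inE ?aX.
case/connectP=> p; elim: p a aC {aX} => [|c p IHp] a aC /=.
  by move=> _ ba; rewrite ba aC in bC.
case/andP; rewrite /induced /= => /and3P[_ cX eac] pc bl.
apply: IHp pc bl.
have := clC a c aC; rewrite /start_graph eac /= inE => /(_ isT) /orP[//|cX'].
by rewrite inE cX' in cX.
Qed.

Lemma graph_at_level l : l.+2 <= n -> level (graph_at l) /\ #|alive (graph_at l)| = n - l.
Proof.
elim: l => [|l IHl] ln.
  split; first exact: start_level.
  rewrite subn0 -[RHS]card_ord; apply: eq_card => u.
  by rewrite !inE /= /start_graph eqxx orbT.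
have [lR cR] := IHl (ltnW ln).
have A2 : 1 < #|alive (graph_at l)| by rewrite cR; lia.
have [lR' cR'] := contraction_level lR A2; split=> //.
by rewrite /= cR' cR; lia.
Qed.

Lemma alive_graph_at l m : l <= m -> m.+2 <= n -> alive (graph_at m) \subset alive (graph_at l).
Proof.
elim: m => [|m IHm]; first by rewrite leqn0 => /eqP->.
rewrite leq_eqVlt ltnS => /orP[/eqP-> //|lm] mn.
apply: subset_trans (IHm lm (ltnW mn)).
have [lR cR] := graph_at_level (ltnW mn).
have A2 : 1 < #|alive (graph_at m)| by rewrite cR; lia.
have [x [y sxy]] := selected_exists lR A2.
have [xy Rxy so] := selected_solid lR sxy.
by rewrite /= /contraction (at_selectedE _ sxy) alive_contract // subsetDl.
Qed.

Definition base_order : rel T := fun u v =>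
  [&& graph_at (n - 2) u u, graph_at (n - 2) v v & u < v].

Lemma base_order_pair : exists a b : T, [/\ a < b, alive (graph_at (n - 2)) = [set a; b]
  & forall u v, base_order u v = (u == a) && (v == b)].
Proof.
have n2 : (n - 2).+2 <= n by lia.
have [lR cR] := graph_at_level n2.
have /cards2P[a0 [b0 [ab0 E0]]] : #|alive (graph_at (n - 2))| == 2 by rewrite cR; lia.
have [a [b [ab E]]] : exists a b : T, a < b /\ alive (graph_at (n - 2)) = [set a; b].
  case: (ltngtP a0 b0) => [lt|lt|/val_inj E]; [by exists a0, b0| |by rewrite E eqxx in ab0].
  by exists b0, a0; rewrite setUC.
exists a, b; split=> // u v; have inA w : graph_at (n - 2) w w = (w == a) || (w == b).
  by have := in_set2 w a b; rewrite -E inE.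
rewrite /base_order !inA.
have ba : (b < a) = false by rewrite ltnNge ltnW.
have nab : (a == b) = false by apply: contraTF ab => /eqP->; rewrite ltnn.
case: (eqVneq u a) => [->|ua]; case: (eqVneq v b) => [->|vb]; rewrite ?eqxx ?orbT ?orbF ?ab //=.
  by case: eqP => // ->; rewrite ltnn.
- by case: eqP => // ->; rewrite ltnn.
case: eqP => // ->; case: eqP => //= ->; by rewrite ba.
Qed.

Lemma base_order_valid : valid (graph_at (n - 2)) base_order.
Proof.
have n2 : (n - 2).+2 <= n by lia.
have [lR cR] := graph_at_level n2.
have [a [b [ab E PE]]] := base_order_pair.
have nab : a != b by apply: contraTneq ab => ->; rewrite ltnn.
have Rab : graph_at (n - 2) a b.
  have A2 : 1 < #|alive (graph_at (n - 2))| by rewrite E cards2 nab.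
  have aA : a \in alive (graph_at (n - 2)) by rewrite E !inE eqxx.
  have [c ac Rac] := level_edge lR A2 aA.
  have: c \in alive (graph_at (n - 2)).
    by rewrite inE (level_refl lR (v := a)) // (level_sym lR).
  by rewrite E !inE eq_sym (negPf ac) /= => /eqP <-.
split.
- split.
  + by move=> u v; rewrite PE => /andP[/eqP-> /eqP->]; rewrite E !inE !eqxx orbT.
  + by move=> u; rewrite PE; apply/andP=> -[/eqP-> ]; apply/negP.
  + by move=> v u w; rewrite !PE => /andP[_ /eqP->] /andP[]; rewrite eq_sym (negPf nab).
  + move=> u v; rewrite E !inE !PE => /orP[]/eqP-> /orP[]/eqP->; rewrite ?eqxx ?orbT //.
- by move=> w v; rewrite PE => /andP[_ /eqP->]; exists a; rewrite ?PE ?eqxx.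
- move=> w v; rewrite /reverse PE => /andP[/eqP-> _]; exists b; last by rewrite PE !eqxx.
  by rewrite (level_sym lR).
Qed.

(* Which of the two surviving vertices comes first: breaking ties by it makes
   expansion commute with reversal. *)
Definition tie P := [exists u, exists v, base_order u v && P u v].

(** The two last vertices are alive at every level, so every order involved compares them. *)
Lemma tie_reverse l P : l.+2 <= n -> linear_order (alive (graph_at l)) P ->
  tie (reverse P) = ~~ tie P.
Proof.
move=> ln lP; have [a [b [ab E PE]]] := base_order_pair.
have tieE Q : tie Q = Q a b.
  apply/existsP/idP; first by case=> u /existsP[v]; rewrite PE => /andP[/andP[/eqP-> /eqP->]].
  by move=> Qab; exists a; apply/existsP; exists b; rewrite PE !eqxx.
have ln2 : l <= n - 2 by lia.
have n2 : (n - 2).+2 <= n by lia.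
have sA := alive_graph_at ln2 n2; rewrite E in sA.
have aA : a \in alive (graph_at l) by apply: (subsetP sA); rewrite !inE eqxx.
have bA : b \in alive (graph_at l) by apply: (subsetP sA); rewrite !inE eqxx orbT.
have nab : a != b by apply: contraTneq ab => ->; rewrite ltnn.
rewrite !tieE /reverse; have := linear_total lP aA bA nab.
by case Pab: (P a b) => /=; [rewrite (linear_asym lP Pab)|move=> ->].
Qed.

(** Rounds count up while levels go down: round [j] expands an order of level [l - j] to level
    [l - j.+1]. *)
Definition full_order l P :=
  iteri l (fun j Q => expand (graph_at (l - j.+1)) (tie Q) Q) P.

Lemma full_orderS l P :
  full_order l.+1 P = full_order l (expand (graph_at l) (tie P) P).
Proof. by rewrite /full_order iteri_shift subSS subn0. Qed.

Lemma full_order_valid l P : l.+2 <= n -> valid (graph_at l) P -> valid start_graph (full_order l P).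
Proof.
elim: l P => [//|l IHl] P ln vP; rewrite full_orderS; apply: IHl; first exact: ltnW.
have [lR cR] := graph_at_level (ltnW ln).
by apply: expand_valid => //; rewrite cR; lia.
Qed.

Lemma full_order_reverse l P : l.+2 <= n -> valid (graph_at l) P ->
  full_order l (reverse P) = reverse (full_order l P).
Proof.
elim: l P => [//|l IHl] P ln vP; rewrite !full_orderS.
have [lR cR] := graph_at_level (ltnW ln).
have A3 : 2 < #|alive (graph_at l)| by rewrite cR; lia.
rewrite (tie_reverse ln (valid_linear vP)) expand_reverse // IHl //; first exact: ltnW.
exact: expand_valid.
Qed.

(** A count in place of a signed sum: [2h] vertices have weight zero exactly when [h] of them are
    positive, and a swap changes the count by at most one, so it cannot jump over [h]. *)
Definition weigh P := prefix_count plus (h + h) P.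

Definition bracket l P Q := [/\ valid (graph_at l) P, valid (graph_at l) Q, near P Q,
  h <= weigh (full_order l P) & weigh (full_order l Q) <= h].

(** A discrete intermediate value search along the five orders of [refine_steps]: the new pair ends
    at the first order after the initial one whose count is at most [h]. *)
Definition next l (W : rel T * rel T) : rel T * rel T :=
  let: (P, Q) := W in
  let R := graph_at l in
  let S1 := first_step R P Q in let S2 := middle_step R P Q in let S3 := last_step R P Q in
  if weigh (full_order l S1) <= h then (expand R (tie P) P, S1)
  else if weigh (full_order l S2) <= h then (S1, S2)
  else if weigh (full_order l S3) <= h then (S2, S3)
  else (S3, expand R (tie Q) Q).

Lemma next_bracket l P Q : l.+3 <= n -> bracket l.+1 P Q ->
  bracket l (next l (P, Q)).1 (next l (P, Q)).2.
Proof.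
move=> ln [vP vQ nPQ]; rewrite !full_orderS => hP hQ.
have [lR cR] := graph_at_level (ltnW ln).
have A3 : 2 < #|alive (graph_at l)| by rewrite cR; lia.
have [v1 v2 v3 [n1 n2 n3 n4']] := refine_steps (tie P) (tie Q) lR A3 vP vQ nPQ.
have v0 := expand_valid (tie P) lR A3 vP; have v4 := expand_valid (tie Q) lR A3 vQ.
rewrite /next; case: ifP => c1.
  by split; [exact: v0|exact: v1|exact: n1|exact: hP|exact: c1].
move/negbT: c1; rewrite -ltnNge => /ltnW c1.
case: ifP => c2; first by split; [exact: v1|exact: v2|exact: n2|exact: c1|exact: c2].
move/negbT: c2; rewrite -ltnNge => /ltnW c2.
case: ifP => c3; first by split; [exact: v2|exact: v3|exact: n3|exact: c2|exact: c3].
move/negbT: c3; rewrite -ltnNge => /ltnW c3.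
by split; [exact: v3|exact: v4|exact: n4'|exact: c3|exact: hQ].
Qed.

Lemma start_linear P : valid start_graph P -> linear_order [set: T] P.
Proof.
move=> /valid_linear; have -> // : alive start_graph = setT.
by apply/setP=> u; rewrite !inE /start_graph eqxx orbT.
Qed.

(** Here [n] is even, hence [4h] or [4h - 2], and the counts of an order and of its reverse add up
    to a number between [2h - 1] and [2h + 1]. *)
Lemma weigh_reverse P : valid start_graph P ->
  (h < weigh P -> weigh (reverse P) <= h) /\ (weigh P < h -> h <= weigh (reverse P)).
Proof.
move=> /start_linear lP; have := @prefix_count_reverse _ P plus (h + h) lP.
rewrite card_ord -/(weigh P) -/(weigh (reverse P)).
have hh : h + h <= n <= h + h + (h + h) by have := n4; case/andP: h_bounds => b1 b2; lia.
move=> /(_ hh); case/andP: h_bounds => b1 b2; move: plus_card b1 b2.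
by move: #|plus| (weigh P) (weigh (reverse P)) => c w w' pc b1 b2 /andP[H1 H2]; split=> ?; lia.
Qed.

(** The two orders of the last graph, arranged by their counts; if the count is exactly [h], the
    same order is taken twice. *)
Definition descent_start : rel T * rel T :=
  let c := weigh (full_order (n - 2) base_order) in
  (if h <= c then base_order else reverse base_order,
   if c <= h then base_order else reverse base_order).

Definition descent : rel T * rel T :=
  iteri (n - 2) (fun i => next (n - 2 - i.+1)) descent_start.

Lemma descent_start_bracket : bracket (n - 2) descent_start.1 descent_start.2.
Proof.
have n2 : (n - 2).+2 <= n by lia.
have vP := base_order_valid; have vR := valid_rev vP.
have [a [b [_ _ PE]]] := base_order_pair.
have nr : near base_order (reverse base_order).
  exists a, b => u v; rewrite /reverse !PE.
  by case: (u == a); case: (u == b); case: (v == a); case: (v == b).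
have [w1 w2] := weigh_reverse (full_order_valid n2 vP).
rewrite -full_order_reverse // in w1 w2.
rewrite /descent_start /=; case: (ltngtP h (weigh (full_order (n - 2) base_order))) => c.
- by split=> //; [exact: ltnW|exact: w1].
- split=> //; [exact: near_sym|exact: w2|exact: ltnW].
- by split=> //; [exact: near_refl a|rewrite c|rewrite c].
Qed.

Lemma descent_bracket : bracket 0 descent.1 descent.2.
Proof.
have key i : i <= n - 2 -> let W := iteri i (fun i => next (n - 2 - i.+1)) descent_start in
    bracket (n - 2 - i) W.1 W.2.
  elim: i => [|i IHi] il /=; first by rewrite subn0; exact: descent_start_bracket.
  have := IHi (ltnW il); have -> : n - 2 - i = (n - 2 - i.+1).+1 by lia.
  move=> /= /(next_bracket _).
  case: (iteri i _ _) => P Q /=; apply; lia.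
by have := key _ (leqnn _); rewrite subnn.
Qed.

(** The final two counts lie on either side of [h] and the first exceeds the second by at most one,
    so one of them is [h]. *)
Definition answer : {set T} :=
  initial (if weigh descent.1 == h then descent.1 else descent.2) (h + h).

Lemma answer_correct : [/\ connected_on e answer, connected_on e (~: answer),
  #|answer| = h + h & #|answer :&: plus| = h].
Proof.
have [vP vQ nPQ hP hQ] := descent_bracket.
have hn : 0 < h + h < n by have := n4; case/andP: h_bounds => b1 b2; lia.
have lP := start_linear vP; have lQ := start_linear vQ.
have kT : h + h <= #|T| by rewrite card_ord; case/andP: hn => _ /ltnW.
pose S := if weigh descent.1 == h then descent.1 else descent.2.
have [vS wS] : valid start_graph S /\ weigh S = h.
  rewrite /S; case: eqP => [//|ne]; split=> //.
  have := near_prefix_count plus lP lQ nPQ kT.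
  rewrite -/(weigh _) -/(weigh descent.2); move: hP hQ ne; rewrite /full_order /=; lia.
have Re u v : start_graph u v -> u != v -> e u v.
  by rewrite /start_graph => /orP[//|/eqP->]; rewrite eqxx.
have aR : alive start_graph = setT by apply/setP=> u; rewrite !inE /start_graph eqxx orbT.
have hT : 0 < h + h < #|T| by rewrite card_ord.
have [c1 c2] := prefix_connected esym Re aR vS hT.
by split=> //; apply: card_prefix (start_linear vS) kT.
Qed.

End Algorithm.

(** * A functional language and its compiler *)

Inductive tm : Type :=
  | Cst of nat
  | Var of nat
  | Get of nat & nat & nat
  | Add of tm & tm
  | Sub of tm & tm
  | If of tm & tm & tm
  | Sum of nat & tm
  | Let of nat & tm & tm
  | Mat of nat & nat & nat & tm & tm
  | Loop of nat & nat & nat & nat & tm & tm.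

Definition upd (A : Type) (f : nat -> A) (x : nat) (v : A) : nat -> A :=
  fun y => if Nat.eqb y x then v else f y.

Definition matrix_env := nat -> nat -> nat -> nat.

Fixpoint den (n : nat) (t : tm) (ev : nat -> nat) (em : matrix_env) : nat :=
  match t with
  | Cst c => c
  | Var x => ev x
  | Get m x y => if (ev x < n) && (ev y < n) then em m (ev x) (ev y) else 0
  | Add t1 t2 => den n t1 ev em + den n t2 ev em
  | Sub t1 t2 => den n t1 ev em - den n t2 ev em
  | If c t1 t2 => if den n c ev em != 0 then den n t1 ev em else den n t2 ev em
  | Sum x t => \sum_(v < n) den n t (upd ev x v) em
  | Let x t1 t2 => den n t2 (upd ev x (den n t1 ev em)) em
  | Mat m x y t b =>
      den n b ev (upd em m (fun u v => den n t (upd (upd ev x u) y v) em))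
  | Loop m i x y t b =>
      den n b ev (upd em m
        (iteri n (fun k M u v => den n t (upd (upd (upd ev i k) x u) y v) (upd em m M))
               (em m)))
  end.

(* Array holding the multiples of n, by which matrices are addressed. *)
Definition mul_array := 3.

Definition address (x y : nat) : expr := EAdd (EGet mul_array (EReg x)) (EReg y).

(** Register 0 holds [n], so the truncated difference is nonzero exactly while the counter is below
    [n]. *)
Definition for_loop (x : nat) (c : cmd) : cmd :=
  CSeq (CSet x (ECst 0))
       (CWhile (ESub (EReg 0) (EReg x))
               (CSeq c (CSet x (EAdd (EReg x) (ECst 1))))).

Definition fill (A x : nat) (c : cmd) : cmd :=
  for_loop x (for_loop x.+1 (CSeq c (CPut A (address x x.+1) (EReg x.+2)))).

Definition copy (A B x : nat) : cmd :=
  fill B x (CSet x.+2 (EGet A (address x x.+1))).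

(* The compiled program leaves the value of t in register r; it may change the
   registers from r on and the arrays from a on. *)
Fixpoint compile (t : tm) (rv rm : nat -> nat) (r a : nat) : cmd :=
  match t with
  | Cst c => CSet r (ECst c)
  | Var x => CSet r (EReg (rv x))
  | Get m x y =>
      CIf (ESub (EReg 0) (EReg (rv x)))
        (CIf (ESub (EReg 0) (EReg (rv y)))
           (CSet r (EGet (rm m) (address (rv x) (rv y))))
           (CSet r (ECst 0)))
        (CSet r (ECst 0))
  | Add t1 t2 =>
      CSeq (compile t1 rv rm r a)
        (CSeq (compile t2 rv rm r.+1 a) (CSet r (EAdd (EReg r) (EReg r.+1))))
  | Sub t1 t2 =>
      CSeq (compile t1 rv rm r a)
        (CSeq (compile t2 rv rm r.+1 a) (CSet r (ESub (EReg r) (EReg r.+1))))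
  | If c t1 t2 =>
      CSeq (compile c rv rm r a)
        (CIf (EReg r) (compile t1 rv rm r a) (compile t2 rv rm r a))
  | Sum x t =>
      CSeq (CSet r (ECst 0))
        (for_loop r.+1
           (CSeq (compile t (upd rv x r.+1) rm r.+2 a)
                 (CSet r (EAdd (EReg r) (EReg r.+2)))))
  | Let x t1 t2 =>
      CSeq (compile t1 rv rm r a)
        (CSeq (compile t2 (upd rv x r) rm r.+1 a) (CSet r (EReg r.+1)))
  | Mat m x y t b =>
      CSeq (fill a r (compile t (upd (upd rv x r) y r.+1) rm r.+2 a.+1))
           (compile b rv (upd rm m a) r a.+1)
  | Loop m i x y t b =>
      CSeq (copy (rm m) a r)
        (CSeq
           (for_loop r
              (CSeq (fill a.+1 r.+1
                       (compile t (upd (upd (upd rv i r) x r.+1) y r.+2)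
                                (upd rm m a) r.+3 a.+2))
                    (copy a.+1 a r.+1)))
           (compile b rv (upd rm m a) r a.+1))
  end.

(** * Costs and their polynomial bounds *)

Definition for_cost (n B : nat) := (B + 10) * n + 10.
Definition fill_cost (n B : nat) := for_cost n (for_cost n (B + 10)).

Fixpoint tcost (n : nat) (t : tm) : nat :=
  match t with
  | Cst _ | Var _ => 2
  | Get _ _ _ => 20
  | Add t1 t2 | Sub t1 t2 | Let _ t1 t2 => tcost n t1 + tcost n t2 + 10
  | If c t1 t2 => tcost n c + tcost n t1 + tcost n t2 + 10
  | Sum _ t => for_cost n (tcost n t + 10) + 10
  | Mat _ _ _ t b => fill_cost n (tcost n t) + tcost n b
  | Loop _ _ _ _ t b =>
      fill_cost n 10 + for_cost n (fill_cost n (tcost n t) + fill_cost n 10) + tcost n b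
  end.

(** The base [n.+1] is positive, so exponents can be raised when bounds are added. *)
Definition poly_bounded (f : nat -> nat) := exists C d, forall n, f n <= C * n.+1 ^ d.

Lemma poly_cst c : poly_bounded (fun=> c).
Proof. by exists c, 0 => n; rewrite muln1. Qed.

Lemma poly_add f g : poly_bounded f -> poly_bounded g -> poly_bounded (fun n => f n + g n).
Proof.
move=> [C [d fC]] [C' [d' gC]]; exists (C + C'), (d + d') => n.
rewrite mulnDl; apply: leq_add; [apply: leq_trans (fC n) _|apply: leq_trans (gC n) _];
  by rewrite leq_mul2l leq_pexp2l ?leq_addr ?leq_addl ?orbT.
Qed.

Lemma poly_muln f : poly_bounded f -> poly_bounded (fun n => f n * n).
Proof.
move=> [C [d fC]]; exists C, d.+1 => n; rewrite expnSr mulnA.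
by apply: leq_mul => //; exact: ltnW.
Qed.

Lemma poly_for f : poly_bounded f -> poly_bounded (fun n => for_cost n (f n)).
Proof.
by move=> pf; apply: poly_add (poly_cst 10); apply: poly_muln; apply: poly_add (poly_cst 10).
Qed.

Lemma poly_fill f : poly_bounded f -> poly_bounded (fun n => fill_cost n (f n)).
Proof. by move=> pf; do 2 apply: poly_for; apply: poly_add (poly_cst 10). Qed.

Lemma poly_tcost t : poly_bounded (fun n => tcost n t).
Proof.
elim: t => /=.
- by move=> _; apply: poly_cst.
- by move=> _; apply: poly_cst.
- by move=> _ _ _; apply: poly_cst.
- by move=> t1 p1 t2 p2; do ![apply: poly_add => //; try exact: poly_cst].
- by move=> t1 p1 t2 p2; do ![apply: poly_add => //; try exact: poly_cst].
- by move=> t1 p1 t2 p2 t3 p3; do ![apply: poly_add => //; try exact: poly_cst].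
- by move=> _ t p; apply: poly_add (poly_cst 10); apply: poly_for; apply: poly_add (poly_cst 10).
- by move=> _ t1 p1 t2 p2; do ![apply: poly_add => //; try exact: poly_cst].
- by move=> _ _ _ t1 p1 t2 p2; apply: poly_add => //; apply: poly_fill.
- move=> _ _ _ _ t1 p1 t2 p2; apply: poly_add => //; apply: poly_add.
    by apply: poly_fill; exact: poly_cst.
  by apply: poly_for; apply: poly_add; apply: poly_fill => //; exact: poly_cst.
Qed.

(** * Total correctness with time bounds *)

Definition runs (I : store -> Prop) (c : cmd) (B : nat) (J : store -> Prop) :=
  forall s, I s -> exists t s', [/\ exec c s t s', t <= B & J s'].

Lemma runs_weaken (I I' J J' : store -> Prop) c B B' : runs I c B J ->
  (forall s, I' s -> I s) -> (forall s, J s -> J' s) -> B <= B' -> runs I' c B' J'.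
Proof.
move=> rc sI sJ BB s /sI /rc [t [s' [e tB Js]]]; exists t, s'; split=> //.
  exact: leq_trans BB.
exact: sJ.
Qed.

Lemma runs_for (I : nat -> store -> Prop) n x c B :
  (forall k s, I k s -> reg s 0 = n) -> x != 0 ->
  (forall k s v, I k s -> I k (set_reg s x v)) ->
  (forall k, k < n ->
     runs (fun s => I k s /\ reg s x = k) c B (fun s => I k.+1 s /\ reg s x = k)) ->
  runs (I 0) (for_loop x c) (for_cost n B) (I n).
Proof.
move=> I0 x0 Ix body.
have loop : forall m k, k + m = n -> runs (fun s => I k s /\ reg s x = k)
    (CWhile (ESub (EReg 0) (EReg x)) (CSeq c (CSet x (EAdd (EReg x) (ECst 1)))))
    ((B + 10) * m + 5) (I n).
  elim=> [|m IHm] k km s [Is sx].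
    exists 3, s; split=> //; first by apply: ExecWhileFalse; rewrite /= (I0 _ _ Is); lia.
    - by rewrite muln0.
    - by rewrite addn0 in km; rewrite -km.
  have kn : k < n by lia.
  have [t1 [s1 [e1 b1 [I1 s1x]]]] := body k kn s (conj Is sx).
  pose s2 := set_reg s1 x (eval s1 (EAdd (EReg x) (ECst 1))).
  have I2 : I k.+1 s2 /\ reg s2 x = k.+1.
    by split; [exact: Ix|rewrite /= eqxx s1x addn1].
  have km' : k.+1 + m = n by lia.
  have [t3 [s3 [e3 b3 I3]]] := IHm k.+1 km' s2 I2.
  exists (3 + (t1 + 4) + t3), s3; split=> //; last by lia.
  apply: (@ExecWhileTrue (ESub (EReg 0) (EReg x)) _ s s2) e3.
    by rewrite /= (I0 _ _ Is); lia.
  by apply: ExecSeq e1 _; exact: (ExecSet s1 x (EAdd (EReg x) (ECst 1))).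
move=> s Is; have I1 : I 0 (set_reg s x 0) /\ reg (set_reg s x 0) x = 0.
  by split; [exact: Ix|rewrite /= eqxx].
have [t [s' [e b Is']]] := loop n 0 (add0n n) _ I1.
exists (2 + t), s'; split=> //; last by rewrite /for_cost; lia.
by apply: ExecSeq e; exact: (ExecSet s x (ECst 0)).
Qed.

(** The frame condition. Protected arrays form an arbitrary set [K], not an initial range: copying a
    matrix back, and writing the output, must preserve arrays numbered above the one being
    written. *)
Definition same (r : nat) (K : nat -> bool) (s s' : store) : Prop :=
  (forall x, x < r -> reg s' x = reg s x) /\
  (forall A, K A -> arr s' A =1 arr s A).

Lemma same_refl r K s : same r K s s. Proof. by []. Qed.

Lemma same_trans r K s1 s2 s3 : same r K s1 s2 -> same r K s2 s3 -> same r K s1 s3.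
Proof.
move=> [r12 a12] [r23 a23]; split=> [x xr|A KA i]; first by rewrite r23 ?r12.
by rewrite a23 ?a12.
Qed.

Lemma same_weaken r r' (K K' : nat -> bool) s s' : r' <= r -> (forall A, K' A -> K A) ->
  same r K s s' -> same r' K' s s'.
Proof.
move=> rr KK [rs as_]; split=> [x xr|A /KK]; last exact: as_.
by apply: rs; exact: leq_trans rr.
Qed.

Lemma same_set_reg r K s s' x v : r <= x -> same r K s s' -> same r K s (set_reg s' x v).
Proof.
by move=> rx [rs as_]; split=> // y yr; rewrite /= -rs // ltn_eqF // (leq_trans yr).
Qed.

Lemma same_set_arr r (K : nat -> bool) s s' A i v : ~~ K A -> same r K s s' ->
  same r K s (set_arr s' A i v).
Proof.
move=> KA [rs as_]; split=> // B KB j; rewrite /= -as_ //.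
by case: eqP KB KA => // -> ->.
Qed.

Definition table (n : nat) (s : store) :=
  reg s 0 = n /\ forall i, i < n -> arr s mul_array i = i * n.

Definition holds_matrix (n : nat) (s : store) (A : nat) (f : nat -> nat -> nat) :=
  forall u v, u < n -> v < n -> arr s A (u * n + v) = f u v.

Record represents n s (rv rm : nat -> nat) r a (ev : nat -> nat) (em : matrix_env) : Prop :=
  Represents {
    repr_table : table n s;
    repr_rpos : 0 < r;
    repr_apos : mul_array < a;
    repr_var : forall x, rv x < r /\ reg s (rv x) = ev x;
    repr_mat : forall m, rm m < a /\ holds_matrix n s (rm m) (em m) }.

Lemma table_same n s s' r (K : nat -> bool) : table n s -> 0 < r -> K mul_array -> same r K s s' -> table n s'.
Proof.
move=> [t0 tm] r0 K3 [rs as_]; split; first by rewrite rs.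
by move=> i /tm; rewrite as_.
Qed.

Lemma represents_same n s s' rv rm r a r' a' ev em :
  represents n s rv rm r a ev em -> r <= r' -> a <= a' ->
  same r (fun A => A < a) s s' -> represents n s' rv rm r' a' ev em.
Proof.
move=> [tb r0 a3 rs ms] rr aa ss; have [ss1 ss2] := ss; split.
- exact: table_same tb r0 a3 ss.
- exact: leq_trans rr.
- exact: leq_trans aa.
- move=> x; have [h1 h2] := rs x; split; [exact: leq_trans rr|by rewrite ss1].
- move=> m; have [h1 h2] := ms m; split; first exact: leq_trans aa.
  by move=> u v un vn; rewrite ss2 ?h2.
Qed.

Lemma represents_var n s rv rm r a ev em x q k :
  represents n s rv rm r a ev em -> q < r -> reg s q = k ->
  represents n s (upd rv x q) rm r a (upd ev x k) em.
Proof.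
move=> [tb r0 a3 rs ms] qr sq; split=> // y; rewrite /upd; case: Nat.eqb => //.
Qed.

Lemma represents_mat n s rv rm r a ev em m A f :
  represents n s rv rm r a ev em -> A < a -> holds_matrix n s A f ->
  represents n s rv (upd rm m A) r a ev (upd em m f).
Proof.
move=> [tb r0 a3 rs ms] Aa sA; split=> // y; rewrite /upd; case: Nat.eqb => //.
Qed.

Lemma address_inj n u v u' v' : v < n -> v' < n ->
  u * n + v = u' * n + v' -> u = u' /\ v = v'.
Proof.
move=> vn vn' E; have n0 : 0 < n by lia.
have := congr1 (divn^~ n) E; rewrite !divnMDl // !divn_small // !addn0 => uu.
by split=> //; move: E; rewrite uu => /addnI.
Qed.

(** The invariant is that all cells before the current one in row-major order are correct. The body
    may not disturb [A] while computing an entry, and by [address_inj] a write hits no other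
    cell. *)
Lemma fill_ok n s0 x (K : nat -> bool) A f c B : table n s0 -> 0 < x -> K mul_array -> ~~ K A ->
  (forall u v s, u < n -> v < n -> same x K s0 s -> reg s x = u -> reg s x.+1 = v ->
     exists t s', [/\ exec c s t s', t <= B, reg s' x.+2 = f u v
                    & same x.+2 (fun C => K C || (C == A)) s s']) ->
  runs (same x K s0) (fill A x c) (fill_cost n B)
       (fun s => same x K s0 s /\ holds_matrix n s A f).
Proof.
move=> tb x0 K3 KA hc.
have A3 : (mul_array == A) = false by apply: contraNF KA => /eqP<-.
pose done k l s := forall u v, v < n -> (u < k) || ((u == k) && (v < l)) ->
  arr s A (u * n + v) = f u v.
pose I k s := same x K s0 s /\ done k 0 s.
have row k : k < n -> runs (fun s => I k s /\ reg s x = k)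
    (for_loop x.+1 (CSeq c (CPut A (address x x.+1) (EReg x.+2))))
    (for_cost n (B + 10)) (fun s => I k.+1 s /\ reg s x = k).
  move=> kn; pose J l s := [/\ same x K s0 s, done k l s & reg s x = k].
  apply: (@runs_weaken (J 0) _ (J n)); last exact: leqnn.
  - apply: runs_for => //.
    + by move=> l s [/(table_same tb x0 K3) [? _]].
    + move=> l s v [ss ds sx]; split=> //; first by apply: same_set_reg; rewrite // leqnSn.
      by rewrite /= ltn_eqF.
    + move=> l ln s [[ss ds sx] sx1].
      have [t [s1 [e b s1f sm]]] := hc k l s kn ln ss sx sx1.
      have [s1r s1a] := sm.
      have ss1 : same x K s0 s1.
        apply: same_trans ss _; apply: same_weaken sm; first by do 2 apply: leqW.
        by move=> C ->.
      have [_ tb1] := table_same tb x0 K3 ss1.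
      pose s2 := set_arr s1 A (k * n + l) (f k l).
      have e2 : exec (CPut A (address x x.+1) (EReg x.+2)) s1 6 s2.
        have := ExecPut s1 A (address x x.+1) (EReg x.+2).
        by rewrite /= s1f !s1r // sx sx1 tb1.
      exists (t + 6), s2; split; [exact: ExecSeq e e2|lia|].
      split; last by rewrite /= s1r.
      split; [by apply: same_set_arr|move=> u v vn uv|by rewrite /= s1r].
      rewrite /= eqxx /=; case: eqP => [/(address_inj vn ln)[-> ->] //|ne].
      rewrite s1a ?eqxx ?orbT // ds //.
      case/orP: uv => [->//|/andP[/eqP uk vl]]; rewrite uk eqxx ltnn /=.
      rewrite ltnS leq_eqVlt in vl; case/orP: vl => // /eqP vl.
      by case: ne; rewrite uk vl.
  - by move=> s [[ss ds] sx].
  - move=> s [ss ds sx]; split=> //; split=> // u v vn.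
    rewrite ltn0 andbF orbF ltnS leq_eqVlt => H; apply: ds => //.
    by case/orP: H => ->; rewrite ?vn ?orbT.
apply: (@runs_weaken (I 0) _ (I n)); last exact: leqnn.
- apply: runs_for => //.
  + by move=> k s [/(table_same tb x0 K3) [? _]].
  + by rewrite -lt0n.
  + by move=> k s v [ss ds]; split=> //; apply: same_set_reg.
- by move=> s ss; split=> // u v vn; rewrite !ltn0 andbF.
- move=> s [ss ds]; split=> // u v un vn; apply: ds => //.
  by rewrite un.
Qed.

Lemma copy_ok n s0 x (K : nat -> bool) A B f : table n s0 -> 0 < x -> K mul_array -> K A -> ~~ K B ->
  holds_matrix n s0 A f ->
  runs (same x K s0) (copy A B x) (fill_cost n 10)
       (fun s => same x K s0 s /\ holds_matrix n s B f).
Proof.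
move=> tb x0 K3 KA KB sA; apply: fill_ok => // u v s un vn ss sx sx1.
have [_ tb1] := table_same tb x0 K3 ss; have [_ as_] := ss.
have e := ExecSet s x.+2 (EGet A (address x x.+1)).
do 2 eexists; split; [exact: e|by []| |].
  by rewrite /= eqxx sx sx1 tb1 // as_ // sA.
by apply: same_set_reg; last exact: same_refl.
Qed.

Definition below (a A : nat) := A < a.

Definition computes n t rv rm r a ev em := forall s,
  represents n s rv rm r a ev em ->
  exists T s', [/\ exec (compile t rv rm r a) s T s', T <= tcost n t,
    reg s' r = den n t ev em & same r (below a) s s'].

Lemma compile_ok n t rv rm r a ev em : computes n t rv rm r a ev em.
Proof.
have bw a1 a2 A : a1 <= a2 -> below a1 A -> below a2 A by move=> h1 h2; exact: leq_trans h1.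
have binop t1 t2 op opx c1 rv1 rm1 r1 a1 ev1 em1 :
    (forall rv rm r a ev em, computes n t1 rv rm r a ev em) ->
    (forall rv rm r a ev em, computes n t2 rv rm r a ev em) ->
    (forall s, eval s opx = op (reg s r1) (reg s r1.+1)) -> cost opx = 3 ->
    c1 = CSeq (compile t1 rv1 rm1 r1 a1)
        (CSeq (compile t2 rv1 rm1 r1.+1 a1) (CSet r1 opx)) ->
    forall s, represents n s rv1 rm1 r1 a1 ev1 em1 ->
    exists T s', [/\ exec c1 s T s', T <= tcost n t1 + tcost n t2 + 10,
      reg s' r1 = op (den n t1 ev1 em1) (den n t2 ev1 em1) & same r1 (below a1) s s'].
  move=> IH1 IH2 opE copE -> s rs.
  have [T1 [s1 [e1 b1 v1 ss1]]] := IH1 _ _ _ _ _ _ _ rs.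
  have [T2 [s2 [e2 b2 v2 ss2]]] := IH2 _ _ _ _ _ _ _ (represents_same rs (leqnSn _) (leqnn _) ss1).
  have e3 := ExecSet s2 r1 opx.
  do 2 eexists; split; [exact: ExecSeq e1 (ExecSeq e2 e3)|by rewrite copE; lia| |].
    by rewrite /= eqxx opE v2 ss2.1 // v1.
  apply: same_set_reg => //; apply: same_trans ss1 _; apply: same_weaken ss2 => //.
elim: t rv rm r a ev em => [c|x|m x y|t1 IH1 t2 IH2|t1 IH1 t2 IH2|t1 IH1 t2 IH2 t3 IH3|x t IHt
    |x t1 IH1 t2 IH2|m x y t1 IH1 t2 IH2|m i x y t1 IH1 t2 IH2] rv rm r a ev em s rs.
- do 2 eexists; split; [exact: (ExecSet s r (ECst c))|by []|by rewrite /= eqxx|].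
  exact: same_set_reg.
- have [_ vx] := repr_var rs x.
  do 2 eexists; split; [exact: (ExecSet s r (EReg (rv x)))|by []|by rewrite /= eqxx|].
  exact: same_set_reg.
- have [_ vx] := repr_var rs x; have [_ vy] := repr_var rs y.
  have [sn stab] := repr_table rs; have [_ sm] := repr_mat rs m.
  have zero : exec (CSet r (ECst 0)) s 2 (set_reg s r 0) := ExecSet s r (ECst 0).
  rewrite /=; case: (ltnP (ev x) n) => /= xn; last first.
    do 2 eexists; split; [apply: ExecIfFalse zero| | |exact: same_set_reg]; rewrite /= ?eqxx //.
    by rewrite sn vx; lia.
  case: (ltnP (ev y) n) => /= yn; last first.
    do 2 eexists; split; [apply: ExecIfTrue; [|apply: ExecIfFalse zero]| | |exact: same_set_reg];
      rewrite /= ?eqxx //; by rewrite sn ?vx ?vy; lia.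
  have e := ExecSet s r (EGet (rm m) (address (rv x) (rv y))).
  do 2 eexists; split; [apply: ExecIfTrue; [|apply: ExecIfTrue; [|exact: e]]| | |exact: same_set_reg];
    rewrite /= ?eqxx //; first by rewrite sn vx; lia.
    by rewrite sn vy; lia.
  by rewrite vx vy stab // sm.
- by apply: (binop t1 t2 addn (EAdd (EReg r) (EReg r.+1)) _ rv rm r a ev em) rs.
- by apply: (binop t1 t2 subn (ESub (EReg r) (EReg r.+1)) _ rv rm r a ev em) rs.
- have [T1 [s1 [e1 b1 v1 ss1]]] := IH1 _ _ _ _ _ _ _ rs.
  have rs1 := represents_same rs (leqnn _) (leqnn _) ss1.
  rewrite /=; case: eqP => [c0|/eqP c0].
    have [T3 [s3 [e3 b3 v3 ss3]]] := IH3 _ _ _ _ _ _ _ rs1.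
    exists (T1 + (1 + T3)), s3; split=> //; last exact: same_trans ss3; last by lia.
    by apply: ExecSeq e1 _; apply: (@ExecIfFalse (EReg r)) => //=; rewrite v1.
  have [T2 [s2 [e2 b2 v2 ss2]]] := IH2 _ _ _ _ _ _ _ rs1.
  exists (T1 + (1 + T2)), s2; split=> //; last exact: same_trans ss2; last by lia.
  by apply: ExecSeq e1 _; apply: (@ExecIfTrue (EReg r)) => //=; rewrite v1.
- pose f k := den n t (upd ev x k) em.
  pose I k s' := same r (below a) s s' /\ reg s' r = \sum_(v < k) f v.
  have r0 := repr_rpos rs; have tb := repr_table rs; have a3 := repr_apos rs.
  have loop : runs (I 0) (for_loop r.+1
           (CSeq (compile t (upd rv x r.+1) rm r.+2 a)
                 (CSet r (EAdd (EReg r) (EReg r.+2))))) (for_cost n (tcost n t + 10)) (I n).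
    apply: runs_for => //.
    + by move=> k s1 [/(table_same tb r0 a3) []].
    + by move=> k s1 v [ss1 v1]; split; [exact: same_set_reg|rewrite /= ltn_eqF].
    + move=> k kn s1 [[ss1 v1] s1k].
      have rs1 := represents_var x (represents_same rs (leqW (leqnSn r)) (leqnn a) ss1) (leqnn _) s1k.
      have [T [s2 [e2 b2 v2 ss2]]] := IHt _ _ _ _ _ _ _ rs1.
      have e3 := ExecSet s2 r (EAdd (EReg r) (EReg r.+2)).
      do 2 eexists; split; [exact: ExecSeq e2 e3|by rewrite /=; lia|].
      have [ss2r _] := ss2.
      split; last by rewrite /= eqn_leq ltnn /= ss2r.
      split; last by rewrite /= eqxx ss2r // v1 v2 big_ord_recr.
      apply: same_set_reg => //; apply: same_trans ss1 _; apply: same_weaken ss2 => //.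
      exact: leqW.
  have Is : I 0 (set_reg s r 0).
    by split; [exact: same_set_reg|rewrite /= eqxx big_ord0].
  have [T [s' [e b [ss' v']]]] := loop _ Is.
  exists (2 + T), s'; split=> //; last by rewrite /=; lia.
  exact: ExecSeq (ExecSet s r (ECst 0)) e.
- have [T1 [s1 [e1 b1 v1 ss1]]] := IH1 _ _ _ _ _ _ _ rs.
  have rs1 := represents_var x (represents_same rs (leqnSn r) (leqnn _) ss1) (leqnn _) v1.
  have [T2 [s2 [e2 b2 v2 ss2]]] := IH2 _ _ _ _ _ _ _ rs1.
  have e3 := ExecSet s2 r (EReg r.+1).
  do 2 eexists; split; [exact: ExecSeq e1 (ExecSeq e2 e3)|by rewrite /=; lia|by rewrite /= eqxx|].
  by apply: same_set_reg => //; apply: same_trans ss1 _; apply: same_weaken ss2.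
- have r0 := repr_rpos rs; have tb := repr_table rs; have a3 := repr_apos rs.
  pose f u v := den n t1 (upd (upd ev x u) y v) em.
  have fl : runs (same r (below a) s) (fill a r (compile t1 (upd (upd rv x r) y r.+1) rm r.+2 a.+1))
     (fill_cost n (tcost n t1)) (fun s' => same r (below a) s s' /\ holds_matrix n s' a f).
    apply: fill_ok => //; first by rewrite /below ltnn.
    move=> u v s1 un vn ss1 s1u s1v.
    have rs1 := represents_same rs (leqW (leqnSn r)) (leqnSn a) ss1.
    have rs2 := represents_var y (represents_var x rs1 (leqnSn _) s1u) (leqnn _) s1v.
    have [T [s2 [e2 b2 v2 ss2]]] := IH1 _ _ _ _ _ _ _ rs2.
    exists T, s2; split=> //; apply: same_weaken ss2 => // A.
    by case/orP=> [/leqW //|/eqP->]; exact: leqnn.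
  have [T1 [s1 [e1 b1 [ss1 f1]]]] := fl s (same_refl _ _ _).
  have rs1 := represents_mat m (represents_same rs (leqnn r) (leqnSn a) ss1) (leqnn _) f1.
  have [T2 [s2 [e2 b2 v2 ss2]]] := IH2 _ _ _ _ _ _ _ rs1.
  exists (T1 + T2), s2; split=> //; [exact: ExecSeq e1 e2|by rewrite /=; lia|].
  by apply: same_trans ss1 _; apply: same_weaken ss2 => // A; apply: bw.
have r0 := repr_rpos rs; have tb := repr_table rs; have a3 := repr_apos rs.
have [ma sm] := repr_mat rs m.
have cp : runs (same r (below a) s) (copy (rm m) a r) (fill_cost n 10)
    (fun s' => same r (below a) s s' /\ holds_matrix n s' a (em m)).
  by apply: copy_ok => //; rewrite /below ltnn.
pose g k M u v := den n t1 (upd (upd (upd ev i k) x u) y v) (upd em m M).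
pose M k := iteri k g (em m).
pose I k s' := same r (below a) s s' /\ holds_matrix n s' a (M k).
have loop : runs (I 0) (for_loop r
    (CSeq (fill a.+1 r.+1 (compile t1 (upd (upd (upd rv i r) x r.+1) y r.+2)
                                (upd rm m a) r.+3 a.+2))
                    (copy a.+1 a r.+1)))
    (for_cost n (fill_cost n (tcost n t1) + fill_cost n 10)) (I n).
  apply: runs_for => //.
  + by move=> k s1 [/(table_same tb r0 a3) []].
  + by rewrite -lt0n.
  + by move=> k s1 v [ss1 f1]; split=> //; exact: same_set_reg.
  move=> k kn s1 [[ss1 f1] s1k].
  have tb1 := table_same tb r0 a3 ss1.
  have rs1 := represents_same rs (leqnSn r) (leqnSn a) ss1.
  have rs2 := represents_var i (represents_mat m rs1 (leqnn _) f1) (leqnn _) s1k.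
  have fl : runs (same r.+1 (below a.+1) s1) (fill a.+1 r.+1 (compile t1 (upd (upd (upd rv i r) x r.+1) y r.+2)
                                (upd rm m a) r.+3 a.+2))
     (fill_cost n (tcost n t1)) (fun s' => same r.+1 (below a.+1) s1 s' /\ holds_matrix n s' a.+1 (M k.+1)).
    apply: fill_ok => //; [exact: leqW|by rewrite /below ltnn|].
    move=> u v s2 un vn ss2 s2u s2v.
    have rs3 := represents_same rs2 (leqW (leqnSn r.+1)) (leqnSn a.+1) ss2.
    have rs4 := represents_var y (represents_var x rs3 (leqnSn _) s2u) (leqnn _) s2v.
    have [T [s3 [e3 b3 v3 ss3]]] := IH1 _ _ _ _ _ _ _ rs4.
    exists T, s3; split=> //; apply: same_weaken ss3 => // A.
    by case/orP=> [/leqW //|/eqP->]; exact: leqnn.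
  have [T2 [s2 [e2 b2 [ss2 f2]]]] := fl s1 (same_refl _ _ _).
  (* The new matrix is built in array [a.+1], as the body still reads the old one in [a]; it has to
     survive the copy back into [a]. *)
  pose K A := below a A || (A == a.+1).
  have tb2 : table n s2 by apply: table_same tb1 _ _ ss2 => //; exact: leqW.
  have cp2 : runs (same r.+1 K s2) (copy a.+1 a r.+1) (fill_cost n 10)
      (fun s' => same r.+1 K s2 s' /\ holds_matrix n s' a (M k.+1)).
    apply: copy_ok => //; rewrite /K /below; first by rewrite a3.
      by rewrite eqxx orbT.
    by rewrite ltnn ltn_eqF.
  have [T3 [s3 [e3 b3 [ss3 f3]]]] := cp2 s2 (same_refl _ _ _).
  exists (T2 + T3), s3; split; [exact: ExecSeq e2 e3|lia|].
  split; last by rewrite ss3.1 // ss2.1.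
  split=> //; apply: same_trans ss1 _; apply: same_trans.
    by apply: same_weaken ss2 => // A; apply: bw.
  by apply: same_weaken ss3 => // A; rewrite /K => ->.
have [T0 [s0 [e0 b0 Is0]]] := cp s (same_refl _ _ _).
have [T1 [s1 [e1 b1 [ss1 f1]]]] := loop s0 Is0.
have rs1 := represents_mat m (represents_same rs (leqnn r) (leqnSn a) ss1) (leqnn _) f1.
have [T2 [s2 [e2 b2 v2 ss2]]] := IH2 _ _ _ _ _ _ _ rs1.
exists (T0 + (T1 + T2)), s2; split=> //; [exact: ExecSeq e0 (ExecSeq e1 e2)|by rewrite /=; lia|].
by apply: same_trans ss1 _; apply: same_weaken ss2 => // A; apply: bw.
Qed.

Definition setup : cmd :=
  CSeq (CSet 1 (ECst 0))
    (for_loop 2 (CSeq (CPut mul_array (EReg 2) (EReg 1))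
                      (CSet 1 (EAdd (EReg 1) (EReg 0))))).

(** Scalar variables initially refer to register 0, so they denote [n], and matrices to the input
    arrays 0 and 1. Registers 1 and 2 count rows and columns, and array 3 holds the multiples, so
    the term may use registers from 3 and arrays from 4 on. *)
Definition program (x y : nat) (t : tm) : cmd :=
  CSeq setup (fill 2 1 (compile t (upd (upd (fun=> 0) x 1) y 2)
                                (fun m => minn m 1) 3 4)).

Definition input_env (n : nat) (e : rel 'I_n) (p : 'I_n -> int) : matrix_env :=
  fun m u v => if m == 0 then adj_array e (u * n + v) else sign_array p (u * n + v).

(** The program fills array 2 as an [n] by [n] matrix, of which row 0 is the output: hence the value
    0 for [x], while [y] is the vertex. *)
Theorem program_ok x y t : exists C d, forall n (e : rel 'I_n) (p : 'I_n -> int),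
  exists T s, [/\ exec (program x y t) (graph_input e p) T s, T <= C * n.+1 ^ d &
    forall v, v < n ->
      arr s 2 v = den n t (upd (upd (fun=> n) x 0) y v) (input_env e p)].
Proof.
have pf : poly_bounded (fun n => (2 + for_cost n 10) + fill_cost n (tcost n t)).
  apply: poly_add; last by apply: poly_fill; exact: poly_tcost.
  by apply: poly_add (poly_cst 2) _; apply: poly_for; exact: poly_cst.
have [C [d bound]] := pf; exists C, d => n e p.
set s := graph_input e p.
pose K A := A < 3.
pose I k s1 := [/\ same 1 K s s1, reg s1 1 = k * n & forall i, i < k -> arr s1 mul_array i = i * n].
have loop : runs (I 0) (for_loop 2 (CSeq (CPut mul_array (EReg 2) (EReg 1))
                      (CSet 1 (EAdd (EReg 1) (EReg 0))))) (for_cost n 10) (I n).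
  apply: runs_for => //.
  - by move=> k s1 [[rs _] _ _]; rewrite rs.
  - by move=> k s1 v [ss1 v1 m1]; split=> //; exact: same_set_reg.
  move=> k kn s1 [[ss1 v1 m1] s1k].
  do 2 eexists; split; [exact: ExecSeq (ExecPut _ _ _ _) (ExecSet _ _ _)|by []|].
  split=> //; split.
  - by apply: same_set_reg => //; apply: same_set_arr.
  - by rewrite /= v1 ss1.1 //= mulSn addnC.
  - move=> i; rewrite /= ltnS s1k; case: eqP => [-> _ //|/eqP ik ik'].
    by apply: m1; rewrite ltn_neqAle ik.
have I0 : I 0 (set_reg s 1 0) by split=> //; apply: same_set_reg.
have [T1 [s1 [e1 b1 [ss1 v1 m1]]]] := loop _ I0.
have tb : table n s1 by split=> //; rewrite ss1.1.
pose K' A := (A < 4) && (A != 2).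
pose f u v := den n t (upd (upd (fun=> n) x u) y v) (input_env e p).
have fl : runs (same 1 K' s1) (fill 2 1 (compile t (upd (upd (fun=> 0) x 1) y 2)
                                (fun m => minn m 1) 3 4))
    (fill_cost n (tcost n t)) (fun s' => same 1 K' s1 s' /\ holds_matrix n s' 2 f).
  apply: fill_ok => // u v s2 un vn ss2 s2u s2v.
  have rs : represents n s2 (fun=> 0) (fun m => minn m 1) 3 4 (fun=> n) (input_env e p).
    split=> //; first exact: table_same tb _ _ ss2.
      by move=> _; split=> //; rewrite ss2.1 // ss1.1.
    move=> m; split; first by rewrite (leq_ltn_trans (geq_minr m 1)).
    move=> u' v' un' vn'; rewrite ss2.2; last by case: m => [|[|]].
    rewrite ss1.2; last by case: m => [|[|]].
    by rewrite /input_env /=; case: m => [|m]; rewrite ?min0n // minnSS minn0.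
  have rs2 := represents_var y (represents_var x rs (isT : 1 < 3) s2u) (isT : 2 < 3) s2v.
  have [T [s3 [e3 b3 v3 ss3]]] := compile_ok t rs2.
  exists T, s3; split=> //; apply: same_weaken ss3 => // A.
  by rewrite /K' /below => /orP[/andP[]|/eqP->].
have [T2 [s2 [e2 b2 [ss2 f2]]]] := fl s1 (same_refl _ _ _).
exists (2 + T1 + T2), s2; split.
- apply: ExecSeq e2; apply: ExecSeq e1; exact: ExecSet.
- apply: leq_trans (bound n); apply: leq_add => //; exact: leq_add.
- move=> v vn; have n0 : 0 < n by apply: leq_ltn_trans vn.
  by have := f2 0 v n0 vn; rewrite mul0n add0n.
Qed.

(** * The descent as a term *)

(** Any nonzero number counts as true, so [Sum] is the existential quantifier. *)
Definition Not t := If t (Cst 0) (Cst 1).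
Definition And s t := If s t (Cst 0).
Definition Or s t := If s (Cst 1) t.
Definition Imp s t := If s t (Cst 1).
Definition Lt s t := Sub t s.
Definition Le s t := Not (Sub s t).
Definition Eq s t := And (Le s t) (Le t s).
Definition All x t := Not (Sum x (Not t)).
Definition Bit t := If t (Cst 1) (Cst 0).
Definition VEq x y := Eq (Var x) (Var y).

(* Numbers of the matrix and scalar variables.  tContractible and tPairOk take
   variables below 10 as arguments, the ones they bind being above. *)
Local Notation mE := 0 (only parsing).
Local Notation mS := 1 (only parsing).
Local Notation mR := 2 (only parsing).
Local Notation mX := 3 (only parsing).
Local Notation mO := 4 (only parsing).
Local Notation mF := 5 (only parsing).
Local Notation mW := 6 (only parsing).
Local Notation mP := 7 (only parsing).
Local Notation mQ := 8 (only parsing).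
Local Notation m0 := 9 (only parsing).
Local Notation m1 := 10 (only parsing).
Local Notation m2 := 11 (only parsing).
Local Notation m3 := 12 (only parsing).
Local Notation m4 := 13 (only parsing).

Local Notation vx := 0 (only parsing).
Local Notation vy := 1 (only parsing).
Local Notation vu := 2 (only parsing).
Local Notation vv := 3 (only parsing).
Local Notation vz := 10 (only parsing).
Local Notation va := 11 (only parsing).
Local Notation vb := 12 (only parsing).
Local Notation vc := 13 (only parsing).
Local Notation vi := 14 (only parsing).
Local Notation vp := 15 (only parsing).
Local Notation vq := 16 (only parsing).
Local Notation vl := 17 (only parsing).
Local Notation vN := 18 (only parsing).
Local Notation vH := 19 (only parsing).
Local Notation vw := 20 (only parsing).
Local Notation vj := 21 (only parsing).
Local Notation vk := 22 (only parsing).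

Definition tOff x y a :=
  And (Get mR a a) (And (Not (VEq a x)) (And (Not (VEq a y)) (Not (VEq a vz)))).

(** Row [a] of [mX] is the set reached from [a]. The [n] rounds of the loop, started from empty
    rows, carry out the iterations for all [a] at once. *)
Definition tContractible x y :=
  And (Not (VEq x y)) (And (Get mR x y)
    (All vz (Mat mX va vb (Cst 0)
      (Loop mX vi va vb
         (And (tOff x y vb) (Or (VEq vb va) (Sum vc (And (Get mX va vc) (Get mR vc vb)))))
         (All va (All vb (Imp (And (tOff x y va) (tOff x y vb)) (Get mX va vb)))))))).

Definition tSelected :=
  And (tContractible vx vy)
      (Not (Sum vu (Sum vv (And (tContractible vu vv)
         (Or (Lt (Var vu) (Var vx)) (And (VEq vu vx) (Lt (Var vv) (Var vy)))))))).

Definition tAtSelected t := Sum vx (Sum vy (And tSelected t)).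

Definition tContract :=
  And (Not (VEq vp vy)) (And (Not (VEq vq vy))
    (Or (Get mR vp vq) (Or (And (VEq vp vx) (Get mR vy vq)) (And (VEq vq vx) (Get mR vp vy))))).

(** The graph of level [vl] is recomputed from the input whenever it is used, because a loop carries
    a single matrix. *)
Definition tLevel b :=
  Mat mR vp vq (Or (Get mE vp vq) (VEq vp vq))
    (Loop mR vi vp vq
       (If (Lt (Var vi) (Var vl)) (tAtSelected tContract) (Get mR vp vq)) b).

Definition tPairOk lo hi P :=
  And (Imp (Sum vw (Get P vw vx)) (Sum vw (And (Get mR vw lo) (Get P vw vx))))
      (Imp (Sum vw (Get P vx vw)) (Sum vw (And (Get mR hi vw) (Get P vx vw)))).

Definition tMid lo hi P Q :=
  If (VEq vp lo)
    (If (VEq vq hi) (Cst 1) (If (VEq vq lo) (Cst 0) (Or (Get P vx vq) (Get Q vx vq))))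
    (If (VEq vp hi)
       (If (Or (VEq vq lo) (VEq vq hi)) (Cst 0) (And (Get P vx vq) (Get Q vx vq)))
       (If (VEq vq lo) (And (Get P vp vx) (Get Q vp vx))
         (If (VEq vq hi) (Or (Get P vp vx) (Get Q vp vx)) (Get P vp vq)))).

Definition tTie P := Sum va (Sum vb (And (Get mO va vb) (Get P va vb))).

Definition tExpand P :=
  tAtSelected
    (If (And (tPairOk vx vy P) (Or (tTie P) (Not (tPairOk vy vx P))))
        (tMid vx vy P P) (tMid vy vx P P)).

(** One term for the three inner orders of a refinement, as [ext] is [mid] with equal arguments: [S]
    and [S'] are both [P], then [P] and [Q], then both [Q]. *)
Definition tCommon P Q S S' :=
  tAtSelected
    (If (And (tPairOk vx vy P) (tPairOk vx vy Q)) (tMid vx vy S S') (tMid vy vx S S')).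

Definition tInitial P := Lt (Sum vw (Bit (Get P vw vk))) (Add (Var vH) (Var vH)).

(** The signs form row 0 of [mS], and [Get] takes variables only, so the row index is a bound
    variable required to be 0. *)
Definition tWeigh P :=
  Sum vk (Bit (And (tInitial P) (Sum vw (And (Eq (Var vw) (Cst 0)) (Get mS vw vk))))).

(** Rebinding [vl] makes [tLevel] produce the graph of the level that round [j] expands to. *)
Definition tFullWeigh P :=
  Mat mF vp vq (Get P vp vq)
    (Loop mF vj vp vq
       (If (Lt (Var vj) (Var vl))
           (Let vl (Sub (Var vl) (Add (Var vj) (Cst 1))) (tLevel (tExpand mF)))
           (Get mF vp vq))
       (tWeigh mF)).

Definition tPair s t := Add (Bit s) (If t (Cst 2) (Cst 0)).
Definition tFst := Or (Eq (Get mW vp vq) (Cst 1)) (Eq (Get mW vp vq) (Cst 3)).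
Definition tSnd := Lt (Cst 1) (Get mW vp vq).
Definition tPairOf P Q := tPair (Get P vp vq) (Get Q vp vq).

(** A loop body denotes one entry, so the whole step is recomputed for every entry of the coded
    pair; this costs only a polynomial factor. *)
Definition tNext :=
  Mat mP vp vq tFst (Mat mQ vp vq tSnd (tLevel
    (Mat m0 vp vq (tExpand mP) (Mat m1 vp vq (tCommon mP mQ mP mP)
    (Mat m2 vp vq (tCommon mP mQ mP mQ) (Mat m3 vp vq (tCommon mP mQ mQ mQ)
    (Mat m4 vp vq (tExpand mQ)
      (If (Le (tFullWeigh m1) (Var vH)) (tPairOf m0 m1)
      (If (Le (tFullWeigh m2) (Var vH)) (tPairOf m1 m2)
      (If (Le (tFullWeigh m3) (Var vH)) (tPairOf m2 m3) (tPairOf m3 m4))))))))))).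

Definition tAnswer :=
  Let vN (Sum vi (Cst 1))
  (Let vH (Sum vi (Bit (Lt (Add (Add (Var vi) (Var vi)) (Add (Var vi) (Var vi))) (Var vN))))
  (Let vl (Sub (Var vN) (Cst 2))
  (Mat mO vp vq (tLevel (And (Get mR vp vp) (And (Get mR vq vq) (Lt (Var vp) (Var vq)))))
  (Mat mP vp vq (Get mO vp vq) (Mat mQ vp vq (Get mO vq vp)
  (Let vc (tFullWeigh mP)
  (Mat mW vp vq
     (tPair (If (Le (Var vH) (Var vc)) (Get mP vp vq) (Get mQ vp vq))
            (If (Le (Var vc) (Var vH)) (Get mP vp vq) (Get mQ vp vq)))
  (Loop mW vj vp vq
     (If (Lt (Var vj) (Sub (Var vN) (Cst 2)))
         (Let vl (Sub (Sub (Var vN) (Cst 2)) (Add (Var vj) (Cst 1))) tNext)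
         (Get mW vp vq))
  (Mat mP vp vq tFst (Mat mQ vp vq tSnd
     (If (Eq (tWeigh mP) (Var vH)) (tInitial mP) (tInitial mQ)))))))))))).

(** Carries a loop on matrices of numbers over to the loop on sets, relations or pairs of relations
    that they stand for. *)
Lemma iteri_morph (A B : Type) (phi : A -> B) k F G a :
  (forall i a, phi (F i a) = G i (phi a)) -> phi (iteri k F a) = iteri k G (phi a).
Proof. by move=> FG; elim: k => //= k IHk; rewrite FG IHk. Qed.

Lemma iteri_const (A : Type) k (f : A -> A) a : iteri k (fun _ => f) a = iter k f a.
Proof. by elim: k => //= k ->. Qed.

(** * Meaning of the terms *)

Section Semantics.
Variable n : nat.
Implicit Types (ev : nat -> nat) (em : matrix_env) (s t : tm).
Local Notation T := 'I_n.

Definition holds t ev em := den n t ev em != 0.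

Lemma holds_not t ev em : holds (Not t) ev em = ~~ holds t ev em.
Proof. by rewrite /holds /=; case: ifP. Qed.

Lemma holds_if c s t ev em :
  holds (If c s t) ev em = if holds c ev em then holds s ev em else holds t ev em.
Proof. by rewrite /holds /=; case: ifP. Qed.

Lemma holds_and s t ev em : holds (And s t) ev em = holds s ev em && holds t ev em.
Proof. by rewrite /holds /=; case: ifP. Qed.

Lemma holds_or s t ev em : holds (Or s t) ev em = holds s ev em || holds t ev em.
Proof. by rewrite /holds /=; case: ifP. Qed.

Lemma holds_imp s t ev em : holds (Imp s t) ev em = (holds s ev em ==> holds t ev em).
Proof. by rewrite /holds /=; case: ifP. Qed.

Lemma holds_lt s t ev em : holds (Lt s t) ev em = (den n s ev em < den n t ev em).
Proof. by rewrite /holds /= -lt0n subn_gt0. Qed.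

Lemma holds_le s t ev em : holds (Le s t) ev em = (den n s ev em <= den n t ev em).
Proof. by rewrite /Le holds_not /holds /= negbK subn_eq0. Qed.

Lemma holds_eq s t ev em : holds (Eq s t) ev em = (den n s ev em == den n t ev em).
Proof. by rewrite /Eq holds_and !holds_le eqn_leq. Qed.

Lemma holds_veq x y ev em : holds (VEq x y) ev em = (ev x == ev y).
Proof. by rewrite /VEq holds_eq. Qed.

Lemma holds_ex x t ev em :
  holds (Sum x t) ev em = [exists v : T, holds t (upd ev x v) em].
Proof.
rewrite /holds /= sum_nat_eq0 negb_forall; apply: eq_existsb => v.
by rewrite implyTb.
Qed.

Lemma holds_all x t ev em :
  holds (All x t) ev em = [forall v : T, holds t (upd ev x v) em].
Proof.
rewrite /All holds_not holds_ex negb_exists; apply: eq_forallb => v.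
by rewrite holds_not negbK.
Qed.

Lemma holds_cst c ev em : holds (Cst c) ev em = (c != 0). Proof. by []. Qed.

Lemma den_if c s t ev em :
  den n (If c s t) ev em = if holds c ev em then den n s ev em else den n t ev em.
Proof. by []. Qed.

Lemma den_let x s t ev em :
  den n (Let x s t) ev em = den n t (upd ev x (den n s ev em)) em.
Proof. by []. Qed.

Lemma den_bit t ev em : den n (Bit t) ev em = holds t ev em.
Proof. by rewrite /holds /=; case: ifP. Qed.

Definition holdsE := (holds_not, holds_and, holds_or, holds_imp, holds_lt, holds_le,
  holds_veq, holds_eq, holds_ex, holds_all, holds_cst).

Definition mrel (M : nat -> nat -> nat) : rel T := fun u v => M u v != 0.

Lemma holds_get m x y ev em (u v : T) : ev x = u -> ev y = v ->
  holds (Get m x y) ev em = mrel (em m) u v.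
Proof. by move=> eu ev'; rewrite /holds /= eu ev' !ltn_ord. Qed.

Lemma updE (A : Type) (f : nat -> A) x v y : upd f x v y = if Nat.eqb y x then v else f y.
Proof. by []. Qed.

Lemma holds_off x y (a : nat) ev em (u v w c : T) : ev x = u -> ev y = v -> ev vz = w ->
  ev a = c ->
  holds (tOff x y a) ev em = mrel (em mR) c c && (c \notin [set u; v; w]).
Proof.
move=> ex ey ez ea; rewrite /tOff !holdsE (holds_get _ _ ea ea) ex ey ez ea.
by rewrite !inE !negb_or -!val_eqE /= !andbA.
Qed.

Lemma holds_contractible x y ev em (u v : T) : x < 10 -> y < 10 ->
  ev x = u -> ev y = v ->
  holds (tContractible x y) ev em = contractible (mrel (em mR)) u v.
Proof.
move=> x10 y10 ex ey.
have xk k : 10 <= k -> Nat.eqb x k = false by move=> hk; apply/PeanoNat.Nat.eqb_neq; lia.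
have yk k : 10 <= k -> Nat.eqb y k = false by move=> hk; apply/PeanoNat.Nat.eqb_neq; lia.
rewrite /tContractible 2!holds_and holds_not holds_veq (holds_get _ _ ex ey) holds_all ex ey.
rewrite /contractible -val_eqE; congr (_ && (_ && _)); apply: eq_forallb => w.
set R := mrel (em mR); set X := [set u; v; w].
pose body i0 (M : nat -> nat -> nat) := fun a b => den n (And (tOff x y vb)
  (Or (VEq vb va) (Sum vc (And (Get mX va vc) (Get mR vc vb)))))
  (upd (upd (upd (upd ev vz w) vi i0) va a) vb b) (upd (upd em mX (fun _ _ => 0)) mX M).
set M := iteri n body (fun _ _ => 0).
have ME (a b : T) : (M a b != 0) = reached R X a b.
  (* Row [a], read as a set, evolves independently of the other rows, by [reach_next]. *)
  pose phi (M' : nat -> nat -> nat) := [set b' : T | M' a b' != 0].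
  have step i M' : phi (body i M') = reach_next R X a (phi M').
    apply/setP=> c; rewrite inE [in RHS]inE -/(holds _ _ _).
    rewrite holds_and (@holds_off x y vb _ _ u v w c) //= ?updE ?xk ?yk //.
    rewrite -andbA; congr [&& _, _ & _].
    rewrite holds_or holds_veq holds_ex; congr (_ || _); apply: eq_existsb => d.
    rewrite holds_and (@holds_get _ _ _ _ _ a d) // (@holds_get _ _ _ _ _ d c) //.
    by rewrite inE.
  have := @iteri_morph _ _ phi n body (fun _ => reach_next R X a) (fun _ _ => 0) step; rewrite -/M.
  have -> : phi (fun _ _ => 0) = set0 by apply/setP=> c; rewrite !inE.
  move=> /setP/(_ b); rewrite inE => ->.
  by rewrite /reached card_ord iteri_const.
transitivity (holds (All va (All vb (Imp (And (tOff x y va) (tOff x y vb)) (Get mX va vb))))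
   (upd ev vz w) (upd (upd em mX (fun _ _ => 0)) mX M)); first by [].
rewrite holds_all; apply: eq_forallb => a; rewrite holds_all; apply: eq_forallb => b.
rewrite holds_imp holds_and (@holds_off x y va _ _ u v w a) //= ?updE ?xk ?yk //.
rewrite (@holds_off x y vb _ _ u v w b) //= ?updE ?xk ?yk //.
by rewrite (@holds_get _ _ _ _ _ a b) // -andbA; congr (_ ==> _); exact: ME.
Qed.

Lemma holds_selected ev em (u v : T) : ev vx = u -> ev vy = v ->
  holds tSelected ev em = selected (mrel (em mR)) u v.
Proof.
move=> ex ey; rewrite /tSelected holds_and (@holds_contractible vx vy _ _ u v) //.
congr (_ && _); rewrite holds_not; congr (~~ _).
rewrite holds_ex; apply: eq_existsb => a; rewrite holds_ex; apply: eq_existsb => b.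
rewrite holds_and (@holds_contractible vu vv _ _ a b) //; congr (_ && _).
by rewrite !holdsE /= !updE /= ex ey -val_eqE.
Qed.

Lemma holds_at_selected t ev em F (a b : T) :
  (forall x y : T, holds t (upd (upd ev vx x) vy y) em = F x y a b) ->
  holds (tAtSelected t) ev em = at_selected (mrel (em mR)) F a b.
Proof.
move=> tF; rewrite /tAtSelected holds_ex; apply: eq_existsb => x.
rewrite holds_ex; apply: eq_existsb => y.
by rewrite holds_and (@holds_selected _ _ x y) // tF.
Qed.

Lemma holds_contraction ev em (a b : T) : ev vp = a -> ev vq = b ->
  holds (tAtSelected tContract) ev em = contraction (mrel (em mR)) a b.
Proof.
move=> ea eb; apply: holds_at_selected => x y.
rewrite /tContract /contract !(holds_and, holds_or, holds_not, holds_veq) /= !updE /= ea eb.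
rewrite (@holds_get _ _ _ _ _ a b) //= (@holds_get _ _ _ _ _ y b) //=.
by rewrite (@holds_get _ _ _ _ _ a y) //= -!val_eqE.
Qed.

Definition level_matrix ev em : nat -> nat -> nat :=
  let em' := upd em mR (fun u v => den n (Or (Get mE vp vq) (VEq vp vq)) (upd (upd ev vp u) vq v) em) in
  iteri n (fun k M u v => den n
       (If (Lt (Var vi) (Var vl)) (tAtSelected tContract) (Get mR vp vq))
       (upd (upd (upd ev vi k) vp u) vq v) (upd em' mR M)) (em' mR).

Lemma holds_level b ev em : exists em', [/\ em' mR = level_matrix ev em,
  forall m, m != mR -> em' m = em m & den n (tLevel b) ev em = den n b ev em'].
Proof.
eexists; split; last by [].
  by [].
by move=> m mR'; rewrite !updE; case: (PeanoNat.Nat.eqb_spec m mR) => // E; rewrite E in mR'.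
Qed.

Lemma level_matrixE ev em l : ev vl = l -> l <= n ->
  mrel (level_matrix ev em) = graph_at (mrel (em mE)) l.
Proof.
move=> el ln; rewrite /level_matrix.
set em' := upd em mR _.
rewrite (@iteri_morph _ _ mrel n _ (fun k R => if k < l then contraction R else R)).
  rewrite iteri_guard //; have -> : mrel (em' mR) = start_graph (mrel (em mE)).
    apply: rel_ext => u v.
    transitivity (holds (Or (Get mE vp vq) (VEq vp vq)) (upd (upd ev vp u) vq v) em); first by [].
    by rewrite holds_or (@holds_get _ _ _ _ _ u v) // holds_veq.
  by rewrite /graph_at iteri_const.
move=> k M; apply: rel_ext => u v.
transitivity (holds (If (Lt (Var vi) (Var vl)) (tAtSelected tContract) (Get mR vp vq))
       (upd (upd (upd ev vi k) vp u) vq v) (upd em' mR M)); first by [].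
rewrite holds_if holds_lt /= !updE /= el; case: ifP => _; last by rewrite (@holds_get _ _ _ _ _ u v).
by rewrite (@holds_contraction _ _ u v).
Qed.

Lemma holds_pair_ok lo hi P ev em (x l h : T) : lo < 10 -> hi < 10 ->
  ev vx = x -> ev lo = l -> ev hi = h ->
  holds (tPairOk lo hi P) ev em = pair_ok (mrel (em mR)) x l h (mrel (em P)).
Proof.
move=> l10 h10 ex el eh.
have lk : Nat.eqb lo vw = false by apply/PeanoNat.Nat.eqb_neq; lia.
have hk : Nat.eqb hi vw = false by apply/PeanoNat.Nat.eqb_neq; lia.
rewrite /tPairOk /pair_ok holds_and !holds_imp !holds_ex.
congr ((_ ==> _) && (_ ==> _)); apply: eq_existsb => w.
- exact: (@holds_get P vw vx _ _ w x).
- by rewrite holds_and (@holds_get P vw vx _ _ w x) // (@holds_get mR vw lo _ _ w l) // updE lk.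
- exact: (@holds_get P vx vw _ _ x w).
- by rewrite holds_and (@holds_get P vx vw _ _ x w) // (@holds_get mR hi vw _ _ h w) // updE hk.
Qed.

Lemma holds_mid lo hi P Q ev em (x l h a b : T) :
  ev vx = x -> ev lo = l -> ev hi = h -> ev vp = a -> ev vq = b ->
  holds (tMid lo hi P Q) ev em = mid x l h (mrel (em P)) (mrel (em Q)) a b.
Proof.
move=> ex el eh ea eb; rewrite /tMid /mid !(holds_if, holds_and, holds_or, holds_veq).
rewrite !(@holds_get _ vx vq _ _ x b) // !(@holds_get _ vp vx _ _ a x) //.
by rewrite (@holds_get _ vp vq _ _ a b) // el eh ea eb -!val_eqE.
Qed.

Definition tied em P : bool := [exists u, exists v, mrel (em mO) u v && mrel (em P) u v].

Lemma holds_tie P ev em : holds (tTie P) ev em = tied em P.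
Proof.
rewrite /tTie holds_ex; apply: eq_existsb => u; rewrite holds_ex; apply: eq_existsb => v.
by rewrite holds_and !(@holds_get _ va vb _ _ u v).
Qed.

Lemma holds_expand P ev em (a b : T) : ev vp = a -> ev vq = b ->
  holds (tExpand P) ev em = expand (mrel (em mR)) (tied em P) (mrel (em P)) a b.
Proof.
move=> ea eb; apply: holds_at_selected => x y.
rewrite holds_if holds_and holds_or holds_not holds_tie.
rewrite (@holds_pair_ok vx vy _ _ _ x x y) // (@holds_pair_ok vy vx _ _ _ x y x) //.
rewrite (@holds_mid vx vy _ _ _ _ x x y a b) // (@holds_mid vy vx _ _ _ _ x y x a b) //.
by rewrite /extend -/(preferred _ _ _ _ _); case: ifP.
Qed.

Lemma holds_common P Q S S' ev em (a b : T) : ev vp = a -> ev vq = b ->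
  holds (tCommon P Q S S') ev em =
  at_selected (mrel (em mR)) (fun x y => between x y
    (common (mrel (em mR)) x y (mrel (em P)) (mrel (em Q))) (mrel (em S)) (mrel (em S'))) a b.
Proof.
move=> ea eb; apply: holds_at_selected => x y.
rewrite holds_if holds_and !(@holds_pair_ok vx vy _ _ _ x x y) //.
rewrite (@holds_mid vx vy _ _ _ _ x x y a b) // (@holds_mid vy vx _ _ _ _ x y x a b) //.
by rewrite /between -/(common _ _ _ _ _); case: ifP.
Qed.

Lemma sum_bool (b : pred T) : \sum_(w < n) (b w : nat) = #|[set w | b w]|.
Proof.
by rewrite -sum1dep_card [RHS]big_mkcond; apply: eq_bigr => w _; case: (b w).
Qed.

Lemma holds_initial P ev em h (v : T) : ev vk = v -> ev vH = h ->
  holds (tInitial P) ev em = (v \in initial (mrel (em P)) (h + h)).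
Proof.
move=> ek eh; rewrite /tInitial holds_lt inE /rank.
have -> : den n (Sum vw (Bit (Get P vw vk))) ev em = \sum_(w < n) (mrel (em P) w v : nat).
  apply: eq_bigr => w _; rewrite -[LHS]/(den n (Bit (Get P vw vk)) (upd ev vw w) em).
  by rewrite den_bit (@holds_get _ vw vk _ _ w v).
by rewrite sum_bool /= eh.
Qed.

Definition signs em : {set T} := [set v : T | em mS 0 v != 0].

Lemma den_weigh P ev em h : ev vH = h ->
  den n (tWeigh P) ev em = weigh (signs em) h (mrel (em P)).
Proof.
move=> eh; rewrite /weigh /prefix_count.
transitivity (\sum_(v < n) ((v \in initial (mrel (em P)) (h + h)) && (v \in signs em) : nat)).
  apply: eq_bigr => v _; rewrite -[LHS]/(den n (Bit (And (tInitial P)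
    (Sum vw (And (Eq (Var vw) (Cst 0)) (Get mS vw vk))))) (upd ev vk v) em).
  rewrite den_bit holds_and (@holds_initial _ _ _ h v) //.
  congr (nat_of_bool (_ && _)); rewrite inE holds_ex.
  apply/existsP/idP => [[w]|sv].
    by rewrite holds_and holds_eq (@holds_get _ vw vk _ _ w v) //= updE /= => /andP[/eqP w0]; rewrite /mrel w0.
  exists (Ordinal (leq_ltn_trans (leq0n v) (ltn_ord v))).
  by rewrite holds_and holds_eq (@holds_get _ vw vk _ _ (Ordinal (leq_ltn_trans (leq0n v) (ltn_ord v))) v) // /= updE.
by rewrite sum_bool; apply: eq_card => v; rewrite !inE.
Qed.

Lemma den_full_weigh P ev em h l : ev vH = h -> ev vl = l -> l <= n ->
  mrel (em mO) = base_order (mrel (em mE)) ->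
  den n (tFullWeigh P) ev em =
  weigh (signs em) h (full_order (mrel (em mE)) l (mrel (em P))).
Proof.
move=> eh el ln eO.
set em1 := upd em mF (fun u v => den n (Get P vp vq) (upd (upd ev vp u) vq v) em).
pose F k M u v := den n (If (Lt (Var vj) (Var vl))
           (Let vl (Sub (Var vl) (Add (Var vj) (Cst 1))) (tLevel (tExpand mF)))
           (Get mF vp vq)) (upd (upd (upd ev vj k) vp u) vq v) (upd em1 mF M).
rewrite -[LHS]/(den n (tWeigh mF) ev (upd em1 mF (iteri n F (em1 mF)))).
rewrite (den_weigh _ _ eh); congr (weigh _ _ _).
rewrite updE [Nat.eqb _ _]/= (@iteri_morph _ _ mrel n F
  (fun k R => if k < l then expand (graph_at (mrel (em mE)) (l - k.+1)) (tie (mrel (em mE)) R) R else R)).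
  rewrite iteri_guard // /full_order; congr (iteri _ _ _).
  by apply: rel_ext => u v; exact: (@holds_get P vp vq _ _ u v).
move=> k M; apply: rel_ext => u v.
transitivity (holds (If (Lt (Var vj) (Var vl))
           (Let vl (Sub (Var vl) (Add (Var vj) (Cst 1))) (tLevel (tExpand mF)))
           (Get mF vp vq)) (upd (upd (upd ev vj k) vp u) vq v) (upd em1 mF M)); first by [].
rewrite holds_if holds_lt /= !updE /= el; case: ifP => kl; last exact: (@holds_get mF vp vq _ _ u v).
pose ev1 := upd (upd (upd ev vj k) vp u) vq v.
pose ev2 := upd ev1 vl (den n (Sub (Var vl) (Add (Var vj) (Cst 1))) ev1 (upd em1 mF M)).
have el2 : ev2 vl = l - k.+1 by rewrite /ev2 /ev1 !updE /= !updE /= el addn1.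
rewrite /holds -[den n (Let _ _ _) _ _]/(den n (tLevel (tExpand mF)) ev2 (upd em1 mF M)).
have [em2 [em2R em2o ->]] := holds_level (tExpand mF) ev2 (upd em1 mF M).
rewrite -/(holds _ _ _) (@holds_expand _ _ _ u v) // em2R (level_matrixE _ el2); last by lia.
rewrite /tied (em2o mF isT) (em2o mO isT).
rewrite -[mrel (upd em1 mF M mE)]/(mrel (em mE)) -[mrel (upd em1 mF M mF)]/(mrel M).
by rewrite -[mrel (upd em1 mF M mO)]/(mrel (em mO)) eO.
Qed.

(* Loops carry one matrix only: a pair of relations is coded by entries 0 to 3. *)
Definition code (W : rel T * rel T) (a b : T) : nat := W.1 a b + (if W.2 a b then 2 else 0).
Definition decode (W : nat -> nat -> nat) : rel T * rel T :=
  (fun a b : T => (W a b == 1) || (W a b == 3), fun a b : T => 1 < W a b).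

Lemma eq_decode (W W' : nat -> nat -> nat) : (forall a b : T, W a b = W' a b) ->
  decode W = decode W'.
Proof. by move=> WE; congr pair; apply: rel_ext => a b; rewrite WE. Qed.

Lemma decode_code (W : nat -> nat -> nat) V : (forall a b : T, W a b = code V a b) -> decode W = V.
Proof.
case: V => P Q WE; congr pair; apply: rel_ext => a b; rewrite WE /code /=;
by case: (P a b); case: (Q a b).
Qed.

Lemma den_pair s t ev em :
  den n (tPair s t) ev em = holds s ev em + (if holds t ev em then 2 else 0).
Proof.
by rewrite -[LHS]/(den n (Bit s) ev em + (if holds t ev em then 2 else 0)) den_bit.
Qed.

Lemma den_pair_of P Q ev em (a b : T) : ev vp = a -> ev vq = b ->
  den n (tPairOf P Q) ev em = code (mrel (em P), mrel (em Q)) a b.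
Proof.
move=> ea eb; by rewrite /tPairOf den_pair !(@holds_get _ vp vq _ _ a b).
Qed.

Lemma holds_fst ev em (a b : T) : ev vp = a -> ev vq = b ->
  holds tFst ev em = (decode (em mW)).1 a b.
Proof. by move=> ea eb; rewrite /tFst holds_or !holds_eq /= ea eb !ltn_ord. Qed.

Lemma holds_snd ev em (a b : T) : ev vp = a -> ev vq = b ->
  holds tSnd ev em = (decode (em mW)).2 a b.
Proof. by move=> ea eb; rewrite /tSnd holds_lt /= ea eb !ltn_ord. Qed.

Lemma mrel_mat t ev em R :
  (forall u v : T, holds t (upd (upd ev vp u) vq v) em = R u v) ->
  mrel (fun u v => den n t (upd (upd ev vp u) vq v) em) = R.
Proof. by move=> tR; apply: rel_ext => u v; exact: tR. Qed.

(** The extended environment is hidden behind an existential quantifier, so that long chains of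
    binders do not pile up as nested updates. *)
Lemma den_mat m t b ev em R :
  (forall u v : T, holds t (upd (upd ev vp u) vq v) em = R u v) ->
  exists em', [/\ mrel (em' m) = R, forall m', m' != m -> em' m' = em m'
    & den n (Mat m vp vq t b) ev em = den n b ev em'].
Proof.
move=> tR; eexists; split; last by [].
  by rewrite updE PeanoNat.Nat.eqb_refl; exact: mrel_mat.
by move=> m' mm; rewrite updE; case: (PeanoNat.Nat.eqb_spec m' m) => // E; rewrite E eqxx in mm.
Qed.

Lemma den_next ev em h l (a b : T) : ev vp = a -> ev vq = b ->
  ev vH = h -> ev vl = l -> l <= n -> mrel (em mO) = base_order (mrel (em mE)) ->
  den n tNext ev em =
  code (next (mrel (em mE)) (signs em) h l (decode (em mW))) a b.
Proof.
move=> ea eb eh el ln eO; rewrite /tNext.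
set b1 := Mat mQ _ _ _ _.
have [emP [PE oP ->]] := @den_mat mP tFst b1 ev em _
  (fun u v => holds_fst em (erefl : upd (upd ev vp u) vq v vp = u) erefl).
rewrite {}/b1; set b2 := tLevel _.
have [emQ [QE oQ ->]] := @den_mat mQ tSnd b2 ev emP _
  (fun u v => holds_snd emP (erefl : upd (upd ev vp u) vq v vp = u) erefl).
rewrite {}/b2; set b3 := Mat m0 _ _ _ _.
have [emR [RE oR ->]] := holds_level b3 ev emQ.
have {}RE : mrel (emR mR) = graph_at (mrel (em mE)) l.
  by rewrite RE (level_matrixE _ el ln) oQ // oP.
rewrite {}/b3; set b4 := Mat m1 _ _ _ _.
have [em0 [E0 o0 ->]] := @den_mat m0 (tExpand mP) b4 ev emR _
  (fun u v => holds_expand mP emR (erefl : upd (upd ev vp u) vq v vp = u) erefl).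
rewrite {}/b4; set b5 := Mat m2 _ _ _ _.
have [em1 [E1 o1 ->]] := @den_mat m1 (tCommon mP mQ mP mP) b5 ev em0 _
  (fun u v => holds_common mP mQ mP mP em0 (erefl : upd (upd ev vp u) vq v vp = u) erefl).
rewrite {}/b5; set b6 := Mat m3 _ _ _ _.
have [em2 [E2 o2 ->]] := @den_mat m2 (tCommon mP mQ mP mQ) b6 ev em1 _
  (fun u v => holds_common mP mQ mP mQ em1 (erefl : upd (upd ev vp u) vq v vp = u) erefl).
rewrite {}/b6; set b7 := Mat m4 _ _ _ _.
have [em3 [E3 o3 ->]] := @den_mat m3 (tCommon mP mQ mQ mQ) b7 ev em2 _
  (fun u v => holds_common mP mQ mQ mQ em2 (erefl : upd (upd ev vp u) vq v vp = u) erefl).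
rewrite {}/b7; set b8 := If _ _ _.
have [em4 [E4 o4 ->]] := @den_mat m4 (tExpand mQ) b8 ev em3 _
  (fun u v => holds_expand mQ em3 (erefl : upd (upd ev vp u) vq v vp = u) erefl).
rewrite {}/b8.
have agree m : m \in [:: mE; mS; mO] -> em4 m = em m.
  rewrite !inE => mm; rewrite o4 ?o3 ?o2 ?o1 ?o0 ?oR ?oQ ?oP //;
  by move: mm => /orP[/eqP->//|/orP[]/eqP->].
have sE : signs em4 = signs em by rewrite /signs agree.
have eO4 : mrel (em4 mO) = base_order (mrel (em4 mE)) by rewrite !agree.
have tE k em' : em' mO = em mO -> tied em' k = tie (mrel (em mE)) (mrel (em' k)).
  by move=> eq; rewrite /tied eq eO.
set R := graph_at _ _ in RE.
set P := (decode (em mW)).1 in PE; set Q := (decode (em mW)).2.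
have QE' : mrel (emQ mQ) = Q by rewrite QE /Q oP.
have PR : mrel (emR mP) = P by rewrite (oR mP isT) (oQ mP isT) PE.
have QR : mrel (emR mQ) = Q by rewrite (oR mQ isT) QE'.
have OR : emR mO = em mO by rewrite (oR mO isT) (oQ mO isT) (oP mO isT).
(* Binding the matrices of the refinement leaves intact the pair, the graph and the base order, from
   which the later ones are computed. *)
have keep em' m em'' : (forall m', m' != m -> em'' m' = em' m') ->
    m \in [:: m0; m1; m2; m3] ->
    [/\ mrel (em' mP) = P, mrel (em' mQ) = Q, mrel (em' mR) = R & em' mO = em mO] ->
    [/\ mrel (em'' mP) = P, mrel (em'' mQ) = Q, mrel (em'' mR) = R & em'' mO = em mO].
  rewrite !inE => o mm [<- <- <- <-].
  by rewrite !o //; case/or4P: mm => /eqP->.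
have [P0 Q0 R0 O0] := keep _ _ _ o0 isT (And4 PR QR RE OR).
have [P1 Q1 R1 O1] := keep _ _ _ o1 isT (And4 P0 Q0 R0 O0).
have [P2 Q2 R2 O2] := keep _ _ _ o2 isT (And4 P1 Q1 R1 O1).
have [P3 Q3 R3 O3] := keep _ _ _ o3 isT (And4 P2 Q2 R2 O2).
have H0 : mrel (em4 m0) = expand R (tie (mrel (em mE)) P) P.
  by rewrite (o4 m0 isT) (o3 m0 isT) (o2 m0 isT) (o1 m0 isT) E0 RE (tE _ _ OR) PR.
have H1 : mrel (em4 m1) = first_step R P Q.
  by rewrite (o4 m1 isT) (o3 m1 isT) (o2 m1 isT) E1 P0 Q0 R0.
have H2 : mrel (em4 m2) = middle_step R P Q.
  by rewrite (o4 m2 isT) (o3 m2 isT) E2 P1 Q1 R1.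
have H3 : mrel (em4 m3) = last_step R P Q.
  by rewrite (o4 m3 isT) E3 P2 Q2 R2.
have H4 : mrel (em4 m4) = expand R (tie (mrel (em mE)) Q) Q.
  by rewrite E4 (tE _ _ O3) Q3 R3.
have fw k : holds (Le (tFullWeigh k) (Var vH)) ev em4 =
    (weigh (signs em) h (full_order (mrel (em mE)) l (mrel (em4 k))) <= h).
  by rewrite holds_le (den_full_weigh _ eh el ln eO4) sE agree // [den _ (Var _) _ _]/= eh.
have -> : decode (em mW) = (P, Q) by rewrite /P /Q; case: (decode _).
have codeE (c : bool) V V' : code (if c then V else V') a b = if c then code V a b else code V' a b.
  by case: c.
rewrite !den_if !fw !(den_pair_of _ _ _ ea eb) H0 H1 H2 H3 H4 /next -/R.
by rewrite !codeE.
Qed.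

Definition main_loop ev em := iteri n (fun k M u v => den n
  (If (Lt (Var vj) (Sub (Var vN) (Cst 2)))
         (Let vl (Sub (Sub (Var vN) (Cst 2)) (Add (Var vj) (Cst 1))) tNext)
         (Get mW vp vq))
  (upd (upd (upd ev vj k) vp u) vq v) (upd em mW M)) (em mW).

Lemma signs_upd em m M : m != mS -> signs (upd em m M) = signs em.
Proof.
move=> mS'; apply/setP=> v; rewrite !inE updE.
by case: (PeanoNat.Nat.eqb_spec mS m) => // E; rewrite E eqxx in mS'.
Qed.

Lemma main_loopE ev em h W : ev vN = n -> ev vH = h ->
  mrel (em mO) = base_order (mrel (em mE)) -> decode (em mW) = W ->
  decode (main_loop ev em) =
  iteri (n - 2) (fun i => next (mrel (em mE)) (signs em) h (n - 2 - i.+1)) W.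
Proof.
move=> eN eh eO eW; rewrite /main_loop (@iteri_morph _ _ decode n _
  (fun i V => if i < n - 2 then next (mrel (em mE)) (signs em) h (n - 2 - i.+1) V else V)).
  by rewrite iteri_guard ?leq_subr // eW.
move=> k M.
have condE u v em' : holds (Lt (Var vj) (Sub (Var vN) (Cst 2)))
    (upd (upd (upd ev vj k) vp u) vq v) em' = (k < n - 2).
  by rewrite holds_lt /= !updE /= eN.
case: ifP => kn; last first.
  apply: eq_decode => u v; cbv beta; rewrite den_if condE kn.
  by rewrite /= !updE /= !ltn_ord.
apply: decode_code => u v; cbv beta; rewrite den_if condE kn den_let.
rewrite (@den_next _ _ h (n - 2 - k.+1) u v) //.
- by rewrite /= !updE /= eN addn1.
- by lia.
Qed.

(* Twice this is the least even number that is at least n / 2, for even n. *)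
Definition quarter := \sum_(i < n) (4 * i < n : nat).

Lemma holds_let x s t ev em :
  holds (Let x s t) ev em = holds t (upd ev x (den n s ev em)) em.
Proof. by []. Qed.

Lemma holds_mat m t b ev em R :
  (forall u v : T, holds t (upd (upd ev vp u) vq v) em = R u v) ->
  exists em', [/\ mrel (em' m) = R, forall m', m' != m -> em' m' = em m'
    & holds (Mat m vp vq t b) ev em = holds b ev em'].
Proof. by move=> /(den_mat m b)[em' [h1 h2 h3]]; exists em'; split=> //; rewrite /holds h3. Qed.

Lemma holds_base ev em (u v : T) : ev vl = n - 2 -> ev vp = u -> ev vq = v ->
  holds (tLevel (And (Get mR vp vp) (And (Get mR vq vq) (Lt (Var vp) (Var vq))))) ev em
  = base_order (mrel (em mE)) u v.
Proof.
move=> el eu ev'; set b := And _ _; rewrite /holds.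
have [em' [eR _ ->]] := holds_level b ev em; rewrite -/(holds b ev em') /b.
rewrite !holds_and holds_lt (@holds_get mR vp vp _ _ u u) // (@holds_get mR vq vq _ _ v v) //.
by rewrite eR (level_matrixE _ el (leq_subr _ _)) /= eu ev'.
Qed.

Lemma holds_answer ev em (v : T) : ev vk = v ->
  holds tAnswer ev em = (v \in answer (mrel (em mE)) (signs em) quarter).
Proof.
move=> ek; set e := mrel (em mE); set plus := signs em.
rewrite /tAnswer holds_let.
have -> : den n (Sum vi (Cst 1)) ev em = n.
  by rewrite -[LHS]/(\sum_(i < n) 1) sum1_card card_ord.
set ev1 := upd ev vN n; rewrite holds_let.
have -> : den n (Sum vi (Bit (Lt (Add (Add (Var vi) (Var vi)) (Add (Var vi) (Var vi))) (Var vN)))) ev1 em = quarter.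
  apply: eq_bigr => i _; rewrite -[LHS]/(den n (Bit (Lt (Add (Add (Var vi) (Var vi)) (Add (Var vi) (Var vi))) (Var vN))) (upd ev1 vi i) em).
  rewrite den_bit holds_lt /= !updE /=; congr (nat_of_bool (_ < _)); lia.
set ev2 := upd ev1 vH quarter; rewrite holds_let.
have -> : den n (Sub (Var vN) (Cst 2)) ev2 em = n - 2 by [].
set ev3 := upd ev2 vl (n - 2).
set b1 := Mat mP _ _ _ _.
set tb := tLevel _.
have HB (u w : T) : holds tb (upd (upd ev3 vp u) vq w) em = base_order e u w.
  exact: holds_base.
have [em1 [EO o1 ->]] := holds_mat mO b1 HB.
rewrite {}/b1; clear HB tb; set b2 := Mat mQ _ _ _ _.
have HP (u w : T) : holds (Get mO vp vq) (upd (upd ev3 vp u) vq w) em1 = base_order e u w.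
  by rewrite (@holds_get mO vp vq _ _ u w) // EO.
have [em2 [EP o2 ->]] := holds_mat mP b2 HP.
rewrite {}/b2; clear HP; set b3 := Let vc _ _.
have HQ (u w : T) : holds (Get mO vq vp) (upd (upd ev3 vp u) vq w) em2 = reverse (base_order e) u w.
  by rewrite (@holds_get mO vq vp _ _ w u) // (o2 mO isT) EO.
have [em3 [EQ o3 ->]] := holds_mat mQ b3 HQ.
rewrite {}/b3 holds_let; clear HQ.
have E3 : em3 mE = em mE by rewrite (o3 mE isT) (o2 mE isT) (o1 mE isT).
have S3 : signs em3 = plus by rewrite /signs (o3 mS isT) (o2 mS isT) (o1 mS isT).
have O3 : mrel (em3 mO) = base_order (mrel (em3 mE)).
  by rewrite E3 (o3 mO isT) (o2 mO isT) EO.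
have P3 : mrel (em3 mP) = base_order e by rewrite (o3 mP isT) EP.
rewrite (@den_full_weigh mP ev3 em3 quarter (n - 2)) //; last exact: leq_subr.
rewrite S3 E3 P3 -/e.
set c := weigh _ _ _; set ev4 := upd ev3 vc c.
set tW := tPair _ _; set b4 := Loop _ _ _ _ _ _.
(* The entries of [mW] matter as numbers from 0 to 3, not only as truth values, so this environment
   is given explicitly. *)
pose em4 := upd em3 mW (fun u w => den n tW (upd (upd ev4 vp u) vq w) em3).
have -> : holds (Mat mW vp vq tW b4) ev4 em3 = holds b4 ev4 em4 by [].
have W4 : decode (em4 mW) = descent_start e plus quarter.
  apply: decode_code => a b; rewrite -[LHS]/(den n tW (upd (upd ev4 vp a) vq b) em3).
  rewrite /tW den_pair (holds_if (Le (Var vH) _)) (holds_if (Le (Var vc) _)) !holds_le (@holds_get mP vp vq _ _ a b) //.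
  rewrite (@holds_get mQ vp vq _ _ a b) // P3 EQ /code /descent_start -/c.
  rewrite -[den n (Var vH) _ _]/quarter -[den n (Var vc) _ _]/c.
  by case: (quarter <= c); case: (c <= quarter).
rewrite {}/b4; set b5 := Mat mP _ _ _ _.
set em5 := upd em4 mW (main_loop ev4 em4).
rewrite -[LHS]/(holds b5 ev4 em5).
have W5 : decode (em5 mW) = descent e plus quarter.
  have O4 : mrel (em4 mO) = base_order (mrel (em4 mE)) := O3.
  have S4 : signs em4 = plus by rewrite signs_upd.
  have := @main_loopE ev4 em4 quarter _ (erefl : ev4 vN = n) (erefl : ev4 vH = quarter) O4 W4.
  by rewrite S4 -[em4 mE]/(em3 mE) E3.
rewrite {}/b5; set b6 := Mat mQ _ _ _ _.
have [em6 [E6 o6 ->]] := @holds_mat mP tFst b6 ev4 em5 _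
  (fun u w => holds_fst em5 (erefl : upd (upd ev4 vp u) vq w vp = u) erefl).
rewrite {}/b6; set b7 := If _ _ _.
have [em7 [E7 o7 ->]] := @holds_mat mQ tSnd b7 ev4 em6 _
  (fun u w => holds_snd em6 (erefl : upd (upd ev4 vp u) vq w vp = u) erefl).
rewrite {}/b7 (o6 mW isT) W5 in E7 *; rewrite W5 in E6.
have P7 : mrel (em7 mP) = (descent e plus quarter).1 by rewrite (o7 mP isT).
have S7 : signs em7 = plus.
  by rewrite /signs (o7 mS isT) (o6 mS isT) -[em5 mS]/(em3 mS) -S3.
rewrite holds_if holds_eq (@den_weigh mP ev4 em7 quarter) // S7 P7.
rewrite -[den n (Var vH) _ _]/quarter.
rewrite !(@holds_initial _ ev4 em7 quarter v) // P7 E7 /answer.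
by case: ifP.
Qed.

End Semantics.

(** * Balanced partitions *)

Section Signs.
Variables (T : finType) (p : T -> int).
Hypothesis p_sign : forall v, p v = (-1)%R \/ p v = 1%R.

Definition positive : {set T} := [set v | p v == 1%R].

Lemma weightE (S : {set T}) :
  weight p S = (#|S :&: positive|%:Z - #|S :\: positive|%:Z)%R.
Proof.
rewrite /weight (big_setID positive) /=; congr (_ + _)%R.
  transitivity (\sum_(v in S :&: positive) 1%R : int)%R.
    by apply: eq_bigr => v; rewrite !inE => /andP[_ /eqP].
  by rewrite GRing.sumr_const natz.
transitivity (\sum_(v in S :\: positive) (-1)%R : int)%R.
  by apply: eq_bigr => v; rewrite !inE; case: (p_sign v) => ->.
by rewrite GRing.sumr_const GRing.mulNrn natz.
Qed.

Lemma weight_eq0 (S : {set T}) :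
  (weight p S = 0%R) <-> #|S| = #|S :&: positive| + #|S :&: positive|.
Proof.
have := cardsID positive S; rewrite weightE.
by move: #|S| #|S :&: positive| #|S :\: positive| => a b c; split; lia.
Qed.

End Signs.

Lemma quarterE n : quarter n = (n + 3) %/ 4.
Proof.
have qn : (n + 3) %/ 4 <= n by lia.
rewrite /quarter -[RHS]muln1 -[X in X * 1]card_ord -sum_nat_const (big_ord_widen n (fun=> 1) qn) [RHS]big_mkcond.
by apply: eq_bigr => i _; case: ifP; lia.
Qed.

Lemma input_adjacency n (e : rel 'I_n) p : mrel (input_env e p mE) = e.
Proof.
apply: rel_ext => u v; rewrite /mrel /input_env /= /adj_array eqb0 negbK.
apply/existsP/idP => [[i /existsP[j /andP[/eqP E eij]]]|euv].
  have [/val_inj -> /val_inj ->] := address_inj (ltn_ord v) (ltn_ord j) E.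
  exact: eij.
by exists u; apply/existsP; exists v; rewrite eqxx.
Qed.

Lemma input_signs n (e : rel 'I_n) p : signs n (input_env e p) = positive p.
Proof.
apply/setP=> v; rewrite !inE /input_env /= mul0n /sign_array eqb0 negbK.
apply/existsP/idP => [[i /andP[/eqP/val_inj-> //]]|pv].
by exists v; rewrite eqxx.
Qed.

Section Partition.
Variables (n : nat) (e : rel 'I_n) (p : 'I_n -> int).
Hypotheses (esym : symmetric e) (e3 : k_connected 3 e).
Hypothesis p_sign : forall v, p v = (-1)%R \/ p v = 1%R.
Hypothesis p_sum : (\sum_(j < n) p j)%R = 0%R.

Definition balanced_part : {set 'I_n} := answer e (positive p) (quarter n).

(** With [h] for [quarter n], the part has [2h] vertices, [h] of them positive. If [n = 4h] this is
    half of all vertices; if [n = 4h - 2] it is one more than half, whence the difference 2. Balance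
    of the complement follows from that of the whole. *)
Lemma balanced_part_correct :
  bipartition balanced_part (~: balanced_part) /\
  connected_on e balanced_part /\ connected_on e (~: balanced_part) /\
  weight p balanced_part = 0%R /\ weight p (~: balanced_part) = 0%R /\
  (n = 0 %[mod 4] -> #|balanced_part| = #|~: balanced_part|) /\
  (n = 2 %[mod 4] -> #|balanced_part| = #|~: balanced_part| + 2).
Proof.
have plus_card : n = #|positive p| + #|positive p|.
  have [+ _] := weight_eq0 p_sign [set: 'I_n]; rewrite setTI cardsT card_ord; apply.
  by rewrite -[RHS]p_sum; apply: eq_bigl => j; rewrite inE.
have h_bounds : n <= 4 * quarter n <= n + 2.
  by move: plus_card; rewrite quarterE; move: #|_| => c; lia.
have plus2 : 2 * #|positive p| = n by rewrite mul2n -addnn.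
have [c1 c2 cV cP] := answer_correct esym e3 h_bounds plus2.
rewrite -/balanced_part in c1 c2 cV cP.
have cC : #|balanced_part| + #|~: balanced_part| = n by rewrite cardsC card_ord.
have cPC : #|~: balanced_part :&: positive p| + #|balanced_part :&: positive p| = #|positive p|.
  by rewrite addnC setIC [~: _ :&: _]setIC -setDE cardsID.
split; first by split; [exact: setICr|exact: setUCr].
do 2 split=> //.
have [_ w1] := weight_eq0 p_sign balanced_part.
have [_ w2] := weight_eq0 p_sign (~: balanced_part).
split; first by apply: w1; rewrite cV cP.
split.
  apply: w2; move: cV cP cC cPC plus_card; move: (quarter n) #|positive p| #|balanced_part|.
  by move: #|balanced_part :&: _| #|~: balanced_part :&: _| #|~: balanced_part| => *; lia.
have q4 : n <= 4 * quarter n < n + 4 by rewrite quarterE; lia.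
by split; move: cV cC q4; move: (quarter n) #|balanced_part| #|~: balanced_part|; lia.
Qed.

End Partition.

(** * Transport to arbitrary vertex types *)

Lemma connected_on_image (T1 T2 : finType) (f : T1 -> T2) (e1 : rel T1) (e2 : rel T2)
    (S : {set T1}) :
  (forall x y, e1 x y -> e2 (f x) (f y)) -> connected_on e1 S -> connected_on e2 (f @: S).
Proof.
move=> ef [S0 con]; split; first by rewrite imset_eq0.
move=> _ _ /imsetP[x xS ->] /imsetP[y yS ->].
have /connectP[q pq ->] := con x y xS yS.
apply/connectP; exists (map f q); last by rewrite last_map.
elim: q x xS pq => //= z q IHq x xS /andP[/and3P[_ zS xz] pq].
by rewrite (IHq z) // andbT /induced /= !imset_f // ef.
Qed.

Theorem theorem1 :
  (forall (T : finType) (e : rel T) (p : T -> int),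
     symmetric e -> irreflexive e -> k_connected 3 e ->
     (forall v : T, p v = (-1)%R \/ p v = 1%R) ->
     (\sum_(j : T) p j)%R = 0%R ->
     (#|T| = 0 %[mod 4] ->
        exists V1 V2 : {set T},
          bipartition V1 V2 /\
          connected_on e V1 /\ connected_on e V2 /\
          weight p V1 = 0%R /\ weight p V2 = 0%R /\
          #|V1| = #|V2|)
     /\
     (#|T| = 2 %[mod 4] ->
        exists V1 V2 : {set T},
          bipartition V1 V2 /\
          connected_on e V1 /\ connected_on e V2 /\
          weight p V1 = 0%R /\ weight p V2 = 0%R /\
          #|V1| = #|V2| + 2))
  /\
  (exists (prog : cmd) (c k : nat),
     forall (n : nat) (e : rel 'I_n) (p : 'I_n -> int),
     symmetric e -> irreflexive e -> k_connected 3 e ->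
     (forall v : 'I_n, p v = (-1)%R \/ p v = 1%R) ->
     (\sum_(j < n) p j)%R = 0%R ->
     exists (t : nat) (s : store),
       exec prog (graph_input e p) t s /\ t <= c * n ^ k /\
       exists V1 V2 : {set 'I_n},
         V1 = set_output n s /\
         bipartition V1 V2 /\
         connected_on e V1 /\ connected_on e V2 /\
         weight p V1 = 0%R /\ weight p V2 = 0%R /\
         (n = 0 %[mod 4] -> #|V1| = #|V2|) /\
         (n = 2 %[mod 4] -> #|V1| = #|V2| + 2)).
Proof.
split.
  move=> T e p esym eirr [T3 econ] p_sign p_sum.
  pose f : 'I_#|T| -> T := enum_val; pose g : T -> 'I_#|T| := enum_rank.
  have fK : cancel f g := enum_valK; have gK : cancel g f := enum_rankK.
  have finj : injective f := can_inj fK.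
  have fbij : bijective f by exists g.
  pose e' : rel 'I_#|T| := fun i j => e (f i) (f j); pose p' i := p (f i).
  have gsurj (V : {set 'I_#|T|}) : g @: (f @: V) = V by rewrite -imset_comp (eq_imset _ fK) imset_id.
  have imC (V : {set 'I_#|T|}) : f @: (~: V) = ~: (f @: V).
    apply/setP=> x; rewrite inE -{1 2}[x]gK !(mem_imset _ _ finj) inE //.
  (* The complement of [X] is the image under [g] of the complement of [f @: X], a cut set of the
     same size. *)
  have e3' : k_connected 3 e'.
    split; first by rewrite card_ord.
    move=> X X3; rewrite -[~: X]gsurj imC; apply: connected_on_image (econ _ _).
      by move=> x y; rewrite /e' !gK.
    by rewrite card_imset.
  have p_sum' : (\sum_(j < #|T|) p' j)%R = 0%R.
    by rewrite -[RHS]p_sum [RHS](reindex f) //; exact: onW_bij.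
  have esym' : symmetric e' by move=> i j; exact: esym.
  have := balanced_part_correct esym' e3' (fun i => p_sign (f i)) p_sum'.
  set V := balanced_part _ _ => -[_ [c1 [c2 [w1 [w2 [s0 s2]]]]]].
  have wE (W : {set 'I_#|T|}) : weight p (f @: W) = weight p' W.
    by rewrite /weight big_imset //; move=> i j _ _; exact: finj.
  have bip : bipartition (f @: V) (f @: (~: V)).
    by rewrite imC; split; [exact: setICr|exact: setUCr].
  have c1' : connected_on e (f @: V) by apply: connected_on_image c1.
  have c2' : connected_on e (f @: (~: V)) by apply: connected_on_image c2.
  split=> Tmod; exists (f @: V), (f @: (~: V)); rewrite !wE !card_imset //; do 5 split=> //.
    exact: s0.
  exact: s2.
have [c [d run]] := program_ok vx vk tAnswer.
(* As [n > 3], [n.+1] is at most [n ^ 2]; doubling the exponent replaces the base [n.+1] by [n]. *)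
exists (program vx vk tAnswer), c, (2 * d) => n e p esym eirr e3 p_sign p_sum.
have [t [s [ex tb out]]] := run n e p; exists t, s; split=> //.
have n4 : 3 < n by have [] := e3; rewrite card_ord.
split.
  apply: leq_trans tb _; rewrite leq_mul2l expnM; apply/orP; right.
  by case: (posnP d) => [->//|d0]; rewrite leq_exp2r // -mulnn; nia.
exists (balanced_part e p), (~: balanced_part e p).
split; last exact: balanced_part_correct.
apply/setP=> v; rewrite [RHS]inE (out v (ltn_ord v)).
have := holds_answer (input_env e p) (erefl : upd (upd (fun=> n) vx 0) vk v vk = v).
by rewrite input_adjacency input_signs => <-.
Qed.
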